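(* Let $d\ge 5$. For every $(\tfrac1p,\tfrac1r)\in\mathcal R(d)$ there is a constant $A=A(d,p,r)$ such that for every $f\in\ell^p(\mathbb Z^d)$ and every $\Lambda\in\{1,2,4,8,\dots\}$, $$\Big\|\sup_{\lambda\in\tilde\Lambda,\ \Lambda\le\lambda<2\Lambda}|\mathscr A_\lambda f|\Big\|_{\ell^{r'}(\mathbb Z^d)}\le A\,\Lambda^{d(1/r'-1/p)}\|f\|_{\ell^p(\mathbb Z^d)}.$$ Moreover, if $1\le p,r\le\infty$ are such that an estimate of this form holds with a constant $A$ independent of $\Lambda\in\{1,2,4,\dots\}$ and $f$, then $\max\{\tfrac1p+\tfrac2d,\ \tfrac1r+\tfrac{2}{pd}\}\le 1$.
   Context: $|x|$ denotes the Euclidean norm on $\mathbb Z^d$. $\tilde\Lambda=\{\lambda>0:\lambda^2\in\mathbb Z,\ \lambda^2\ge1\}$. For $\lambda\in\tilde\Lambda$ and $f:\mathbb Z^d\to\mathbb C$, the discrete spherical average is $\mathscr A_\lambda f(x)=\frac{1}{\#\{y\in\mathbb Z^d:|y|=\lambda\}}\sum_{y\in\mathbb Z^d:|y|=\lambda}f(x-y)$. For $1\le r\le\infty$, $r'$ denotes the conjugate exponent, $1/r+1/r'=1$. $\mathcal R(d)$ is the interior of the convex hull of the three points $(0,1)$, $(\frac{d-2}{d},\frac2d)$, $(\frac{d-2}{d},\frac{d-2}{d})$ in the plane of coordinates $(\frac1p,\frac1r)$. *)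

(* Defs.v *)
From Stdlib Require Import Reals Lra Lia ZArith List.
Import ListNotations.
Open Scope R_scope.

(* Points of Z^d are lists of integers of length d. *)
Definition Zpt := list Z.

Definition vsub (x y : Zpt) : Zpt := map (fun p => (fst p - snd p)%Z) (combine x y).

Definition normsq (y : Zpt) : Z := fold_right (fun a acc => (a * a + acc)%Z) 0%Z y.

Definition zrange (m : nat) : list Z :=
  map (fun i => (Z.of_nat i - Z.of_nat m)%Z) (seq 0 (2 * m + 1)).

Fixpoint box (d m : nat) : list Zpt :=
  match d with
  | O => [ [] ]
  | S d' => flat_map (fun z => map (cons z) (box d' m)) (zrange m)
  end.

(* the lattice sphere {y in Z^d : |y|^2 = n} (all such y lie in {-n..n}^d) *)
Definition sphere (d n : nat) : list Zpt :=
  filter (fun y => Z.eqb (normsq y) (Z.of_nat n)) (box d n).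

Definition Cx := (R * R)%type.
Definition Cmod (z : Cx) : R := sqrt (fst z ^ 2 + snd z ^ 2).

Definition sumR (l : list R) : R := fold_right Rplus 0 l.

(* discrete spherical average A_lambda f (x), with lambda^2 = n *)
Definition sph_avg (d n : nat) (f : Zpt -> Cx) (x : Zpt) : Cx :=
  let S := sphere d n in
  let N := INR (length S) in
  (sumR (map (fun y => fst (f (vsub x y))) S) / N,
   sumR (map (fun y => snd (f (vsub x y))) S) / N).

(* sup over lambda in tilde-Lambda with L <= lambda < 2L of |A_lambda f(x)|,
   i.e. over n = lambda^2 with L^2 <= n < 4 L^2 (a finite set of n >= 1). *)
Definition max_avg (d L : nat) (f : Zpt -> Cx) (x : Zpt) : R :=
  fold_right Rmax 0 (map (fun n => Cmod (sph_avg d n f x)) (seq (L * L) (3 * (L * L)))).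

(* nonnegative real power, 0^q = 0 for q > 0 *)
Definition rpow (a q : R) : R := if Req_EM_T a 0 then 0 else Rpower a q.

(* lp_le d u g C  <->  ||g||_{l^q(Z^d)} <= C, where u = 1/q in [0,1]
   (u = 0 means q = infinity).  Stated via all finite sets of lattice points. *)
Definition lp_le (d : nat) (u : R) (g : Zpt -> R) (C : R) : Prop :=
  if Req_EM_T u 0 then
    forall x : Zpt, length x = d -> Rabs (g x) <= C
  else
    forall S : list Zpt, NoDup S -> Forall (fun x => length x = d) S ->
      sumR (map (fun x => rpow (Rabs (g x)) (1 / u)) S) <= rpow C (1 / u).

(* convex hull of (0,1), ((d-2)/d, 2/d), ((d-2)/d, (d-2)/d) in (1/p,1/r)-plane *)
Definition in_hull (d : nat) (s t : R) : Prop :=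
  exists a b c : R, 0 <= a /\ 0 <= b /\ 0 <= c /\ a + b + c = 1 /\
    s = a * 0 + b * ((INR d - 2) / INR d) + c * ((INR d - 2) / INR d) /\
    t = a * 1 + b * (2 / INR d) + c * ((INR d - 2) / INR d).

Definition regionR (d : nat) (s t : R) : Prop :=
  exists eps : R, 0 < eps /\
    forall s' t' : R, (s' - s) ^ 2 + (t' - t) ^ 2 < eps ^ 2 -> in_hull d s' t'.

(* The estimate with exponents 1/p = s, 1/r = t (so 1/r' = 1 - t), constant A,
   for Lambda = 2^k. *)
Definition max_estimate (d : nat) (s t A : R) : Prop :=
  forall (k : nat) (f : Zpt -> Cx) (C : R), 0 <= C ->
    lp_le d s (fun x => Cmod (f x)) C ->
    lp_le d (1 - t) (max_avg d (2 ^ k) f)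
      (A * Rpower (INR (2 ^ k)) (INR d * ((1 - t) - s)) * C).

(* Main.v *)
(** Sufficiency.  Let 1/r' = u = 1 - t; the region is 2s/(d-2) < u < s < (d-2)/d.  Since d >= 5, Jacobi's
    four-square theorem at odd integers gives N(n) >= c n^(d/2-1) for the number N(n) of lattice points with |y|^2 = n.
    With e(x) = exp(2 pi i x), Q of order L^2 and L = Lambda,
      1_{|y|^2 = n} = Q^-1 sum_{j < Q} e((|y|^2 - n) j / Q),
    so the maximal function is at most C L^(2-d) Q^-1 sum_j |K_j f|, where K_j is convolution with e(|y|^2 j / Q) on a box.
    Weyl differencing bounds K_j on l^2 by T_j^(d/2), where T_j is at most of order L^2 2^(-(1-eps)i) when the best rational
    approximation of j/Q has height 2^i, and at most C 2^(2i) indices j have height 2^i.  The part of height 2^i is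
    therefore bounded by 2^(2i) L^-d from l^1 to l^oo and by 2^((2-(1-eps)d/2)i) on l^2; splitting f into dyadic levels
    and interpolating, the sum over i converges on exponents p -> q with q < d/2 and 1/p + 1/q < 1.  The pointwise inequality
    (A_lambda f)^k <= A_lambda (f^k) and the fact that everything happens on boxes of side L give the whole region.

    Necessity.  Test the point mass at 0 and the indicator function of a sphere with at most C L^(d-2) points. *)
Require Import Defs.
From Stdlib Require Import Reals Lra Lia ZArith List Permutation Psatz.
From Stdlib Require Classical_Prop ListDec.
Import ListNotations.
Open Scope R_scope.

(** * Finite sums, lattice boxes and real powers *)

(** The radius enters the circle-method formula only through the unimodular factors e(-n j / Q), so
    the triangle inequality disposes of the supremum over radii before anything is estimated. What
    remains is the size of exponential sums; neither asymptotics of the averages nor maximal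
    theorems occur. The price is the loss of endpoints, which an open region can afford. For the
    same reason the logarithm in Weyl's inequality is traded for a small power [e]. In the
    coordinates (s, u) = (1/p, 1/r') the interpolated bounds live near the corner ((d-2)/d, 2/d),
    where q = d/2 meets 1/p + 1/q = 1; this is a vertex of the region. Replacing g by g^k moves (s,
    u) along the ray to the origin, lowering the exponent on a box raises u, and u < s enters when
    the boxes are added up. The lower bound for N(n) cannot be imported from dimension four, where
    powers of two have at most 24 representations. A sphere in dimension five is therefore cut at
    heights of the parity opposite to n. *)

Definition lsum {A : Type} (l : list A) (F : A -> R) : R := sumR (map F l).

Lemma lsum_nil {A} (F : A -> R) : lsum [] F = 0.
Proof. reflexivity. Qed.

Lemma lsum_cons {A} (a : A) l F : lsum (a :: l) F = F a + lsum l F.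
Proof. reflexivity. Qed.

Lemma lsum_app {A} (l1 l2 : list A) F : lsum (l1 ++ l2) F = lsum l1 F + lsum l2 F.
Proof.
  induction l1 as [|a l IH]; simpl; [rewrite lsum_nil; lra|].
  rewrite !lsum_cons, IH; lra.
Qed.

Lemma lsum_ext {A} (l : list A) F G :
  (forall x, In x l -> F x = G x) -> lsum l F = lsum l G.
Proof.
  induction l as [|a l IH]; intros H; [reflexivity|].
  rewrite !lsum_cons, (H a (or_introl eq_refl)), IH; [reflexivity|].
  intros x Hx; apply H; right; exact Hx.
Qed.

Lemma lsum_le {A} (l : list A) F G :
  (forall x, In x l -> F x <= G x) -> lsum l F <= lsum l G.
Proof.
  induction l as [|a l IH]; intros H; [rewrite !lsum_nil; lra|].
  rewrite !lsum_cons.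
  apply Rplus_le_compat; [apply H; left; reflexivity|].
  apply IH; intros x Hx; apply H; right; exact Hx.
Qed.

Lemma lsum_zero {A} (l : list A) F : (forall x, In x l -> F x = 0) -> lsum l F = 0.
Proof.
  induction l as [|a l IH]; intros H; [reflexivity|].
  rewrite lsum_cons, (H a (or_introl eq_refl)), IH; [lra|].
  intros x Hx; apply H; right; exact Hx.
Qed.

Lemma lsum_nonneg {A} (l : list A) F : (forall x, In x l -> 0 <= F x) -> 0 <= lsum l F.
Proof.
  intros H. rewrite <- (lsum_zero l (fun _ => 0)) by reflexivity.
  apply lsum_le; exact H.
Qed.

Lemma lsum_plus {A} (l : list A) F G :
  lsum l (fun x => F x + G x) = lsum l F + lsum l G.
Proof.
  induction l as [|a l IH]; [rewrite !lsum_nil; lra|].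
  rewrite !lsum_cons, IH; lra.
Qed.

Lemma lsum_scal {A} (l : list A) c F : lsum l (fun x => c * F x) = c * lsum l F.
Proof.
  induction l as [|a l IH]; [rewrite !lsum_nil; lra|].
  rewrite !lsum_cons, IH; lra.
Qed.

Lemma lsum_scal_r {A} (l : list A) c F : lsum l (fun x => F x * c) = lsum l F * c.
Proof.
  rewrite Rmult_comm, <- lsum_scal. apply lsum_ext; intros; ring.
Qed.

Lemma lsum_opp {A} (l : list A) F : lsum l (fun x => - F x) = - lsum l F.
Proof.
  induction l as [|a l IH]; [rewrite !lsum_nil; lra|].
  rewrite !lsum_cons, IH; lra.
Qed.

Lemma lsum_minus {A} (l : list A) F G :
  lsum l (fun x => F x - G x) = lsum l F - lsum l G.
Proof.
  induction l as [|a l IH]; [rewrite !lsum_nil; lra|].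
  rewrite !lsum_cons, IH; lra.
Qed.

Lemma lsum_const {A} (l : list A) c : lsum l (fun _ => c) = INR (length l) * c.
Proof.
  induction l as [|a l IH]; [rewrite lsum_nil; simpl; lra|].
  rewrite lsum_cons, IH; change (length (a :: l)) with (S (length l)).
  rewrite S_INR; lra.
Qed.

Lemma lsum_map {A B} (l : list A) (h : A -> B) F : lsum (map h l) F = lsum l (fun x => F (h x)).
Proof. unfold lsum; rewrite map_map; reflexivity. Qed.

Lemma lsum_flat_map {A B} (l : list A) (h : A -> list B) F :
  lsum (flat_map h l) F = lsum l (fun x => lsum (h x) F).
Proof.
  induction l as [|a l IH]; [reflexivity|].
  simpl; rewrite lsum_app, lsum_cons, IH; reflexivity.
Qed.

Lemma lsum_filter {A} (l : list A) p F :
  lsum (filter p l) F = lsum l (fun x => if p x then F x else 0).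
Proof.
  induction l as [|a l IH]; [reflexivity|].
  simpl; rewrite lsum_cons; destruct (p a); rewrite ?lsum_cons, IH; lra.
Qed.

Lemma lsum_swap {A B} (l : list A) (l' : list B) (F : A -> B -> R) :
  lsum l (fun x => lsum l' (fun y => F x y)) = lsum l' (fun y => lsum l (fun x => F x y)).
Proof.
  induction l as [|a l IH].
  - symmetry; apply lsum_zero; intros; apply lsum_nil.
  - rewrite lsum_cons, IH, <- lsum_plus. apply lsum_ext; intros; rewrite lsum_cons; reflexivity.
Qed.

Lemma lsum_abs {A} (l : list A) F : Rabs (lsum l F) <= lsum l (fun x => Rabs (F x)).
Proof.
  induction l as [|a l IH]; [rewrite !lsum_nil, Rabs_R0; lra|].
  rewrite !lsum_cons. eapply Rle_trans; [apply Rabs_triang|lra].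
Qed.

Lemma lsum_perm {A} (l l' : list A) F : Permutation l l' -> lsum l F = lsum l' F.
Proof.
  induction 1; rewrite ?lsum_cons; try lra.
Qed.

Lemma lsum_ge_term {A} (l : list A) F a :
  (forall x, In x l -> 0 <= F x) -> In a l -> F a <= lsum l F.
Proof.
  intros H Ha. destruct (in_split _ _ Ha) as (l1 & l2 & ->).
  rewrite lsum_app, lsum_cons.
  assert (0 <= lsum l1 F) by (apply lsum_nonneg; intros; apply H; rewrite in_app_iff; auto).
  assert (0 <= lsum l2 F) by
    (apply lsum_nonneg; intros; apply H; rewrite in_app_iff; right; right; auto).
  lra.
Qed.

Lemma lsum_incl {A} (l l' : list A) F :
  NoDup l -> incl l l' -> (forall x, In x l' -> 0 <= F x) -> lsum l F <= lsum l' F.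
Proof.
  revert l'. induction l as [|a l IH]; intros l' Hn Hi Hp.
  - rewrite lsum_nil; apply lsum_nonneg; exact Hp.
  - inversion Hn; subst.
    destruct (in_split a l') as (l1 & l2 & ->); [apply Hi; left; reflexivity|].
    rewrite lsum_app, !lsum_cons.
    assert (lsum l F <= lsum (l1 ++ l2) F).
    { apply IH; auto.
      - intros x Hx. assert (In x (l1 ++ a :: l2)) as Hx' by (apply Hi; right; exact Hx).
        rewrite in_app_iff in *. destruct Hx' as [|[|]]; auto. subst; contradiction.
      - intros x Hx; apply Hp; rewrite in_app_iff in *; simpl; tauto. }
    rewrite lsum_app in H; lra.
Qed.

Lemma NoDup_map_inj_on {A B} (f : A -> B) l :
  (forall x y, In x l -> In y l -> f x = f y -> x = y) -> NoDup l -> NoDup (map f l).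
Proof.
  induction l as [|a l IH]; intros Hf Hn; simpl; [constructor|].
  inversion Hn; subst. constructor.
  - intros Hin. apply in_map_iff in Hin. destruct Hin as (x & Hx & Hxl).
    assert (x = a) by (apply Hf; [right; auto|left; auto|auto]). subst; contradiction.
  - apply IH; auto. intros; apply Hf; auto; right; auto.
Qed.

Lemma lsum_inj {A B} (l : list A) (l' : list B) (phi : A -> B) F G :
  NoDup l -> (forall x y, In x l -> In y l -> phi x = phi y -> x = y) ->
  (forall x, In x l -> In (phi x) l' /\ F x <= G (phi x)) ->
  (forall y, In y l' -> 0 <= G y) -> lsum l F <= lsum l' G.
Proof.
  intros Hn Hi H Hp.
  apply Rle_trans with (lsum (map phi l) G).
  - rewrite lsum_map; apply lsum_le; intros; apply H; auto.
  - apply lsum_incl; auto.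
    + apply NoDup_map_inj_on; auto.
    + intros y Hy; apply in_map_iff in Hy; destruct Hy as (x & <- & Hx); apply H; auto.
Qed.

Lemma lsum_bij {A B} (l : list A) (l' : list B) (phi : A -> B) (psi : B -> A) F G :
  NoDup l -> NoDup l' ->
  (forall x, In x l -> In (phi x) l' /\ psi (phi x) = x /\ F x = G (phi x)) ->
  (forall y, In y l' -> In (psi y) l /\ phi (psi y) = y) -> lsum l F = lsum l' G.
Proof.
  intros Hn Hn' H H'.
  rewrite (lsum_ext l F (fun x => G (phi x))) by (intros; apply H; auto).
  rewrite <- lsum_map. apply lsum_perm, NoDup_Permutation; auto.
  - apply NoDup_map_inj_on; auto. intros x y Hx Hy E.
    destruct (H x Hx) as (_ & <- & _). destruct (H y Hy) as (_ & <- & _). congruence.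
  - intros y; rewrite in_map_iff; split.
    + intros (x & <- & Hx); apply H; auto.
    + intros Hy; exists (psi y); split; apply H'; auto.
Qed.

Lemma lsum_partition3 {A} (l : list A) (u v : A -> Z) F :
  lsum l F = lsum (filter (fun x => Z.ltb (u x) (v x)) l) F
   + lsum (filter (fun x => Z.eqb (u x) (v x)) l) F
   + lsum (filter (fun x => Z.ltb (v x) (u x)) l) F.
Proof.
  rewrite !lsum_filter, <- !lsum_plus. apply lsum_ext; intros x _.
  destruct (Z.ltb_spec (u x) (v x)), (Z.eqb_spec (u x) (v x)), (Z.ltb_spec (v x) (u x));
    try lia; lra.
Qed.

Lemma lsum_split {A} (l : list A) p F :
  lsum l F = lsum (filter p l) F + lsum (filter (fun x => negb (p x)) l) F.
Proof.
  rewrite !lsum_filter, <- lsum_plus. apply lsum_ext; intros x _. destruct (p x); simpl; lra.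
Qed.

Lemma lsum_cauchy {A} (l : list A) F :
  (lsum l F) ^ 2 <= INR (length l) * lsum l (fun x => F x ^ 2).
Proof.
  induction l as [|a l IH].
  - rewrite !lsum_nil; simpl; lra.
  - rewrite !lsum_cons. change (length (a :: l)) with (S (length l)). rewrite S_INR.
    set (n := INR (length l)) in *. set (S1 := lsum l F) in *.
    set (S2 := lsum l (fun x => F x ^ 2)) in *.
    assert (0 <= n) by apply pos_INR.
    assert (2 * S1 * F a <= S2 + n * F a ^ 2).
    { destruct (Req_dec n 0) as [E|E].
      - assert (S1 ^ 2 <= 0) by (rewrite E in IH; lra).
        assert (S1 = 0) by nra.
        assert (0 <= S2) by (apply lsum_nonneg; intros; apply pow2_ge_0). rewrite H1, E; lra.
      - assert (0 < n) by lra.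
        assert (0 <= (S1 - n * F a) ^ 2) by apply pow2_ge_0.
        apply Rmult_le_reg_l with n; [assumption|]. nra. }
    nra.
Qed.

(** * Lattice boxes and spheres *)

Lemma in_zrange m z : In z (zrange m) <-> (- Z.of_nat m <= z <= Z.of_nat m)%Z.
Proof.
  unfold zrange; rewrite in_map_iff; split.
  - intros (i & <- & Hi); apply in_seq in Hi; lia.
  - intros H; exists (Z.to_nat (z + Z.of_nat m)); rewrite in_seq; lia.
Qed.

Lemma NoDup_zrange m : NoDup (zrange m).
Proof.
  apply NoDup_map_inj_on; [intros; lia|apply seq_NoDup].
Qed.

Lemma length_zrange m : length (zrange m) = (2 * m + 1)%nat.
Proof. unfold zrange; rewrite length_map, length_seq; reflexivity. Qed.

Lemma in_box d m x :
  In x (box d m) <-> length x = d /\ Forall (fun z => (- Z.of_nat m <= z <= Z.of_nat m)%Z) x.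
Proof.
  revert x; induction d as [|d IH]; intros x; simpl.
  - split; [intros [<-|[]]; auto|]. intros [H _]; destruct x; [left; auto|discriminate].
  - rewrite in_flat_map; split.
    + intros (z & Hz & Hx). apply in_map_iff in Hx; destruct Hx as (y & <- & Hy).
      apply IH in Hy; destruct Hy; apply in_zrange in Hz. split; simpl; auto.
    + intros [Hl Hf]. destruct x as [|z y]; [discriminate|]. inversion Hf; subst.
      exists z; rewrite in_zrange; split; auto.
      apply in_map, IH; auto.
Qed.

Lemma NoDup_box d m : NoDup (box d m).
Proof.
  induction d as [|d IH]; simpl; [repeat constructor; auto|].
  generalize (NoDup_zrange m); induction (zrange m) as [|z l IHl]; intros Hz; simpl; [constructor|].
  inversion Hz; subst. apply NoDup_app.
  - apply NoDup_map_inj_on; [congruence|auto].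
  - apply IHl; auto.
  - intros x Hx Hx'. apply in_map_iff in Hx; destruct Hx as (y & <- & _).
    apply in_flat_map in Hx'. destruct Hx' as (z' & Hz' & Hx').
    apply in_map_iff in Hx'. destruct Hx' as (y' & E & _). injection E; intros; subst; contradiction.
Qed.

Lemma lsum_box_S d m F :
  lsum (box (S d) m) F = lsum (zrange m) (fun z => lsum (box d m) (fun y => F (z :: y))).
Proof. simpl; rewrite lsum_flat_map; apply lsum_ext; intros; apply lsum_map. Qed.

Lemma length_box d m : INR (length (box d m)) = (2 * INR m + 1) ^ d.
Proof.
  induction d as [|d IH]; [simpl; lra|].
  assert (E : forall A (l : list A), INR (length l) = lsum l (fun _ => 1))
    by (intros; rewrite lsum_const; lra).
  rewrite E, lsum_box_S.
  rewrite (lsum_ext _ _ (fun _ => (2 * INR m + 1) ^ d)).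
  - rewrite lsum_const, length_zrange, plus_INR, mult_INR; simpl; lra.
  - intros; rewrite lsum_const, IH; lra.
Qed.

Lemma normsq_nonneg y : (0 <= normsq y)%Z.
Proof. induction y; simpl; nia. Qed.

Lemma normsq_coord y z : In z y -> (z * z <= normsq y)%Z.
Proof.
  induction y as [|a y IH]; simpl; [tauto|].
  pose proof (normsq_nonneg y). intros [->|H']; [nia|]. specialize (IH H'); nia.
Qed.

Lemma in_sphere d n y : In y (sphere d n) <-> length y = d /\ normsq y = Z.of_nat n.
Proof.
  unfold sphere; rewrite filter_In, in_box, Z.eqb_eq. split; [tauto|].
  intros [H1 H2]; repeat split; auto.
  apply Forall_forall; intros z Hz. apply normsq_coord in Hz; nia.
Qed.

Lemma NoDup_sphere d n : NoDup (sphere d n).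
Proof. apply NoDup_filter, NoDup_box. Qed.

(** Coordinates are at most sqrt n in absolute value, so any such box enumerates the same points.
    The circle method needs a box of side comparable to the radius, not to its square. *)
Lemma lsum_sphere_box d n M F : (n <= M * M)%nat ->
  lsum (sphere d n) F = lsum (box d M) (fun y => if Z.eqb (normsq y) (Z.of_nat n) then F y else 0).
Proof.
  intros Hn. rewrite <- lsum_filter. apply lsum_perm, NoDup_Permutation.
  - apply NoDup_sphere.
  - apply NoDup_filter, NoDup_box.
  - intros y; rewrite in_sphere, filter_In, in_box, Z.eqb_eq. split; [|tauto].
    intros [H1 H2]; repeat split; auto.
    apply Forall_forall; intros z Hz. apply normsq_coord in Hz; nia.
Qed.

(** * Powers with 0^q = 0, and convexity inequalities *)

Lemma rpow_0 q : rpow 0 q = 0.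
Proof. unfold rpow; destruct (Req_EM_T 0 0); [auto|lra]. Qed.

Lemma rpow_pos_eq a q : 0 < a -> rpow a q = Rpower a q.
Proof. intros; unfold rpow; destruct (Req_EM_T a 0); [lra|auto]. Qed.

Lemma rpow_pos a q : 0 < a -> 0 < rpow a q.
Proof. intros; rewrite rpow_pos_eq by auto; apply exp_pos. Qed.

Lemma rpow_nonneg a q : 0 <= rpow a q.
Proof. unfold rpow; destruct (Req_EM_T a 0); [lra|left; apply exp_pos]. Qed.

Lemma rpow_le a b q : 0 <= a <= b -> 0 <= q -> rpow a q <= rpow b q.
Proof.
  intros [Ha Hb] Hq. destruct Ha as [Ha|<-]; [|rewrite rpow_0; apply rpow_nonneg].
  rewrite !rpow_pos_eq by lra. apply Rle_Rpower_l; lra.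
Qed.

Lemma rpow_rpow a p q : 0 <= a -> rpow (rpow a p) q = rpow a (p * q).
Proof.
  intros [Ha|<-]; [|rewrite !rpow_0; auto].
  rewrite (rpow_pos_eq (rpow a p)) by (apply rpow_pos; auto).
  rewrite !rpow_pos_eq by auto. apply Rpower_mult.
Qed.

Lemma rpow_mult a b q : 0 <= a -> 0 <= b -> rpow (a * b) q = rpow a q * rpow b q.
Proof.
  intros [Ha|<-] [Hb|<-]; rewrite ?Rmult_0_l, ?Rmult_0_r, ?rpow_0; try lra.
  rewrite !rpow_pos_eq by nra. symmetry; apply Rpower_mult_distr; auto.
Qed.

Lemma rpow_plus a p q : 0 <= a -> rpow a (p + q) = rpow a p * rpow a q.
Proof.
  intros [Ha|<-]; [|rewrite !rpow_0; lra].
  rewrite !rpow_pos_eq by auto. apply Rpower_plus.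
Qed.

Lemma rpow_1 a : 0 <= a -> rpow a 1 = a.
Proof. intros [Ha|<-]; [rewrite rpow_pos_eq by auto; apply Rpower_1; auto|apply rpow_0]. Qed.

Lemma rpow_nat a n : 0 < a -> rpow a (INR n) = a ^ n.
Proof. intros Ha; rewrite rpow_pos_eq by auto; apply Rpower_pow; auto. Qed.

Lemma rpow_2 a : 0 <= a -> rpow a 2 = a ^ 2.
Proof.
  intros [Ha|<-]; [|rewrite rpow_0; lra].
  replace 2 with (INR 2) by (simpl; lra). apply rpow_nat; auto.
Qed.

Lemma rpow_ge_1 a q : 1 <= a -> 0 <= q -> 1 <= rpow a q.
Proof.
  intros Ha Hq. rewrite rpow_pos_eq by lra.
  rewrite <- (Rpower_O a) by lra. apply Rle_Rpower; lra.
Qed.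

Lemma rpow_one q : rpow 1 q = 1.
Proof. rewrite rpow_pos_eq by lra. unfold Rpower; rewrite ln_1, Rmult_0_r, exp_0; auto. Qed.

Lemma rpow_le_exp a p q : 1 <= a -> p <= q -> rpow a p <= rpow a q.
Proof. intros; rewrite !rpow_pos_eq by lra. apply Rle_Rpower; auto. Qed.

Lemma rpow_eq_0 a q : rpow a q = 0 -> a = 0.
Proof.
  unfold rpow; destruct (Req_EM_T a 0); auto. intros H; pose proof (exp_pos (q * ln a)).
  unfold Rpower in H; lra.
Qed.

Lemma exp_ge_1_plus x : 1 + x <= exp x.
Proof.
  destruct (Req_dec x 0) as [->|H]; [rewrite exp_0; lra|].
  left; apply exp_ineq1; auto.
Qed.

(* From the tangent line of [exp] at [a * v]. *)
Lemma exp_convex a v : 0 <= a <= 1 -> exp (a * v) <= a * exp v + (1 - a).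
Proof.
  intros [Ha Ha'].
  set (m := a * v).
  assert (E1 : exp m * (1 + (v - m)) <= exp v).
  { replace (exp v) with (exp m * exp (v - m)) by (rewrite <- exp_plus; f_equal; ring).
    apply Rmult_le_compat_l; [left; apply exp_pos|apply exp_ge_1_plus]. }
  assert (E2 : exp m * (1 + (- m)) <= 1).
  { rewrite <- exp_0 at 2. replace (exp 0) with (exp m * exp (- m)) by (rewrite <- exp_plus; f_equal; ring).
    apply Rmult_le_compat_l; [left; apply exp_pos|apply exp_ge_1_plus]. }
  assert (a * (exp m * (1 + (v - m))) + (1 - a) * (exp m * (1 + - m)) = exp m).
  { unfold m; ring. }
  nra.
Qed.

(** This is [exp_convex] with weight 1/k at the point k ln y. *)
Lemma rpow_bernoulli y k : 0 <= y -> 1 <= k -> 1 + k * (y - 1) <= rpow y k.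
Proof.
  intros [Hy|<-] Hk; [|rewrite rpow_0; lra].
  rewrite rpow_pos_eq by auto. unfold Rpower.
  assert (0 < / k <= 1).
  { split; [apply Rinv_0_lt_compat; lra|]. rewrite <- Rinv_1; apply Rinv_le_contravar; lra. }
  pose proof (exp_convex (/ k) (k * ln y)) as C.
  replace (/ k * (k * ln y)) with (ln y) in C by (field; lra).
  rewrite exp_ln in C by auto. specialize (C ltac:(lra)).
  apply (Rmult_le_compat_l k) in C; [|lra].
  replace (k * (/ k * exp (k * ln y) + (1 - / k))) with (exp (k * ln y) + k - 1) in C by (field; lra).
  lra.
Qed.

(** The power lies above its tangent at the mean [m], which is Bernoulli's inequality for x/m;
    averaging the tangent gives m^k. *)
Lemma rpow_jensen {A} (l : list A) w x k :
  1 <= k -> (forall a, In a l -> 0 <= w a) -> (forall a, In a l -> 0 <= x a) ->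
  lsum l w = 1 -> rpow (lsum l (fun a => w a * x a)) k <= lsum l (fun a => w a * rpow (x a) k).
Proof.
  intros Hk Hw Hx Hs. set (m := lsum l (fun a => w a * x a)).
  assert (0 <= m) as [Hm|<-].
  { apply lsum_nonneg; intros; apply Rmult_le_pos; auto. }
  2:{ rewrite rpow_0; apply lsum_nonneg; intros; apply Rmult_le_pos; auto using rpow_nonneg. }
  apply Rle_trans with (lsum l (fun a => rpow m k * (w a * (1 + k * (x a / m - 1))))).
  - rewrite lsum_scal.
    rewrite (lsum_ext _ _ (fun a => (1 - k) * w a + (k / m) * (w a * x a))) by (intros; field; lra).
    rewrite lsum_plus, !lsum_scal, Hs. fold m.
    replace ((1 - k) * 1 + k / m * m) with 1 by (field; lra). lra.
  - apply lsum_le; intros a Ha.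
    replace (rpow (x a) k) with (rpow m k * rpow (x a / m) k).
    + pose proof (rpow_bernoulli (x a / m) k).
      rewrite (Rmult_comm (w a)), (Rmult_comm (w a)), <- !Rmult_assoc.
      apply Rmult_le_compat_r; [auto|].
      apply Rmult_le_compat_l; [apply rpow_nonneg|].
      apply H; auto. apply Rmult_le_pos; [auto|left; apply Rinv_0_lt_compat; auto].
    + rewrite <- rpow_mult; [f_equal; field; lra|lra|].
      apply Rmult_le_pos; [auto|left; apply Rinv_0_lt_compat; auto].
Qed.

Lemma rpow_inv a q : 0 <= a -> rpow (/ a) q = / rpow a q.
Proof.
  intros [Ha|<-]; [|rewrite Rinv_0, !rpow_0, Rinv_0; auto].
  assert (0 < rpow a q) by (apply rpow_pos; auto).
  apply Rmult_eq_reg_l with (rpow a q); [|lra].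
  rewrite <- rpow_mult, !Rinv_r, rpow_one by (try apply Rlt_le, Rinv_0_lt_compat; lra). auto.
Qed.

Lemma rpow_opp a q : 0 <= a -> rpow a (- q) = / rpow a q.
Proof.
  intros [Ha|<-]; [|rewrite !rpow_0, Rinv_0; auto].
  rewrite !rpow_pos_eq by auto. apply Rpower_Ropp.
Qed.

(** Jensen's inequality with probabilities w/W for the values W a/w. It stands in for Minkowski's
    inequality: with geometric weights [w], the q-th powers of arbitrarily many decaying pieces can
    be added without taking roots and without counting the pieces. *)
Lemma rpow_sum_le {A} (l : list A) w a q :
  1 <= q -> (forall x, In x l -> 0 < w x) -> (forall x, In x l -> 0 <= a x) ->
  rpow (lsum l a) q <= rpow (lsum l w) (q - 1) * lsum l (fun x => rpow (w x) (1 - q) * rpow (a x) q).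
Proof.
  intros Hq Hw Ha. destruct l as [|x0 l0] eqn:El.
  { rewrite !lsum_nil, !rpow_0; lra. }
  rewrite <- El in *. set (W := lsum l w).
  assert (HW : 0 < W).
  { unfold W; rewrite El, lsum_cons.
    assert (0 < w x0) by (apply Hw; rewrite El; left; auto).
    assert (0 <= lsum l0 w) by (apply lsum_nonneg; intros; left; apply Hw; rewrite El; right; auto). lra. }
  pose proof (rpow_jensen l (fun x => w x / W) (fun x => W * a x / w x) q Hq) as J.
  assert (Hpos : forall x, In x l -> 0 <= W * a x / w x).
  { intros x Hx. apply Rmult_le_pos; [apply Rmult_le_pos; [lra|auto]|].
    left; apply Rinv_0_lt_compat; auto. }
  rewrite (lsum_ext _ (fun a0 => w a0 / W * (W * a a0 / w a0)) a) in J
    by (intros x Hx; specialize (Hw x Hx); field; lra).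
  eapply Rle_trans; [apply J; auto|].
  - intros x Hx; apply Rmult_le_pos; [left; auto|left; apply Rinv_0_lt_compat; auto].
  - unfold Rdiv; rewrite lsum_scal_r. fold W. field; lra.
  - rewrite <- lsum_scal. right. apply lsum_ext; intros x Hx. specialize (Hw x Hx). specialize (Ha x Hx).
    replace (W * a x / w x) with (W * (a x * / w x)) by (field; lra).
    assert (0 < / w x) by (apply Rinv_0_lt_compat; auto).
    rewrite rpow_mult by (try apply Rmult_le_pos; lra). rewrite rpow_mult, rpow_inv by lra.
    replace q with (1 + (q - 1)) at 1 by ring. rewrite (rpow_plus W), rpow_1 by lra.
    replace (1 - q) with (1 + - q) by ring. rewrite rpow_plus, rpow_opp, rpow_1 by lra.
    assert (0 < rpow (w x) q) by (apply rpow_pos; auto).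
    field; lra.
Qed.

Lemma rpow_add_le x y q : 1 <= q -> 0 <= x -> 0 <= y ->
  rpow (x + y) q <= rpow 2 (q - 1) * (rpow x q + rpow y q).
Proof.
  intros Hq Hx Hy.
  pose proof (rpow_sum_le [true; false] (fun _ => 1) (fun b : bool => if b then x else y) q Hq) as H.
  rewrite !lsum_cons, !lsum_nil, rpow_one in H.
  replace (x + (y + 0)) with (x + y) in H by ring. replace (1 + (1 + 0)) with 2 in H by ring.
  eapply Rle_trans; [apply H|]; [intros; lra|intros [|]; auto|].
  apply Rmult_le_compat_l; [apply rpow_nonneg|lra].
Qed.

(** * Liouville's identity and Jacobi's four-square theorem *)

Definition sg (z : Z) : R := if Z.even z then 1 else -1.

Lemma sg_add a b : sg (a + b) = sg a * sg b.
Proof. unfold sg; rewrite Z.even_add; destruct (Z.even a), (Z.even b); simpl; lra. Qed.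

Lemma sg_sq a : sg a * sg a = 1.
Proof. unfold sg; destruct (Z.even a); lra. Qed.

Lemma sg_eq a b k : (a = b + 2 * k)%Z -> sg a = sg b.
Proof. intros ->; unfold sg; rewrite Z.even_add_mul_2; auto. Qed.

Definition zpos (n : nat) : list Z := map Z.of_nat (seq 1 n).

Lemma in_zpos n z : In z (zpos n) <-> (1 <= z <= Z.of_nat n)%Z.
Proof.
  unfold zpos; rewrite in_map_iff; split.
  - intros (i & <- & Hi); apply in_seq in Hi; lia.
  - intros H; exists (Z.to_nat z); rewrite in_seq; lia.
Qed.

Lemma NoDup_zpos n : NoDup (zpos n).
Proof. apply NoDup_map_inj_on; [intros; lia|apply seq_NoDup]. Qed.

Lemma lsum_list_prod {A B} (l : list A) (l' : list B) F :
  lsum (list_prod l l') F = lsum l (fun a => lsum l' (fun b => F (a, b))).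
Proof.
  induction l as [|a l IH]; [reflexivity|].
  simpl; rewrite lsum_app, lsum_cons, IH, lsum_map; reflexivity.
Qed.

Lemma NoDup_list_prod {A B} (l : list A) (l' : list B) :
  NoDup l -> NoDup l' -> NoDup (list_prod l l').
Proof.
  intros Hl Hl'; induction l as [|a l IH]; simpl; [constructor|].
  inversion Hl; subst. apply NoDup_app; auto.
  - apply NoDup_map_inj_on; [congruence|auto].
  - intros [x y] H H'. apply in_map_iff in H; destruct H as (? & E & _); injection E; intros; subst.
    apply in_prod_iff in H'; tauto.
Qed.

Definition triples (n : nat) : list (Z * Z * Z) :=
  filter (fun t => let '(i, d, e) := t in Z.eqb (i * i + d * e) (Z.of_nat n))
    (list_prod (list_prod (zrange n) (zpos n)) (zpos n)).

Lemma in_triples n i d e :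
  In (i, d, e) (triples n) <-> (i * i + d * e = Z.of_nat n /\ 1 <= d /\ 1 <= e)%Z.
Proof.
  unfold triples; rewrite filter_In, !in_prod_iff, in_zrange, !in_zpos, Z.eqb_eq.
  split; [tauto|]. intros (H & Hd & He). repeat split; nia.
Qed.

Lemma NoDup_triples n : NoDup (triples n).
Proof. apply NoDup_filter, NoDup_list_prod; [apply NoDup_list_prod|]; auto using NoDup_zrange, NoDup_zpos. Qed.

(** Both formulas are dictated by the substitutions below: the first is odd under the involution of
    [liou1_gt], which fixes i + d and negates e - 2i, and becomes the second under the map of
    [liou1_lt]. *)
Definition liou1 (t : Z * Z * Z) : R :=
  let '(i, d, e) := t in sg (i + d + e) * IZR ((e - 2 * i) * (i + d) * (i + d)).
Definition liou2 (t : Z * Z * Z) : R :=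
  let '(i, d, e) := t in sg (i + d + e) * IZR ((d + e) * i * i).

Definition tri_lhs1 (t : Z * Z * Z) : Z := let '(i, d, e) := t in (2 * i + d)%Z.
Definition tri_rhs1 (t : Z * Z * Z) : Z := let '(i, d, e) := t in e.
Definition tri_lhs2 (t : Z * Z * Z) : Z := let '(i, d, e) := t in (2 * i + e)%Z.
Definition tri_rhs2 (t : Z * Z * Z) : Z := let '(i, d, e) := t in d.

Ltac teq := match goal with |- (?a, ?b, ?c) = (?a', ?b', ?c') =>
  let E1 := fresh in let E2 := fresh in let E3 := fresh in
  assert (E1 : a = a') by lia; assert (E2 : b = b') by lia; assert (E3 : c = c') by lia;
  congruence end.

Ltac tsimp := cbv beta iota delta [liou1 liou2 tri_lhs1 tri_lhs2 tri_rhs1 tri_rhs2].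

(* The Heath-Brown--Zagier involution on i^2 + d e = n. *)
Lemma liou1_gt n : lsum (filter (fun t => Z.ltb (tri_rhs1 t) (tri_lhs1 t)) (triples n)) liou1 = 0.
Proof.
  set (l := filter _ _).
  assert (Hin : forall i d e, In (i, d, e) l <->
    (i * i + d * e = Z.of_nat n /\ 1 <= d /\ 1 <= e /\ e < 2 * i + d)%Z).
  { intros; unfold l; rewrite filter_In, in_triples; tsimp; rewrite Z.ltb_lt; tauto. }
  assert (NoDup l) by apply NoDup_filter, NoDup_triples.
  assert (E : lsum l liou1 = lsum l (fun t => - liou1 t)).
  { pose (phi := fun t : Z * Z * Z => let '(i, d, e) := t in ((e - i, 2 * i + d - e, e)%Z)).
    apply lsum_bij with phi phi; unfold phi; auto; intros [[i d] e] Ht; apply Hin in Ht; tsimp.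
    - split; [apply Hin; nia|]. split; [teq|].
      replace (sg (e - i + (2 * i + d - e) + e)) with (sg (i + d + e)) by (f_equal; lia).
      replace ((e - 2 * (e - i)) * (e - i + (2 * i + d - e)) * (e - i + (2 * i + d - e)))%Z
        with (- ((e - 2 * i) * (i + d) * (i + d)))%Z by ring.
      rewrite opp_IZR; ring.
    - split; [apply Hin; nia|]. teq. }
  rewrite lsum_opp in E; lra.
Qed.

(** The map i' = i + d, d' = d, e' = e - 2i - d preserves i^2 + d e, and it sends i + d to i' and e
    - 2i to d' + e'. *)
Lemma liou1_lt n : lsum (filter (fun t => Z.ltb (tri_lhs1 t) (tri_rhs1 t)) (triples n)) liou1 =
  lsum (filter (fun t => Z.ltb (tri_rhs2 t) (tri_lhs2 t)) (triples n)) liou2.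
Proof.
  apply lsum_bij with
    (fun t : Z * Z * Z => let '(i, d, e) := t in ((i + d, d, e - 2 * i - d)%Z))
    (fun t : Z * Z * Z => let '(i, d, e) := t in ((i - d, d, e + 2 * i - d)%Z));
    try apply NoDup_filter, NoDup_triples; intros [[i d] e];
    rewrite filter_In, in_triples; tsimp; rewrite Z.ltb_lt; intros H.
  - rewrite filter_In, in_triples; tsimp; rewrite Z.ltb_lt.
    split; [nia|]. split; [teq|].
    rewrite (sg_eq (i + d + d + (e - 2 * i - d)) (i + d + e) (- i)) by lia.
    f_equal; f_equal; ring.
  - rewrite filter_In, in_triples; tsimp; rewrite Z.ltb_lt.
    split; [nia|]. teq.
Qed.

Lemma liou2_sym n :
  lsum (filter (fun t => Z.ltb (tri_rhs2 t) (tri_lhs2 t)) (triples n)) liou2 =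
  lsum (filter (fun t => Z.ltb (tri_lhs2 t) (tri_rhs2 t)) (triples n)) liou2.
Proof.
  pose (phi := fun t : Z * Z * Z => let '(i, d, e) := t in ((- i, e, d)%Z)).
  apply lsum_bij with phi phi; unfold phi;
    try apply NoDup_filter, NoDup_triples; intros [[i d] e];
    rewrite filter_In, in_triples; tsimp; rewrite Z.ltb_lt; intros H;
    rewrite filter_In, in_triples; tsimp; rewrite Z.ltb_lt.
  - split; [nia|]. split; [teq|].
    rewrite (sg_eq (- i + e + d) (i + d + e) (- i)) by lia.
    f_equal; f_equal; ring.
  - split; [nia|]. teq.
Qed.

Definition diag1 n := lsum (filter (fun t => Z.eqb (tri_lhs1 t) (tri_rhs1 t)) (triples n)) liou1.
Definition diag2 n := lsum (filter (fun t => Z.eqb (tri_lhs2 t) (tri_rhs2 t)) (triples n)) liou2.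

(** Of the three regions for [liou1] one cancels and one is a half of the sum of [liou2], whose two
    halves agree by symmetry; only the diagonals remain. *)
Lemma liouville n : 2 * lsum (triples n) liou1 = lsum (triples n) liou2 + 2 * diag1 n - diag2 n.
Proof.
  rewrite (lsum_partition3 _ tri_lhs1 tri_rhs1 liou1), (lsum_partition3 _ tri_lhs2 tri_rhs2 liou2).
  rewrite liou1_gt, liou1_lt. pose proof (liou2_sym n). unfold diag1, diag2. lra.
Qed.

Lemma triples_neg n F :
  lsum (triples n) (fun t => let '(i, d, e) := t in F i d e) =
  lsum (triples n) (fun t => let '(i, d, e) := t in F (- i)%Z d e).
Proof.
  pose (phi := fun t : Z * Z * Z => let '(i, d, e) := t in ((- i, d, e)%Z)).
  apply lsum_bij with phi phi; unfold phi; try apply NoDup_triples; intros [[i d] e];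
    rewrite in_triples; tsimp; intros H; rewrite in_triples.
  - split; [lia|]. rewrite Z.opp_involutive; auto.
  - split; [lia|]. rewrite Z.opp_involutive; auto.
Qed.

Lemma triples_swap n F :
  lsum (triples n) (fun t => let '(i, d, e) := t in F i d e) =
  lsum (triples n) (fun t => let '(i, d, e) := t in F i e d).
Proof.
  pose (phi := fun t : Z * Z * Z => let '(i, d, e) := t in ((i, e, d)%Z)).
  apply lsum_bij with phi phi; unfold phi; try apply NoDup_triples; intros [[i d] e];
    rewrite in_triples; tsimp; intros H; rewrite in_triples.
  - split; [lia|auto].
  - split; [lia|auto].
Qed.

Definition trisum n (F : Z -> Z -> Z -> Z) : R :=
  lsum (triples n) (fun t => let '(i, d, e) := t in sg (i + d + e) * IZR (F i d e)).

Lemma trisum_neg n F : trisum n F = trisum n (fun i d e => F (- i)%Z d e).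
Proof.
  unfold trisum. rewrite (triples_neg n (fun i d e => sg (i + d + e) * IZR (F i d e))).
  apply lsum_ext; intros [[i d] e] _. f_equal. apply sg_eq with (- i)%Z; lia.
Qed.

Lemma trisum_swap n F : trisum n F = trisum n (fun i d e => F i e d).
Proof.
  unfold trisum. rewrite (triples_swap n (fun i d e => sg (i + d + e) * IZR (F i d e))).
  apply lsum_ext; intros [[i d] e] _. f_equal. f_equal; lia.
Qed.

Lemma trisum_plus n F G : trisum n (fun i d e => F i d e + G i d e)%Z = trisum n F + trisum n G.
Proof.
  unfold trisum; rewrite <- lsum_plus. apply lsum_ext; intros [[i d] e] _. rewrite plus_IZR; lra.
Qed.

Lemma trisum_scal n c F : trisum n (fun i d e => c * F i d e)%Z = IZR c * trisum n F.
Proof.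
  unfold trisum; rewrite <- lsum_scal. apply lsum_ext; intros [[i d] e] _. rewrite mult_IZR; lra.
Qed.

Lemma trisum_ext n F G : (forall i d e, F i d e = G i d e) -> trisum n F = trisum n G.
Proof. intros H; apply lsum_ext; intros [[i d] e] _; rewrite H; auto. Qed.

Lemma trisum_odd n F : (forall i d e, F (- i)%Z d e = (- F i d e)%Z) -> trisum n F = 0.
Proof.
  intros H. pose proof (trisum_neg n F) as E.
  rewrite (trisum_ext n (fun i d e => F (- i)%Z d e) (fun i d e => (-1) * F i d e)%Z) in E by (intros; rewrite H; ring).
  rewrite trisum_scal in E. lra.
Qed.

(** Terms odd in i cancel, and i^2 e may be exchanged for i^2 d. On the triples the surviving factor
    d e - 4 i^2 equals n - 5 i^2, the very factor that spherical symmetry in dimension five produces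
    in [sphere_hd_sq]. *)
Lemma liouville_symmetrized n :
  2 * trisum n (fun i d e => d * (d * e - 4 * (i * i)))%Z = 2 * diag1 n - diag2 n.
Proof.
  pose proof (liouville n) as L.
  change (lsum (triples n) liou1) with (trisum n (fun i d e => (e - 2 * i) * (i + d) * (i + d))%Z) in L.
  change (lsum (triples n) liou2) with (trisum n (fun i d e => (d + e) * i * i)%Z) in L.
  rewrite (trisum_ext n _ (fun i d e => (i * i * e + (-4) * (i * i * d)) + (d * d * e + (2 * (i * d * e) + (-2) * (i * (i * i + d * d)))))%Z) in L
    by (intros; ring).
  rewrite !trisum_plus, !trisum_scal in L.
  rewrite (trisum_odd n (fun i d e => i * d * e)%Z) in L by (intros; ring).
  rewrite (trisum_odd n (fun i d e => i * (i * i + d * d))%Z) in L by (intros; ring).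
  rewrite (trisum_ext n (fun i d e => (d + e) * i * i)%Z (fun i d e => i * i * d + i * i * e)%Z) in L by (intros; ring).
  rewrite trisum_plus in L. rewrite (trisum_swap n (fun i d e => i * i * e)%Z) in L.
  rewrite (trisum_ext n (fun i d e => d * (d * e - 4 * (i * i)))%Z (fun i d e => d * d * e + (-4) * (i * i * d))%Z) by (intros; ring).
  rewrite trisum_plus, trisum_scal. lra.
Qed.

(** On e = 2i + d the form i^2 + d e is (i + d)^2, and on d = 2i + e it is (i + e)^2. *)
Lemma diag_nonsquare n : (forall s : nat, (s * s)%nat <> n) -> diag1 n = 0 /\ diag2 n = 0.
Proof.
  intros H; split; apply lsum_zero; intros [[i d] e];
    rewrite filter_In, in_triples; tsimp; rewrite Z.eqb_eq; intros Ht; exfalso.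
  - apply (H (Z.to_nat (i + d))). nia.
  - apply (H (Z.to_nat (i + e))). nia.
Qed.

Lemma diag1_square s : (1 <= s)%nat ->
  diag1 (s * s) = IZR (Z.of_nat s * Z.of_nat s) * sg (Z.of_nat s) *
    lsum (zpos (2 * s - 1)) (fun d => sg d * IZR d).
Proof.
  intros Hs. rewrite <- lsum_scal. unfold diag1.
  apply lsum_bij with (fun t : Z * Z * Z => let '(i, d, e) := t in d)
    (fun d => (Z.of_nat s - d, d, 2 * Z.of_nat s - d)%Z).
  - apply NoDup_filter, NoDup_triples.
  - apply NoDup_zpos.
  - intros [[i d] e]; rewrite filter_In, in_triples; tsimp; rewrite Z.eqb_eq, in_zpos; intros H.
    assert (i = Z.of_nat s - d)%Z by nia. subst i.
    assert (e = 2 * Z.of_nat s - d)%Z by lia. subst e.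
    split; [lia|]. split; [auto|].
    rewrite (sg_eq _ (Z.of_nat s + d) (Z.of_nat s - d)) by lia. rewrite sg_add, !mult_IZR.
    replace (2 * Z.of_nat s - d - 2 * (Z.of_nat s - d))%Z with d by lia.
    replace (Z.of_nat s - d + d)%Z with (Z.of_nat s) by lia. ring.
  - intros d; rewrite in_zpos; intros H. rewrite filter_In, in_triples; tsimp; rewrite Z.eqb_eq.
    split; [nia|auto].
Qed.

Lemma diag2_square s : (1 <= s)%nat ->
  diag2 (s * s) = 2 * IZR (Z.of_nat s) * sg (Z.of_nat s) *
    lsum (zpos (2 * s - 1)) (fun d => sg d * IZR ((d - Z.of_nat s) * (d - Z.of_nat s))).
Proof.
  intros Hs. rewrite <- lsum_scal. unfold diag2.
  apply lsum_bij with (fun t : Z * Z * Z => let '(i, d, e) := t in d)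
    (fun d => (d - Z.of_nat s, d, 2 * Z.of_nat s - d)%Z).
  - apply NoDup_filter, NoDup_triples.
  - apply NoDup_zpos.
  - intros [[i d] e]; rewrite filter_In, in_triples; tsimp; rewrite Z.eqb_eq, in_zpos; intros H.
    assert (i + e = Z.of_nat s)%Z by nia.
    assert (i = d - Z.of_nat s)%Z by lia. subst i.
    assert (e = 2 * Z.of_nat s - d)%Z by lia. subst e.
    split; [lia|]. split; [auto|].
    rewrite (sg_eq _ (Z.of_nat s + d) 0) by lia. rewrite sg_add, !mult_IZR, plus_IZR, !minus_IZR, mult_IZR.
    ring.
  - intros d; rewrite in_zpos; intros H. rewrite filter_In, in_triples; tsimp; rewrite Z.eqb_eq.
    split; [nia|auto].
Qed.

Lemma sg_sums s : (1 <= s)%nat ->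
  lsum (zpos (2 * s - 1)) sg = -1 /\
  lsum (zpos (2 * s - 1)) (fun d => sg d * IZR d) = - INR s /\
  lsum (zpos (2 * s - 1)) (fun d => sg d * IZR (d * d)) = - INR s * (2 * INR s - 1).
Proof.
  induction s as [|s IH]; [lia|]. intros _.
  destruct (Nat.eq_dec s 0) as [->|Hs].
  - simpl. unfold lsum, sg; simpl. repeat split; lra.
  - destruct IH as (I1 & I2 & I3); [lia|].
    assert (E : zpos (2 * S s - 1) = zpos (2 * s - 1) ++ [Z.of_nat (2 * s); Z.of_nat (2 * s + 1)]).
    { unfold zpos. replace (2 * S s - 1)%nat with ((2 * s - 1) + 2)%nat by lia.
      rewrite seq_app, map_app. f_equal. simpl. repeat f_equal; lia. }
    rewrite E, !lsum_app, I1, I2, I3, !lsum_cons, !lsum_nil.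
    rewrite (sg_eq (Z.of_nat (2 * s)) 0 (Z.of_nat s)) by lia.
    rewrite (sg_eq (Z.of_nat (2 * s + 1)) 1 (Z.of_nat s)) by lia.
    rewrite S_INR, !mult_IZR, <- !INR_IZR_INZ, plus_INR, mult_INR. unfold sg; simpl. repeat split; ring.
Qed.

Lemma diag_square s : (1 <= s)%nat ->
  2 * diag1 (s * s) - diag2 (s * s) = - 2 * INR s ^ 2 * sg (Z.of_nat s).
Proof.
  intros Hs. rewrite diag1_square, diag2_square by auto.
  destruct (sg_sums s Hs) as (I1 & I2 & I3).
  rewrite (lsum_ext _ (fun d => sg d * IZR ((d - Z.of_nat s) * (d - Z.of_nat s)))
    (fun d => sg d * IZR (d * d) - 2 * INR s * (sg d * IZR d) + INR s ^ 2 * sg d)).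
  - rewrite lsum_plus, lsum_minus, !lsum_scal, I1, I2, I3, mult_IZR, <- INR_IZR_INZ. ring.
  - intros d _. rewrite !mult_IZR, minus_IZR, <- INR_IZR_INZ. ring.
Qed.

(** This is Jacobi's sum of the divisors of m not divisible by 4. For m = 2^k m' with m' odd and k
    >= 1 the sign is -1 exactly when both factors are even, and 1 + 2^k - (2 + ... + 2^(k-1)) = 3 =
    1 + 2. The form with two factors matches the triples i^2 + d e = n. *)
Definition sigs (m : Z) : R :=
  lsum (list_prod (zpos (Z.to_nat m)) (zpos (Z.to_nat m)))
    (fun p => if Z.eqb (fst p * snd p) m then sg ((fst p - 1) * (snd p - 1)) * IZR (fst p) else 0).

Lemma sigs_any m k : (m <= Z.of_nat k)%Z -> sigs m =
  lsum (list_prod (zpos k) (zpos k))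
    (fun p => if Z.eqb (fst p * snd p) m then sg ((fst p - 1) * (snd p - 1)) * IZR (fst p) else 0).
Proof.
  intros Hk. unfold sigs. rewrite <- !(lsum_filter _ (fun p => Z.eqb (fst p * snd p) m)).
  apply lsum_perm, NoDup_Permutation;
    try (apply NoDup_filter, NoDup_list_prod; apply NoDup_zpos).
  intros [a b]; rewrite !filter_In, !in_prod_iff, !in_zpos, !Z.eqb_eq; simpl.
  split; intros; repeat split; nia.
Qed.

Lemma sigs_recurrence n :
  lsum (zrange n) (fun i => IZR (Z.of_nat n - 5 * (i * i)) * sigs (Z.of_nat n - i * i)) =
  sg (Z.of_nat n + 1) * trisum n (fun i d e => d * (d * e - 4 * (i * i)))%Z.
Proof.
  unfold trisum, triples. rewrite <- lsum_scal, lsum_filter, !lsum_list_prod. apply lsum_ext; intros i _.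
  rewrite (sigs_any _ n) by nia. rewrite lsum_list_prod, <- lsum_scal. apply lsum_ext; intros d _.
  rewrite <- lsum_scal. apply lsum_ext; intros e _. cbn [fst snd].
  destruct (Z.eqb_spec (d * e) (Z.of_nat n - i * i)), (Z.eqb_spec (i * i + d * e) (Z.of_nat n)); try lia; [|ring].
  replace (d * e - 4 * (i * i))%Z with (Z.of_nat n - 5 * (i * i))%Z by lia.
  rewrite <- (Rmult_assoc (sg (Z.of_nat n + 1))), <- sg_add, mult_IZR.
  (* From d e = n - i^2 follows (d-1)(e-1) = n + 1 + i + d + e modulo 2. The explicit half of the
     difference involves (i^2 + i)/2, hence the split by the parity of i. *)
  destruct (Z.Even_or_Odd i) as [[k ->]|[k ->]].
  - rewrite (sg_eq ((d - 1) * (e - 1)) (Z.of_nat n + 1 + (2 * k + d + e)) (- d - e - 2 * k * k - k)) by nia. ring.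
  - rewrite (sg_eq ((d - 1) * (e - 1)) (Z.of_nat n + 1 + (2 * k + 1 + d + e)) (- d - e - 2 * k * k - 3 * k - 1)) by nia. ring.
Qed.

Lemma sigs_recurrence_value n : (1 <= n)%nat ->
  lsum (zrange n) (fun i => IZR (Z.of_nat n - 5 * (i * i)) * sigs (Z.of_nat n - i * i)) =
  if Nat.eqb (Nat.sqrt n * Nat.sqrt n) n then INR n else 0.
Proof.
  intros Hn. rewrite sigs_recurrence.
  pose proof (liouville_symmetrized n) as L.
  destruct (Nat.eqb_spec (Nat.sqrt n * Nat.sqrt n) n) as [E|E].
  - set (s := Nat.sqrt n) in *. assert (1 <= s)%nat by nia.
    rewrite <- E in L at 2 3. rewrite diag_square in L by auto.
    set (T := trisum _ _) in *.
    replace T with (- INR s ^ 2 * sg (Z.of_nat s)) by lra.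
    rewrite <- E, mult_INR.
    replace (sg (Z.of_nat (s * s) + 1)) with (sg (Z.of_nat s + 1)).
    + rewrite sg_add. unfold sg at 2; simpl. pose proof (sg_sq (Z.of_nat s)). 
      transitivity ((sg (Z.of_nat s) * sg (Z.of_nat s)) * (INR s * INR s)); [ring|rewrite H0; ring].
    + unfold sg; rewrite Nat2Z.inj_mul, !Z.even_add, Z.even_mul. destruct (Z.even (Z.of_nat s)); auto.
  - destruct (diag_nonsquare n) as [E1 E2].
    { intros s Hs. apply E. rewrite <- Hs, Nat.sqrt_square. auto. }
    rewrite E1, E2 in L. replace (trisum n _) with 0 by lra. ring.
Qed.

(** * Representation numbers and their recurrence *)

Definition repcount (d : nat) (m : Z) : R := if Z.ltb m 0 then 0 else INR (length (sphere d (Z.to_nat m))).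

Lemma repcount_nonneg d m : 0 <= repcount d m.
Proof. unfold repcount; destruct (Z.ltb m 0); [lra|apply pos_INR]. Qed.

Lemma repcount_0 d : repcount d 0 = 1.
Proof.
  unfold repcount; simpl.
  assert (E : Permutation (sphere d 0) [repeat 0%Z d]).
  { apply NoDup_Permutation; [apply NoDup_sphere|repeat constructor; auto|].
    intros y; rewrite in_sphere; simpl. split.
    - intros [<- H]. left. induction y as [|a y IH]; [auto|].
      simpl in *. pose proof (normsq_nonneg y). f_equal; [nia|]. apply IH; nia.
    - intros [<-|[]]. rewrite repeat_length; split; auto. induction d; simpl; auto. }
  rewrite (Permutation_length E); simpl; auto.
Qed.

Lemma lsum_sphere_S d n k (F : Z -> R) : (n <= k)%nat ->
  lsum (sphere (S d) n) (fun y => F (hd 0%Z y)) =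
  lsum (zrange k) (fun i => F i * repcount d (Z.of_nat n - i * i)).
Proof.
  intros Hk. rewrite (lsum_sphere_box _ _ k) by nia. rewrite lsum_box_S.
  apply lsum_ext; intros i _. simpl.
  unfold repcount. destruct (Z.ltb_spec (Z.of_nat n - i * i) 0).
  - rewrite Rmult_0_r. apply lsum_zero; intros y _. pose proof (normsq_nonneg y).
    destruct (Z.eqb_spec (i * i + normsq y) (Z.of_nat n)); [lia|auto].
  - rewrite Rmult_comm, <- lsum_const.
    rewrite (lsum_sphere_box _ _ k) by nia. apply lsum_ext; intros y _.
    destruct (Z.eqb_spec (i * i + normsq y) (Z.of_nat n)), (Z.eqb_spec (normsq y) (Z.of_nat (Z.to_nat (Z.of_nat n - i * i)))); try lia; auto.
Qed.

Definition rotl (y : list Z) : list Z := match y with [] => [] | a :: l => l ++ [a] end.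
Definition rotr (y : list Z) : list Z := match rev y with [] => [] | a :: l => a :: rev l end.

Lemma rotr_rotl y : rotr (rotl y) = y.
Proof. destruct y as [|a l]; [auto|]. unfold rotr; simpl. rewrite rev_unit, rev_involutive; auto. Qed.

Lemma rotl_rotr y : rotl (rotr y) = y.
Proof.
  unfold rotr. destruct (rev y) as [|a l] eqn:E.
  - apply (f_equal (@rev Z)) in E; rewrite rev_involutive in E; subst; auto.
  - apply (f_equal (@rev Z)) in E; rewrite rev_involutive in E; subst; auto.
Qed.

Lemma normsq_app a b : normsq (a ++ b) = (normsq a + normsq b)%Z.
Proof. induction a; simpl; lia. Qed.

Lemma in_sphere_rotl d n y : In y (sphere d n) -> In (rotl y) (sphere d n).
Proof.
  rewrite !in_sphere. destruct y as [|a l]; simpl; [auto|].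
  rewrite length_app, normsq_app; simpl; lia.
Qed.

Lemma in_sphere_rotr d n y : In y (sphere d n) -> In (rotr y) (sphere d n).
Proof.
  rewrite !in_sphere. rewrite <- (rotl_rotr y) at 1 2.
  destruct (rotr y) as [|a l]; simpl; [auto|].
  rewrite length_app, normsq_app; simpl; lia.
Qed.

Lemma lsum_sphere_rotl d n F : lsum (sphere d n) F = lsum (sphere d n) (fun y => F (rotl y)).
Proof.
  apply lsum_bij with rotr rotl; try apply NoDup_sphere.
  - intros y Hy; rewrite rotl_rotr; auto using in_sphere_rotr.
  - intros y Hy; rewrite rotr_rotl; auto using in_sphere_rotl.
Qed.

(** Cyclic shifts of the coordinates preserve the sphere, so each of the five coordinates has mean
    square n/5. *)
Lemma sphere_hd_sq n :
  lsum (sphere 5 n) (fun y => IZR (Z.of_nat n - 5 * (hd 0%Z y * hd 0%Z y))) = 0.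
Proof.
  set (q := fun y : list Z => IZR (hd 0%Z y * hd 0%Z y)).
  assert (E : forall k, lsum (sphere 5 n) q = lsum (sphere 5 n) (fun y => q (Nat.iter k rotl y))).
  { induction k as [|k IH]; [reflexivity|].
    rewrite IH, lsum_sphere_rotl. apply lsum_ext; intros y _.
    f_equal. symmetry; apply Nat.iter_succ_r. }
  assert (T : lsum (sphere 5 n) (fun y => IZR (Z.of_nat n)) = 5 * lsum (sphere 5 n) q).
  { replace (5 * lsum (sphere 5 n) q) with
      (lsum (sphere 5 n) q + lsum (sphere 5 n) q + lsum (sphere 5 n) q + lsum (sphere 5 n) q + lsum (sphere 5 n) q) by ring.
    rewrite (E 1%nat) at 2. rewrite (E 2%nat) at 2. rewrite (E 3%nat) at 2. rewrite (E 4%nat) at 2.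
    rewrite <- !lsum_plus. apply lsum_ext; intros y Hy. apply in_sphere in Hy. destruct Hy as [Hl Hn].
    rewrite <- Hn. unfold q. do 6 (destruct y as [|? y]; try discriminate). simpl.
    rewrite !plus_IZR, !mult_IZR. ring. }
  rewrite (lsum_ext _ _ (fun y => IZR (Z.of_nat n) - 5 * q y))
    by (intros; unfold q; rewrite minus_IZR, !mult_IZR; ring).
  rewrite lsum_minus, lsum_scal. unfold Zpt in *; rewrite T; ring.
Qed.

Lemma rep4_recurrence n :
  lsum (zrange n) (fun i => IZR (Z.of_nat n - 5 * (i * i)) * repcount 4 (Z.of_nat n - i * i)) = 0.
Proof.
  rewrite <- (lsum_sphere_S 4 n n (fun i => IZR (Z.of_nat n - 5 * (i * i)))) by lia. apply sphere_hd_sq.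
Qed.

Lemma sigs_nonpos m : (m <= 0)%Z -> sigs m = 0.
Proof. intros H; unfold sigs. replace (Z.to_nat m) with 0%nat by lia. reflexivity. Qed.

Lemma lsum_zrange_squares n : (1 <= n)%nat ->
  lsum (zrange n) (fun i => if Z.eqb (i * i) (Z.of_nat n) then 1 else 0) =
  if Nat.eqb (Nat.sqrt n * Nat.sqrt n) n then 2 else 0.
Proof.
  intros Hn. rewrite <- lsum_filter.
  destruct (Nat.eqb_spec (Nat.sqrt n * Nat.sqrt n) n) as [E|E].
  - set (s := Nat.sqrt n) in *.
    rewrite (lsum_perm _ [Z.of_nat s; (- Z.of_nat s)%Z]); [unfold lsum; simpl; lra|].
    apply NoDup_Permutation.
    + apply NoDup_filter, NoDup_zrange.
    + repeat constructor; simpl; intuition lia.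
    + intros i; rewrite filter_In, in_zrange, Z.eqb_eq; simpl. split; [|intuition nia].
      intros [_ H]. assert ((i - Z.of_nat s) * (i + Z.of_nat s) = 0)%Z by nia. 
      apply Z.eq_mul_0 in H0. lia.
  - apply lsum_zero; intros i; rewrite filter_In, Z.eqb_eq. intros [_ H].
    exfalso; apply E. replace n with (Z.abs_nat i * Z.abs_nat i)%nat at 1 2 3 by nia.
    rewrite Nat.sqrt_square. nia.
Qed.

(** Summing [sphere_hd_sq] over slices gives a homogeneous recurrence for r_4, while [sigs]
    satisfies the same one with right side n at squares. The discrepancy is the value r_4(0) = 1,
    which [sigs] lacks. The difference [a] then satisfies a homogeneous recurrence in which i = 0
    has the nonzero coefficient n, so it vanishes by strong induction. *)
Theorem jacobi_four_squares n : (1 <= n)%nat -> repcount 4 (Z.of_nat n) = 8 * sigs (Z.of_nat n).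
Proof.
  set (a := fun m => if Z.leb m 0 then 0 else repcount 4 m - 8 * sigs m).
  assert (R : forall n, (1 <= n)%nat ->
    lsum (zrange n) (fun i => IZR (Z.of_nat n - 5 * (i * i)) * a (Z.of_nat n - i * i)%Z) = 0).
  { clear n; intros n Hn.
    rewrite (lsum_ext _ _ (fun i => IZR (Z.of_nat n - 5 * (i * i)) * repcount 4 (Z.of_nat n - i * i)
      - 8 * (IZR (Z.of_nat n - 5 * (i * i)) * sigs (Z.of_nat n - i * i))
      (* At i^2 = n the term of [repcount] is (n - 5n) r_4(0) = -4n, while [a] and [sigs] vanish
         there; this summand restores the balance. *)
      + 4 * INR n * (if Z.eqb (i * i) (Z.of_nat n) then 1 else 0))).
    - rewrite lsum_plus, lsum_minus, !lsum_scal, rep4_recurrence, sigs_recurrence_value, lsum_zrange_squares by auto.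
      destruct (Nat.eqb _ _); lra.
    - intros i _. unfold a. destruct (Z.leb_spec (Z.of_nat n - i * i) 0).
      + rewrite sigs_nonpos by auto. destruct (Z.eqb_spec (i * i) (Z.of_nat n)) as [E|E].
        * replace (Z.of_nat n - i * i)%Z with 0%Z by lia. rewrite repcount_0.
          rewrite E, minus_IZR, mult_IZR, <- INR_IZR_INZ. ring.
        * unfold repcount. destruct (Z.ltb_spec (Z.of_nat n - i * i) 0); [ring|lia].
      + destruct (Z.eqb_spec (i * i) (Z.of_nat n)); [lia|ring]. }
  assert (A : forall n, (1 <= n)%nat -> a (Z.of_nat n) = 0).
  { clear n; induction n as [n IH] using lt_wf_ind. intros Hn.
    specialize (R n Hn).
    rewrite (lsum_perm _ (0%Z :: filter (fun i => negb (Z.eqb i 0)) (zrange n))) in R.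
    - rewrite lsum_cons, (lsum_zero (filter _ _)) in R.
      + replace (Z.of_nat n - 5 * (0 * 0))%Z with (Z.of_nat n) in R by lia.
        replace (Z.of_nat n - 0 * 0)%Z with (Z.of_nat n) in R by lia.
        rewrite <- INR_IZR_INZ in R. assert (1 <= INR n) by (apply (le_INR 1); auto). nra.
      + intros i; rewrite filter_In. intros [_ Hi]. destruct (Z.eqb_spec i 0); [discriminate|].
        destruct (Z_le_gt_dec (Z.of_nat n - i * i) 0).
        * unfold a. destruct (Z.leb_spec (Z.of_nat n - i * i) 0); [ring|lia].
        * replace (Z.of_nat n - i * i)%Z with (Z.of_nat (Z.to_nat (Z.of_nat n - i * i))) by lia.
          rewrite IH by nia. ring.
    - apply NoDup_Permutation.
      + apply NoDup_zrange.
      + constructor; [rewrite filter_In; simpl; intuition discriminate|apply NoDup_filter, NoDup_zrange].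
      + intros i; simpl; rewrite filter_In, in_zrange.
        destruct (Z.eqb_spec i 0); simpl; split; intuition (try lia; try discriminate). }
  intros Hn. specialize (A n Hn). unfold a in A.
  destruct (Z.leb_spec (Z.of_nat n) 0); [lia|lra].
Qed.

(** Divisors of an odd number are odd, so every sign is positive, and the pair (m, 1) alone
    contributes m. *)
Lemma sigs_odd_ge m : (1 <= m)%Z -> Z.odd m = true -> IZR m <= sigs m.
Proof.
  intros Hm Ho. unfold sigs.
  set (F := fun p : Z * Z => _).
  replace (IZR m) with (F (m, 1%Z)).
  - apply lsum_ge_term.
    + intros [a b]; rewrite in_prod_iff, !in_zpos. intros H. unfold F; simpl.
      destruct (Z.eqb_spec (a * b) m) as [<-|]; [|lra].
      rewrite Z.odd_mul in Ho. apply andb_prop in Ho. destruct Ho as [Ho _].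
      unfold sg. rewrite Z.even_mul, Z.even_sub.
      rewrite <- Z.negb_odd, Ho; simpl. rewrite Rmult_1_l; apply IZR_le; lia.
    + rewrite in_prod_iff, !in_zpos; lia.
  - unfold F; simpl. rewrite Z.mul_1_r, Z.eqb_refl, Z.mul_0_r. unfold sg; simpl; ring.
Qed.

Lemma rep4_odd_ge m : (1 <= m)%Z -> Z.odd m = true -> 8 * IZR m <= repcount 4 m.
Proof.
  intros Hm Ho. replace m with (Z.of_nat (Z.to_nat m)) at 2 by lia.
  rewrite jacobi_four_squares by lia. rewrite Z2Nat.id by lia.
  pose proof (sigs_odd_ge m Hm Ho). lra.
Qed.

(** * Lattice points on spheres *)

Lemma sphere_count_slices d n :
  INR (length (sphere (S d) n)) = lsum (zrange n) (fun i => repcount d (Z.of_nat n - i * i)).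
Proof.
  rewrite <- (Rmult_1_r (INR _)), <- lsum_const.
  rewrite (lsum_sphere_S d n n (fun _ => 1)) by lia. apply lsum_ext; intros; ring.
Qed.

Lemma sphere_count_S_ge d n J c (i : nat -> Z) :
  (forall a b, i a = i b -> a = b) ->
  (forall j, (j <= J)%nat -> (0 <= i j <= Z.of_nat n)%Z /\ c <= repcount d (Z.of_nat n - i j * i j)) ->
  (INR J + 1) * c <= INR (length (sphere (S d) n)).
Proof.
  intros Hi H. rewrite sphere_count_slices.
  replace ((INR J + 1) * c) with (lsum (seq 0 (S J)) (fun _ => c))
    by (rewrite lsum_const, length_seq, S_INR; auto).
  apply lsum_inj with i; [apply seq_NoDup|auto| |intros; apply repcount_nonneg].
  intros j Hj. apply in_seq in Hj. destruct (H j) as [H1 H2]; [lia|].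
  split; [apply in_zrange; lia|exact H2].
Qed.

Lemma sqrt_lt_Nat_sqrt n : sqrt (INR n) <= INR (Nat.sqrt n) + 1.
Proof.
  rewrite <- S_INR. rewrite <- (sqrt_square (INR (S (Nat.sqrt n)))) by apply pos_INR.
  apply sqrt_le_1_alt. rewrite <- mult_INR. apply le_INR.
  pose proof (Nat.sqrt_specif n). lia.
Qed.

(** The bit [b] makes n - i^2 odd for i = 2j + b, and these heights keep n - i^2 >= n/4. Each of the
    k/4 + 1 slices then has at least 8 (n/4) = 2n points. *)
Lemma sphere5_count_ge n : (1 <= n)%nat -> / 2 * sqrt (INR n) ^ 3 <= INR (length (sphere 5 n)).
Proof.
  intros Hn. set (k := Nat.sqrt n).
  assert (Hk : (k * k <= n)%nat) by (pose proof (Nat.sqrt_specif n); unfold k; lia).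
  pose (b := if Z.odd (Z.of_nat n) then 0%Z else 1%Z).
  apply Rle_trans with ((INR (k / 4) + 1) * (2 * INR n)).
  - pose proof (sqrt_lt_Nat_sqrt n) as S1. fold k in S1.
    assert (S2 : INR k + 1 <= 4 * (INR (k / 4) + 1)).
    { rewrite <- !S_INR. replace 4 with (INR 4) by (simpl; lra). rewrite <- mult_INR. apply le_INR.
      pose proof (Nat.div_mod k 4). pose proof (Nat.mod_upper_bound k 4). lia. }
    replace (sqrt (INR n) ^ 3) with (INR n * sqrt (INR n)).
    + pose proof (pos_INR n). nra.
    + rewrite <- (sqrt_sqrt (INR n)) at 1 by apply pos_INR. ring.
  - apply sphere_count_S_ge with (i := fun j => (2 * Z.of_nat j + b)%Z); [intros; lia|].
    intros j Hj.
    assert (B : (2 * Z.of_nat j + b <= Z.of_nat n)%Z /\ (Z.of_nat n <= 4 * (Z.of_nat n - (2 * Z.of_nat j + b) * (2 * Z.of_nat j + b)))%Z).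
    { assert (Hb : b = 0%Z \/ b = 1%Z /\ (2 <= n)%nat).
      { unfold b. destruct (Z.odd (Z.of_nat n)) eqn:E; auto. right; split; auto.
        destruct (Nat.eq_dec n 1); [subst; discriminate|lia]. }
      pose proof (Nat.div_mod k 4). pose proof (Nat.mod_upper_bound k 4).
      (* For k >= 4 the heights satisfy 4i <= 8j + 4 <= 3k; for smaller k the only slice is j =
         0. *)
      destruct (le_lt_dec 4 k).
      - assert (8 * j + 4 <= 3 * k)%nat by lia. nia.
      - replace (k / 4)%nat with 0%nat in * by (symmetry; apply Nat.div_small; lia).
        assert (j = 0%nat) by lia. subst. destruct Hb as [->|[-> ?]]; lia. }
    assert (b = 0 \/ b = 1)%Z by (unfold b; destruct (Z.odd _); auto).
    split; [lia|].
    apply Rle_trans with (8 * IZR (Z.of_nat n - (2 * Z.of_nat j + b) * (2 * Z.of_nat j + b))).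
    + rewrite INR_IZR_INZ. destruct B as [_ B]. apply IZR_le in B. rewrite mult_IZR in B. lra.
    + apply rep4_odd_ge; [lia|]. rewrite Z.odd_sub, Z.odd_mul, Z.odd_add, Z.odd_mul. simpl.
      unfold b. destruct (Z.odd (Z.of_nat n)); auto.
Qed.

(** Each further dimension gains a factor sqrt n: the slices at heights up to half of sqrt n are
    that numerous and have n - i^2 comparable to n. *)
Theorem sphere_count_ge d : (5 <= d)%nat ->
  exists c, 0 < c /\ forall n, (1 <= n)%nat -> c * sqrt (INR n) ^ (d - 2) <= INR (length (sphere d n)).
Proof.
  induction d as [|d IH]; [lia|]. intros Hd.
  destruct (Nat.eq_dec d 4) as [->|Hd4].
  { exists (/ 2); split; [lra|]. intros; apply sphere5_count_ge; auto. }
  destruct IH as (c & Hc & IH); [lia|].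
  exists (c / 2 ^ (d - 1)). split.
  { apply Rdiv_lt_0_compat; [auto|apply pow_lt; lra]. }
  intros n Hn. set (k := Nat.sqrt n).
  assert (Hk : (k * k <= n)%nat) by (pose proof (Nat.sqrt_specif n); unfold k; lia).
  apply Rle_trans with ((INR (k / 2) + 1) * (c * (sqrt (INR n) / 2) ^ (d - 2))).
  - pose proof (sqrt_lt_Nat_sqrt n) as S1. fold k in S1.
    assert (S2 : INR k + 1 <= 2 * (INR (k / 2) + 1)).
    { rewrite <- !S_INR. replace 2 with (INR 2) by (simpl; lra). rewrite <- mult_INR. apply le_INR.
      pose proof (Nat.div_mod k 2). pose proof (Nat.mod_upper_bound k 2). lia. }
    replace (S d - 2)%nat with (S (d - 2)) by lia. replace (d - 1)%nat with (S (d - 2)) by lia.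
    unfold Rdiv. rewrite Rpow_mult_distr, pow_inv, <- !tech_pow_Rmult.
    assert (0 < 2 ^ (d - 2)) by (apply pow_lt; lra).
    assert (0 <= sqrt (INR n) ^ (d - 2)) by (apply pow_le, sqrt_pos).
    replace (c * / (2 * 2 ^ (d - 2)) * (sqrt (INR n) * sqrt (INR n) ^ (d - 2)))
      with (sqrt (INR n) / 2 * (c * (sqrt (INR n) ^ (d - 2) * / 2 ^ (d - 2)))) by (field; lra).
    apply Rmult_le_compat_r; [|lra].
    apply Rmult_le_pos; [lra|]. apply Rmult_le_pos; [auto|left; apply Rinv_0_lt_compat; auto].
  - apply sphere_count_S_ge with (i := fun j => Z.of_nat j); [intros; lia|].
    intros j Hj. pose proof (Nat.div_mod k 2).
    assert (2 * j <= k)%nat by lia.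
    split; [nia|].
    set (m := Z.to_nat (Z.of_nat n - Z.of_nat j * Z.of_nat j)).
    assert (Hm : (n <= 4 * m)%nat) by (unfold m; nia).
    unfold repcount. destruct (Z.ltb_spec (Z.of_nat n - Z.of_nat j * Z.of_nat j) 0); [nia|].
    fold m. eapply Rle_trans; [|apply IH; lia].
    apply Rmult_le_compat_l; [lra|]. apply pow_incr. split.
    { pose proof (sqrt_pos (INR n)); lra. }
    assert (E : sqrt (INR n) <= sqrt (2 * 2 * INR m)).
    { apply sqrt_le_1_alt. replace (2 * 2) with (INR 4) by (simpl; lra).
      rewrite <- mult_INR. apply le_INR; lia. }
    rewrite sqrt_mult, sqrt_square in E by (try apply pos_INR; lra). lra.
Qed.

(** * Rational approximation and Weyl weights *)

(** The representative of m modulo Q of least absolute value; |[sres Q m]| / Q is the distance from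
    m/Q to the nearest integer. *)
Definition sres (Q m : Z) : Z :=
  let a := (m mod Q)%Z in if Z.leb (2 * a) Q then a else (a - Q)%Z.

Lemma sres_spec Q m : (0 < Q)%Z ->
  (2 * Z.abs (sres Q m) <= Q)%Z /\ exists t, (m = sres Q m + t * Q)%Z.
Proof.
  intros HQ. unfold sres. pose proof (Z.div_mod m Q). pose proof (Z.mod_pos_bound m Q HQ).
  destruct (Z.leb_spec (2 * (m mod Q)) Q).
  - split; [lia|]. exists (m / Q)%Z; lia.
  - split; [lia|]. exists (m / Q + 1)%Z; lia.
Qed.

Lemma sres_min Q m s t : (0 < Q)%Z -> (m = s + t * Q)%Z -> (Z.abs (sres Q m) <= Z.abs s)%Z.
Proof.
  intros HQ E. destruct (sres_spec Q m HQ) as [H1 [t' H2]].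
  destruct (Z.eq_dec t t') as [->|N]; [lia|].
  assert (Q <= Z.abs (sres Q m - s))%Z; [|lia].
  replace (sres Q m - s)%Z with ((t - t') * Q)%Z by lia. rewrite Z.abs_mul. nia.
Qed.

Lemma sres_ge Q m s t : (0 < Q)%Z -> (m = s + t * Q)%Z -> (2 * Z.abs s <= Q)%Z ->
  (Z.abs s <= Z.abs (sres Q m))%Z.
Proof.
  intros HQ E Hs. destruct (sres_spec Q m HQ) as [H1 [t' H2]].
  destruct (Z.eq_dec t t') as [->|N]; [lia|].
  assert (Q <= Z.abs (sres Q m - s))%Z; [|lia].
  replace (sres Q m - s)%Z with ((t - t') * Q)%Z by lia. rewrite Z.abs_mul. nia.
Qed.

Lemma pigeonhole (f : nat -> nat) n : (forall i, (i <= n)%nat -> (f i < n)%nat) ->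
  exists i j, (i < j <= n)%nat /\ f i = f j.
Proof.
  intros Hf.
  destruct (ListDec.NoDup_dec Nat.eq_dec (map f (seq 0 (S n)))) as [Hn|Hn].
  - exfalso. assert (L : (length (map f (seq 0 (S n))) <= length (seq 0 n))%nat).
    { apply NoDup_incl_length; auto. intros y Hy. apply in_map_iff in Hy.
      destruct Hy as (i & <- & Hi). apply in_seq in Hi. apply in_seq. specialize (Hf i). lia. }
    rewrite length_map, !length_seq in L. lia.
  - destruct (Classical_Prop.classic (exists i j, (i < j <= n)%nat /\ f i = f j)) as [|C]; auto.
    exfalso; apply Hn. apply NoDup_map_inj_on; [|apply seq_NoDup].
    intros x y Hx Hy E. apply in_seq in Hx, Hy.
    destruct (lt_eq_lt_dec x y) as [[L|]|L]; auto; exfalso; apply C.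
    + exists x, y; split; [lia|auto].
    + exists y, x; split; [lia|auto].
Qed.

(** Pigeonhole for 2H + 1 multiples in 2H cells. With 2H cells instead of H the residue rho of q j
    satisfies h |rho| <= Q/2 for all h <= H, so that its multiples do not wrap around. *)
Lemma dirichlet Q (H : nat) j : (0 < Q)%Z -> (1 <= H)%nat ->
  exists q, (1 <= q <= 2 * H)%nat /\
    (2 * Z.of_nat H * Z.abs (sres Q (Z.of_nat q * j)) <= Q)%Z.
Proof.
  intros HQ HH. set (K := (2 * Z.of_nat H)%Z).
  set (r := fun i : nat => ((Z.of_nat i * j) mod Q)%Z).
  assert (Hr : forall i, (0 <= r i < Q)%Z) by (intros; apply Z.mod_pos_bound; auto).
  destruct (pigeonhole (fun i => Z.to_nat (r i * K / Q)) (2 * H)) as (a & b & Hab & E).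
  { intros i _. specialize (Hr i). assert (r i * K / Q < K)%Z.
    { apply Z.div_lt_upper_bound; auto. assert (0 < K)%Z by lia. nia. }
    assert (0 <= r i * K / Q)%Z by (apply Z.div_pos; lia). lia. }
  pose proof (Hr a) as Ha. pose proof (Hr b) as Hb.
  assert (0 <= r a * K / Q)%Z by (apply Z.div_pos; lia).
  assert (0 <= r b * K / Q)%Z by (apply Z.div_pos; lia).
  assert (E' : (r a * K / Q = r b * K / Q)%Z) by lia.
  exists (b - a)%nat. split; [lia|].
  assert (B : (K * Z.abs (r b - r a) < Q)%Z).
  { pose proof (Z.div_mod (r a * K) Q). pose proof (Z.mod_pos_bound (r a * K) Q HQ).
    pose proof (Z.div_mod (r b * K) Q). pose proof (Z.mod_pos_bound (r b * K) Q HQ).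
    assert (K * Z.abs (r b - r a) = Z.abs (r b * K - r a * K))%Z by nia. nia. }
  assert (Z.abs (sres Q (Z.of_nat (b - a) * j)) <= Z.abs (r b - r a))%Z; [|nia].
  apply sres_min with (Z.of_nat b * j / Q - Z.of_nat a * j / Q)%Z; auto.
  pose proof (Z.div_mod (Z.of_nat a * j) Q). pose proof (Z.div_mod (Z.of_nat b * j) Q).
  unfold r. rewrite Nat2Z.inj_sub by lia. nia.
Qed.

Lemma least_nat (P : nat -> Prop) n : P n -> exists m, P m /\ forall k, (k < m)%nat -> ~ P k.
Proof.
  induction n as [n IH] using lt_wf_ind. intros Hn.
  destruct (Classical_Prop.classic (exists k, (k < n)%nat /\ P k)) as [(k & Hk & HP)|C].
  - apply (IH k); auto.
  - exists n; split; auto. intros k Hk HP; apply C; exists k; auto.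
Qed.

(** Minimality of q takes the place of a reduced fraction: it is what separates the residues of the
    non-multiples of q from 0. *)
Definition approx_denom (Q j : Z) (H q : nat) : Prop :=
  (1 <= q <= 2 * H)%nat /\ (2 * Z.of_nat H * Z.abs (sres Q (Z.of_nat q * j)) <= Q)%Z /\
  forall q', (1 <= q' < q)%nat -> (Q < 2 * Z.of_nat H * Z.abs (sres Q (Z.of_nat q' * j)))%Z.

Lemma approx_denom_exists Q j H : (0 < Q)%Z -> (1 <= H)%nat -> exists q, approx_denom Q j H q.
Proof.
  intros HQ HH. destruct (dirichlet Q H j HQ HH) as (q0 & H1 & H2).
  destruct (least_nat (fun q => (1 <= q <= 2 * H)%nat /\
    (2 * Z.of_nat H * Z.abs (sres Q (Z.of_nat q * j)) <= Q)%Z) q0) as (q & [H3 H4] & H5); [auto|].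
  exists q; split; [auto|split; auto]. intros q' Hq'.
  specialize (H5 q'). destruct (Z_lt_ge_dec Q (2 * Z.of_nat H * Z.abs (sres Q (Z.of_nat q' * j)))); auto.
  exfalso; apply H5; lia.
Qed.

(** The multiple l rho still has absolute value at most Q/2, hence it is a residue of least absolute
    value. *)
Lemma sres_multiple Q j H q l : (0 < Q)%Z -> approx_denom Q j H q -> (1 <= l)%nat -> (l * q <= H)%nat ->
  (Z.of_nat l * Z.abs (sres Q (Z.of_nat q * j)) <= Z.abs (sres Q (Z.of_nat (l * q) * j)))%Z.
Proof.
  intros HQ (H1 & H2 & H3) Hl Hlq.
  destruct (sres_spec Q (Z.of_nat q * j) HQ) as [_ [t Ht]].
  set (rho := sres Q (Z.of_nat q * j)) in *.
  replace (Z.of_nat l * Z.abs rho)%Z with (Z.abs (Z.of_nat l * rho)) by (rewrite Z.abs_mul; nia).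
  apply sres_ge with (Z.of_nat l * t)%Z; auto.
  - rewrite Nat2Z.inj_mul. nia.
  - rewrite Z.abs_mul. assert (l <= H)%nat by nia. nia.
Qed.

(* q s - h rho vanishes modulo Q; it cannot vanish by minimality of q. *)
Lemma sres_nonmultiple Q j H q h : (0 < Q)%Z -> approx_denom Q j H q ->
  (1 <= h <= H)%nat -> (h mod q <> 0)%nat ->
  (Q <= 2 * Z.of_nat q * Z.abs (sres Q (Z.of_nat h * j)))%Z.
Proof.
  intros HQ (H1 & H2 & H3) Hh Hm.
  destruct (sres_spec Q (Z.of_nat q * j) HQ) as [_ [t Ht]].
  destruct (sres_spec Q (Z.of_nat h * j) HQ) as [_ [u Hu]].
  set (rho := sres Q (Z.of_nat q * j)) in *. set (s := sres Q (Z.of_nat h * j)) in *.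
  set (l := (h / q)%nat). set (h0 := (h mod q)%nat) in *.
  assert (Eh : h = (q * l + h0)%nat) by (apply Nat.div_mod; lia).
  assert (h0 < q)%nat by (apply Nat.mod_upper_bound; lia).
  destruct (Z.eq_dec (Z.of_nat q * s) (Z.of_nat h * rho)) as [E|E].
  - exfalso.
    assert (E' : (Z.of_nat q * (s - Z.of_nat l * rho) = Z.of_nat h0 * rho)%Z) by nia.
    assert (B : (Z.abs (s - Z.of_nat l * rho) <= Z.abs rho)%Z).
    { apply (f_equal Z.abs) in E'. rewrite !Z.abs_mul, !(Z.abs_eq (Z.of_nat _)) in E' by lia.
      apply Z.mul_le_mono_pos_l with (Z.of_nat q); [lia|]. rewrite E'.
      apply Z.mul_le_mono_nonneg_r; lia. }
    assert (B' : (Z.abs (sres Q (Z.of_nat h0 * j)) <= Z.abs (s - Z.of_nat l * rho))%Z).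
    { apply sres_min with (u - Z.of_nat l * t)%Z; auto.
      replace (Z.of_nat h0) with (Z.of_nat h - Z.of_nat l * Z.of_nat q)%Z by lia. nia. }
    specialize (H3 h0 ltac:(lia)).
    assert (2 * Z.of_nat H * Z.abs (sres Q (Z.of_nat h0 * j)) <= 2 * Z.of_nat H * Z.abs rho)%Z
      by (apply Z.mul_le_mono_nonneg_l; lia). lia.
  - assert (D : (Q <= Z.abs (Z.of_nat q * s - Z.of_nat h * rho))%Z).
    { assert (D0 : (Z.of_nat q * s - Z.of_nat h * rho = (Z.of_nat h * t - Z.of_nat q * u) * Q)%Z).
      { replace s with (Z.of_nat h * j - u * Q)%Z by lia.
        replace rho with (Z.of_nat q * j - t * Q)%Z by lia. ring. }
      rewrite D0, Z.abs_mul. assert (Z.of_nat h * t - Z.of_nat q * u <> 0)%Z by nia. nia. }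
    assert (Z.abs (Z.of_nat q * s - Z.of_nat h * rho) <= Z.of_nat q * Z.abs s + Z.of_nat h * Z.abs rho)%Z by nia.
    nia.
Qed.

(** The usual bound for a geometric sum of at most H terms with ratio e(m/Q). *)
Definition wt (Q : Z) (H : nat) (m : Z) : R :=
  if Z.eqb (sres Q m) 0 then INR H else Rmin (INR H) (IZR Q / IZR (Z.abs (sres Q m))).

Lemma wt_le_H Q H m : wt Q H m <= INR H.
Proof. unfold wt; destruct (Z.eqb _ _); [lra|apply Rmin_l]. Qed.

Lemma wt_le Q H m x : (0 < Q)%Z -> 0 < x -> x <= IZR (Z.abs (sres Q m)) -> wt Q H m <= IZR Q / x.
Proof.
  intros HQ Hx Hm. unfold wt. destruct (Z.eqb_spec (sres Q m) 0) as [E|E].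
  - rewrite E in Hm; simpl in Hm; lra.
  - eapply Rle_trans; [apply Rmin_r|]. apply Rmult_le_compat_l; [apply IZR_le; lia|].
    apply Rinv_le_contravar; auto.
Qed.

Lemma wt_nonneg Q H m : (0 < Q)%Z -> 0 <= wt Q H m.
Proof.
  intros HQ. unfold wt. destruct (Z.eqb_spec (sres Q m) 0); [apply pos_INR|].
  apply Rmin_glb; [apply pos_INR|]. left; apply Rdiv_lt_0_compat; apply IZR_lt; lia.
Qed.

Lemma rpow_bernoulli_concave y e : 0 < y -> 0 <= e <= 1 -> rpow y e <= 1 + e * (y - 1).
Proof.
  intros Hy He. rewrite rpow_pos_eq by auto. unfold Rpower.
  pose proof (exp_convex e (ln y) He) as C. rewrite exp_ln in C by auto. lra.
Qed.

(** Concavity gives e x^(e-1) <= x^e - (x-1)^e, and the sum telescopes. *)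
Lemma lsum_power_le e m : 0 < e <= 1 ->
  lsum (seq 1 m) (fun l => rpow (INR l) (e - 1)) <= rpow (INR m) e / e.
Proof.
  intros He. induction m as [|m IH].
  - simpl. rewrite lsum_nil, rpow_0. lra.
  - rewrite seq_S, lsum_app, lsum_cons, lsum_nil.
    replace (1 + m)%nat with (S m) by lia.
    destruct (Nat.eq_dec m 0) as [->|Hm].
    + simpl. rewrite lsum_nil, !rpow_one. assert (1 <= 1 / e); [|lra].
      unfold Rdiv; rewrite Rmult_1_l, <- Rinv_1. apply Rinv_le_contravar; lra.
    + assert (0 < INR m) by (apply lt_0_INR; lia).
      set (x := INR (S m)). assert (Hx : x = INR m + 1) by (unfold x; rewrite S_INR; auto).
      assert (K : rpow (INR m) e <= rpow x e - e * rpow x (e - 1)).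
      { replace (INR m) with (x * (INR m / x)) at 1 by (field; lra).
        rewrite rpow_mult; [|lra|left; apply Rdiv_lt_0_compat; lra].
        pose proof (rpow_bernoulli_concave (INR m / x) e) as B.
        assert (0 < INR m / x) by (apply Rdiv_lt_0_compat; lra).
        specialize (B ltac:(auto) ltac:(lra)).
        replace (rpow x e) with (x * rpow x (e - 1)).
        - replace (x * rpow x (e - 1) - e * rpow x (e - 1)) with (x * rpow x (e - 1) * (1 + e * (INR m / x - 1))).
          + apply Rmult_le_compat_l; [apply Rmult_le_pos; [lra|apply rpow_nonneg]|auto].
          + rewrite Hx. field. lra.
        - rewrite <- (rpow_1 x) at 1 by lra. rewrite <- rpow_plus by lra. f_equal; ring. }
      assert (rpow (INR m) e / e <= (rpow x e - e * rpow x (e - 1)) / e).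
      { apply Rmult_le_compat_r; [left; apply Rinv_0_lt_compat; lra|auto]. }
      replace ((rpow x e - e * rpow x (e - 1)) / e) with (rpow x e / e - rpow x (e - 1)) in H0 by (field; lra).
      lra.
Qed.

(** Applied to min(H, c/l), this makes the sum over l a power of H where the harmonic sum would give
    a logarithm. *)
Lemma le_geometric_mean x a b e : 0 <= x -> x <= a -> x <= b -> 0 <= e <= 1 ->
  x <= rpow a e * rpow b (1 - e).
Proof.
  intros Hx Ha Hb He. rewrite <- (rpow_1 x) at 1 by auto.
  replace 1 with (e + (1 - e)) at 1 by ring. rewrite rpow_plus by auto.
  apply Rmult_le_compat; try apply rpow_nonneg; apply rpow_le; lra.
Qed.

(** If q <= N, the hypothesis at q and [sres_multiple] bound the weight at h = l q by H^2/(N l),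
    which is interpolated with the trivial bound H. If q > N, there are at most H/N multiples of q,
    each of weight at most H. *)
Lemma wt_sum_multiples Q (D : R) j H N q e : (0 < Q)%Z -> 0 < D -> IZR Q = D * INR H ^ 2 ->
  (1 <= N <= H)%nat -> 0 < e <= 1 -> approx_denom Q j H q ->
  (forall q', (1 <= q' <= N)%nat -> D * INR N <= IZR (Z.abs (sres Q (Z.of_nat q' * j)))) ->
  lsum (filter (fun h => Nat.eqb (h mod q) 0) (seq 1 H)) (fun h => wt Q H (Z.of_nat h * j))
   <= / e * INR H ^ 2 * rpow (INR N) (e - 1).
Proof.
  intros HQ HD EQ HN He Hq Hmaj.
  assert (1 <= INR N) by (apply (le_INR 1); lia).
  assert (INR N <= INR H) by (apply le_INR; lia).
  assert (Hie : 1 <= / e) by (rewrite <- Rinv_1; apply Rinv_le_contravar; lra).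
  pose proof Hq as (Hq1 & Hq2 & Hq3).
  assert (Hin : forall h, In h (filter (fun h => Nat.eqb (h mod q) 0) (seq 1 H)) ->
     (1 <= h <= H /\ h = h / q * q /\ 1 <= h / q <= H / q)%nat).
  { intros h; rewrite filter_In, in_seq, Nat.eqb_eq; intros [G1 G2].
    pose proof (Nat.div_mod h q ltac:(lia)) as E.
    split; [lia|split; [lia|]]. split; [|apply Nat.Div0.div_le_mono; lia].
    destruct (h / q)%nat; lia. }
  assert (Hinj : forall x y, In x (filter (fun h => Nat.eqb (h mod q) 0) (seq 1 H)) ->
     In y (filter (fun h => Nat.eqb (h mod q) 0) (seq 1 H)) -> (x / q = y / q)%nat -> x = y).
  { intros x y Hx Hy E. apply Hin in Hx, Hy. destruct Hx as (_ & -> & _), Hy as (_ & -> & _). congruence. }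
  destruct (le_lt_dec q N) as [Hle|Hlt].
  - apply Rle_trans with (lsum (seq 1 H) (fun l => INR H ^ 2 * rpow (INR H) (- e) * rpow (INR N) (e - 1) * rpow (INR l) (e - 1))).
    + apply lsum_inj with (fun h => (h / q)%nat); [apply NoDup_filter, seq_NoDup|auto| |].
      * intros h Hh. apply Hin in Hh. destruct Hh as (G1 & G2 & G3).
        assert (H / q <= H)%nat by (apply Nat.Div0.div_le_upper_bound; nia).
        split; [apply in_seq; lia|]. set (l := (h / q)%nat) in *.
        assert (1 <= INR l) by (apply (le_INR 1); lia).
        assert (B : wt Q H (Z.of_nat h * j) <= INR H ^ 2 / (INR N * INR l)).
        { replace (INR H ^ 2 / (INR N * INR l)) with (IZR Q / (D * INR N * INR l)) by (rewrite EQ; field; lra).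
          apply wt_le; [auto|apply Rmult_lt_0_compat; [apply Rmult_lt_0_compat|]; lra|].
          rewrite G2. eapply Rle_trans; [|apply IZR_le, (sres_multiple Q j H q l); auto; lia].
          rewrite mult_IZR, <- INR_IZR_INZ. rewrite Rmult_comm. apply Rmult_le_compat_l; [lra|].
          apply Hmaj; lia. }
        assert (0 < INR H ^ 2) by (apply pow_lt; lra).
        eapply Rle_trans; [apply le_geometric_mean with (e := e); [apply wt_nonneg; auto|apply wt_le_H|exact B|lra]|].
        right. unfold Rdiv. rewrite rpow_mult, rpow_inv, rpow_mult; try nra.
        2:{ left; apply Rinv_0_lt_compat; nra. }
        rewrite <- rpow_2, rpow_rpow by lra.
        replace (e - 1) with (- (1 - e)) by ring. rewrite !(rpow_opp _ (1 - e)) by lra.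
        rewrite Rinv_mult. rewrite <- Rmult_assoc, <- rpow_plus by lra.
        rewrite <- rpow_plus by lra. rewrite !Rmult_assoc. do 2 f_equal. ring.
      * intros l _. repeat apply Rmult_le_pos; try apply rpow_nonneg; lra.
    + rewrite lsum_scal.
      eapply Rle_trans; [apply Rmult_le_compat_l; [|apply lsum_power_le; auto]|].
      * repeat apply Rmult_le_pos; try apply rpow_nonneg; lra.
      * right. rewrite rpow_opp by lra. assert (0 < rpow (INR H) e) by (apply rpow_pos; lra). field. lra.
  - apply Rle_trans with (lsum (seq 1 (H / q)) (fun _ => INR H)).
    + apply lsum_inj with (fun h => (h / q)%nat); [apply NoDup_filter, seq_NoDup|auto| |].
      * intros h Hh. apply Hin in Hh. split; [apply in_seq; lia|apply wt_le_H].
      * intros; lra.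
    + rewrite lsum_const, length_seq.
      assert (INR (H / q) * INR N <= INR H).
      { rewrite <- mult_INR. apply le_INR. pose proof (Nat.div_mod H q). nia. }
      assert (INR (H / q) <= INR H / INR N).
      { apply Rmult_le_reg_r with (INR N); [lra|]. replace (INR H / INR N * INR N) with (INR H) by (field; lra). lra. }
      assert (/ INR N <= rpow (INR N) (e - 1)).
      { rewrite <- (rpow_1 (INR N)) at 1 by lra. rewrite <- rpow_opp by lra. apply rpow_le_exp; lra. }
      pose proof (rpow_nonneg (INR N) (e - 1)).
      apply Rle_trans with (INR H ^ 2 * rpow (INR N) (e - 1)).
      * apply Rle_trans with (INR H ^ 2 * / INR N); [unfold Rdiv in *; nra|].
        apply Rmult_le_compat_l; [apply pow2_ge_0|auto].
      * rewrite Rmult_assoc. assert (0 <= INR H ^ 2 * rpow (INR N) (e - 1)) by (apply Rmult_le_pos; [apply pow2_ge_0|auto]). nra.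
Qed.

(** Within a block of h with equal h/q, residues are separated from one another by Q/(2q), and they
    stay as far from 0. The cell numbers [m h] are then distinct and nonzero, so each block
    contributes a harmonic sum of 4q/|m|. There are H/q + 1 blocks, and q <= 2H gives (H/q + 1) q <=
    3H. *)
Lemma wt_sum_nonmultiples Q j H q e : (0 < Q)%Z -> (1 <= H)%nat -> 0 < e <= 1 -> approx_denom Q j H q ->
  lsum (filter (fun h => negb (Nat.eqb (h mod q) 0)) (seq 1 H)) (fun h => wt Q H (Z.of_nat h * j))
   <= 48 / e * INR H * rpow (INR H) e.
Proof.
  intros HQ HH He Hq. pose proof Hq as (Hq1 & Hq2 & Hq3).
  set (s := fun h : nat => sres Q (Z.of_nat h * j)).
  set (m := fun h : nat => (2 * Z.of_nat q * s h / Q)%Z).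
  set (G := fun a : Z => if Z.eqb a 0 then 0 else 4 * INR q / IZR (Z.abs a)).
  assert (HG : forall a, 0 <= G a).
  { intros a; unfold G; destruct (Z.eqb_spec a 0); [lra|].
    apply Rmult_le_pos; [pose proof (pos_INR q); lra|left; apply Rinv_0_lt_compat, IZR_lt; lia]. }
  assert (Hin : forall h, In h (filter (fun h => negb (Nat.eqb (h mod q) 0)) (seq 1 H)) ->
     (1 <= h <= H /\ h mod q <> 0)%nat).
  { intros h; rewrite filter_In, in_seq. destruct (Nat.eqb_spec (h mod q) 0); simpl; intros [? ?]; [discriminate|lia]. }
  assert (Hm : forall h, (m h * Q <= 2 * Z.of_nat q * s h < m h * Q + Q)%Z).
  { intros h. unfold m. pose proof (Z.div_mod (2 * Z.of_nat q * s h) Q).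
    pose proof (Z.mod_pos_bound (2 * Z.of_nat q * s h) Q). lia. }
  apply Rle_trans with (lsum (list_prod (seq 0 (S (H / q))) (zrange q)) (fun p => G (snd p))).
  - apply lsum_inj with (fun h => ((h / q)%nat, m h)); [apply NoDup_filter, seq_NoDup| | |intros; auto].
    + intros x y Hx Hy E. apply Hin in Hx, Hy. injection E; intros E2 E1.
      pose proof (Hm x) as Mx. pose proof (Hm y) as My. rewrite E2 in Mx.
      assert (C : forall a b, (a < b)%nat -> (1 <= a <= H)%nat -> (1 <= b <= H)%nat -> (a / q = b / q)%nat ->
         m a = m b -> False).
      { intros a b Hab Ha Hb E3 E4. pose proof (Hm a) as Ma. pose proof (Hm b) as Mb. rewrite E4 in Ma.
        pose proof (Nat.div_mod a q). pose proof (Nat.div_mod b q).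
        pose proof (Nat.mod_upper_bound a q). pose proof (Nat.mod_upper_bound b q).
        assert (L : (Q <= 2 * Z.of_nat q * Z.abs (sres Q (Z.of_nat (b - a) * j)))%Z).
        { apply sres_nonmultiple with H; auto; [lia|]. rewrite Nat.mod_small; nia. }
        assert (L' : (Z.abs (sres Q (Z.of_nat (b - a) * j)) <= Z.abs (s b - s a))%Z).
        { destruct (sres_spec Q (Z.of_nat a * j) HQ) as [_ [t Ht]].
          destruct (sres_spec Q (Z.of_nat b * j) HQ) as [_ [u Hu]].
          apply sres_min with (u - t)%Z; auto. unfold s. rewrite Nat2Z.inj_sub by lia. lia. }
        assert (2 * Z.of_nat q * Z.abs (s b - s a) < Q)%Z by nia. nia. }
      destruct (lt_eq_lt_dec x y) as [[L|]|L]; auto; exfalso.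
      * apply (C x y); tauto.
      * apply (C y x); auto; tauto.
    + intros h Hh. apply Hin in Hh. destruct Hh as [Hh1 Hh2]. specialize (Hm h).
      pose proof (sres_nonmultiple Q j H q h HQ Hq Hh1 Hh2) as L.
      destruct (sres_spec Q (Z.of_nat h * j) HQ) as [B _]. fold (s h) in *.
      assert (m h <> 0)%Z by nia.
      split.
      * apply in_prod_iff. split; [apply in_seq; pose proof (Nat.Div0.div_le_mono h H q); lia|].
        apply in_zrange. nia.
      * simpl. unfold G. destruct (Z.eqb_spec (m h) 0); [contradiction|].
        (* Rounding down at most doubles the absolute value of 2 q s / Q, which is at least 1; hence
           the 4. *)
        assert (Hsm : (Z.abs (m h) * Q <= 4 * Z.of_nat q * Z.abs (s h))%Z) by nia.
        replace (4 * INR q / IZR (Z.abs (m h))) with (IZR Q / (IZR Q * IZR (Z.abs (m h)) / (4 * INR q))).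
        { assert (0 < IZR Q) by (apply IZR_lt; auto). assert (0 < IZR (Z.abs (m h))) by (apply IZR_lt; lia).
          assert (0 < INR q) by (apply lt_0_INR; lia).
          apply wt_le; auto.
          - apply Rdiv_lt_0_compat; nra.
          - apply IZR_le in Hsm. rewrite !mult_IZR, <- INR_IZR_INZ in Hsm. fold (s h).
            apply Rmult_le_reg_r with (4 * INR q); [lra|].
            replace (IZR Q * IZR (Z.abs (m h)) / (4 * INR q) * (4 * INR q)) with (IZR Q * IZR (Z.abs (m h))) by (field; lra).
            lra. }
        assert (0 < IZR Q) by (apply IZR_lt; auto). assert (0 < IZR (Z.abs (m h))) by (apply IZR_lt; lia).
        assert (0 < INR q) by (apply lt_0_INR; lia). field. lra.
  - rewrite lsum_list_prod. cbn [snd]. rewrite lsum_const, length_seq.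
    assert (1 <= INR q) by (apply (le_INR 1); lia).
    assert (1 <= INR H) by (apply (le_INR 1); lia).
    assert (Hie : 0 < / e) by (apply Rinv_0_lt_compat; lra).
    assert (S1 : lsum (zrange q) G <= 8 * INR q * (rpow (INR q) e / e)).
    { apply Rle_trans with (2 * lsum (seq 1 q) (fun l => G (Z.of_nat l))).
      - apply Rle_trans with (lsum (list_prod [true; false] (seq 1 q)) (fun p => G (Z.of_nat (snd p)))).
        + rewrite (lsum_split _ (fun a => Z.eqb a 0)), (lsum_zero (filter (fun a => Z.eqb a 0) _)), Rplus_0_l.
          2:{ intros a; rewrite filter_In, Z.eqb_eq; intros [_ ->]; reflexivity. }
          apply lsum_inj with (fun a => (Z.ltb 0 a, Z.abs_nat a)); [apply NoDup_filter, NoDup_zrange| | |intros; auto].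
          * intros x y _ _ E; injection E; intros E1 E2.
            destruct (Z.ltb_spec 0 x), (Z.ltb_spec 0 y); try discriminate; lia.
          * intros a; rewrite filter_In, in_zrange; intros [G1 G2].
            destruct (Z.eqb_spec a 0); [discriminate|]. split.
            -- apply in_prod_iff; split; [destruct (Z.ltb 0 a); simpl; auto|apply in_seq; lia].
            -- cbn [snd]. unfold G. destruct (Z.eqb_spec a 0); [lia|].
               destruct (Z.eqb_spec (Z.of_nat (Z.abs_nat a)) 0); [lia|].
               replace (Z.abs (Z.of_nat (Z.abs_nat a))) with (Z.abs a) by lia. lra.
        + rewrite lsum_list_prod, !lsum_cons, lsum_nil. cbn [snd]. lra.
      - apply Rle_trans with (2 * lsum (seq 1 q) (fun l => 4 * INR q * rpow (INR l) (e - 1))).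
        + apply Rmult_le_compat_l; [lra|]. apply lsum_le. intros l Hl; apply in_seq in Hl.
          assert (1 <= INR l) by (apply (le_INR 1); lia).
          unfold G. destruct (Z.eqb_spec (Z.of_nat l) 0); [lia|].
          rewrite Z.abs_eq, <- INR_IZR_INZ by lia. unfold Rdiv. apply Rmult_le_compat_l; [lra|].
          rewrite <- (rpow_1 (INR l)) at 1 by lra. rewrite <- rpow_opp by lra. apply rpow_le_exp; lra.
        + rewrite lsum_scal. pose proof (lsum_power_le e q He). nra. }
    assert (S2 : INR (S (H / q)) * INR q <= 3 * INR H).
    { rewrite <- mult_INR. replace 3 with (INR 3) by (simpl; lra). rewrite <- mult_INR. apply le_INR.
      pose proof (Nat.div_mod H q). nia. }
    assert (S3 : rpow (INR q) e <= 2 * rpow (INR H) e).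
    { apply Rle_trans with (rpow (2 * INR H) e).
      - apply rpow_le; [|lra]. split; [lra|]. replace 2 with (INR 2) by (simpl; lra).
        rewrite <- mult_INR. apply le_INR; lia.
      - rewrite rpow_mult by lra. apply Rmult_le_compat_r; [apply rpow_nonneg|].
        rewrite <- (rpow_1 2) at 2 by lra. apply rpow_le_exp; lra. }
    pose proof (rpow_nonneg (INR q) e). pose proof (pos_INR (S (H / q))).
    apply Rle_trans with (INR (S (H / q)) * (8 * INR q * (rpow (INR q) e / e))).
    { apply Rmult_le_compat_l; auto. }
    replace (INR (S (H / q)) * (8 * INR q * (rpow (INR q) e / e))) with ((INR (S (H / q)) * INR q) * (8 * / e * rpow (INR q) e)) by (field; lra).
    apply Rle_trans with (3 * INR H * (8 * / e * rpow (INR q) e)).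
    { apply Rmult_le_compat_r; [|auto]. apply Rmult_le_pos; [lra|auto]. }
    replace (48 / e * INR H * rpow (INR H) e) with (3 * INR H * (8 * / e * (2 * rpow (INR H) e))) by (field; lra).
    apply Rmult_le_compat_l; [lra|]. apply Rmult_le_compat_l; [lra|auto].
Qed.

Theorem wt_sum_minor Q (D : R) j H N e : (0 < Q)%Z -> 0 < D -> IZR Q = D * INR H ^ 2 ->
  (1 <= N <= H)%nat -> 0 < e <= 1 ->
  (forall q, (1 <= q <= N)%nat -> D * INR N <= IZR (Z.abs (sres Q (Z.of_nat q * j)))) ->
  lsum (seq 1 H) (fun h => wt Q H (Z.of_nat h * j)) <= 49 / e * INR H ^ 2 * rpow (INR N) (e - 1).
Proof.
  intros HQ HD EQ HN He Hmaj.
  destruct (approx_denom_exists Q j H HQ) as [q Hq]; [lia|].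
  rewrite (lsum_split _ (fun h => Nat.eqb (h mod q) 0)).
  pose proof (wt_sum_multiples Q D j H N q e HQ HD EQ HN He Hq Hmaj) as S1.
  pose proof (wt_sum_nonmultiples Q j H q e HQ ltac:(lia) He Hq) as S2.
  assert (1 <= INR N) by (apply (le_INR 1); lia).
  assert (INR N <= INR H) by (apply le_INR; lia).
  assert (S3 : INR H * rpow (INR H) e <= INR H ^ 2 * rpow (INR N) (e - 1)).
  { replace (INR H * rpow (INR H) e) with (INR H ^ 2 * rpow (INR H) (e - 1)).
    - apply Rmult_le_compat_l; [apply pow2_ge_0|].
      replace (e - 1) with (- (1 - e)) by ring. rewrite !rpow_opp by lra.
      apply Rinv_le_contravar; [apply rpow_pos; lra|]. apply rpow_le; lra.
    - rewrite <- rpow_2, <- rpow_plus by lra. rewrite <- (rpow_1 (INR H)) at 2 by lra.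
      rewrite <- rpow_plus by lra. f_equal; ring. }
  assert (0 < / e) by (apply Rinv_0_lt_compat; lra).
  unfold Rdiv in *. nra.
Qed.

(** The threshold is D N for D = d, so the complement satisfies the hypothesis of [wt_sum_minor]
    when Q = d H^2. *)
Definition major (d Q N : nat) : list nat :=
  filter (fun j => existsb (fun q => Z.leb (Z.abs (sres (Z.of_nat Q) (Z.of_nat q * Z.of_nat j))) (Z.of_nat (d * N)))
    (seq 1 N)) (seq 0 Q).

(** Write q j = s + a Q and cut the range of the residue s into cells of length q. The pair formed
    by a and the cell of s determines q j up to less than q, hence j. *)
Lemma near_multiple_count Q X q : (1 <= Q)%nat -> (1 <= q)%nat ->
  (length (filter (fun j => Z.leb (Z.abs (sres (Z.of_nat Q) (Z.of_nat q * Z.of_nat j))) (Z.of_nat X)) (seq 0 Q))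
   <= S q * S (2 * X / q))%nat.
Proof.
  intros HQ Hq. set (l := filter _ _).
  set (s := fun j : nat => sres (Z.of_nat Q) (Z.of_nat q * Z.of_nat j)).
  set (a := fun j : nat => ((Z.of_nat q * Z.of_nat j - s j) / Z.of_nat Q)%Z).
  set (b := fun j : nat => ((s j + Z.of_nat X) / Z.of_nat q)%Z).
  assert (Hl : forall j, In j l -> (j < Q)%nat /\ (Z.abs (s j) <= Z.of_nat X)%Z).
  { intros j; unfold l; rewrite filter_In, in_seq, Z.leb_le. unfold s. lia. }
  assert (Ha : forall j, (Z.of_nat q * Z.of_nat j = s j + a j * Z.of_nat Q)%Z).
  { intros j. destruct (sres_spec (Z.of_nat Q) (Z.of_nat q * Z.of_nat j)) as [_ [t Ht]]; [lia|].
    fold (s j) in Ht. unfold a. rewrite Ht at 2.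
    replace (s j + t * Z.of_nat Q - s j)%Z with (t * Z.of_nat Q)%Z by ring. rewrite Z.div_mul by lia. auto. }
  assert (Hb : forall j, (Z.of_nat q * b j <= s j + Z.of_nat X < Z.of_nat q * b j + Z.of_nat q)%Z).
  { intros j; unfold b. pose proof (Z.div_mod (s j + Z.of_nat X) (Z.of_nat q)).
    pose proof (Z.mod_pos_bound (s j + Z.of_nat X) (Z.of_nat q)). lia. }
  assert (L : (length (map (fun j => (Z.to_nat (a j), Z.to_nat (b j))) l) <=
     length (list_prod (seq 0 (S q)) (seq 0 (S (2 * X / q)))))%nat).
  { assert (Hab : forall j, In j l -> (0 <= a j <= Z.of_nat q)%Z /\ (0 <= b j <= 2 * Z.of_nat X / Z.of_nat q)%Z).
    { intros j Hj. apply Hl in Hj. destruct Hj as [Hj1 Hj2]. specialize (Ha j).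
      destruct (sres_spec (Z.of_nat Q) (Z.of_nat q * Z.of_nat j)) as [B _]; [lia|]. fold (s j) in B.
      split; [nia|]. unfold b. split; [apply Z.div_pos; lia|]. apply Z.div_le_mono; lia. }
    apply NoDup_incl_length.
    - apply NoDup_map_inj_on; [|apply NoDup_filter, seq_NoDup].
      intros x y Hx Hy E. injection E; intros E2 E1.
      pose proof (Hab x Hx). pose proof (Hab y Hy).
      assert (Ea : a x = a y) by lia. assert (Eb : b x = b y) by lia.
      pose proof (Ha x) as Ax. pose proof (Ha y) as Ay. rewrite Ea in Ax.
      pose proof (Hb x) as Bx. pose proof (Hb y) as By. rewrite Eb in Bx. nia.
    - intros p Hp. apply in_map_iff in Hp. destruct Hp as (j & <- & Hj).
      destruct (Hab j Hj) as [B1 B2]. apply in_prod_iff. rewrite !in_seq. split; [lia|].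
      assert (Z.of_nat (2 * X / q) = 2 * Z.of_nat X / Z.of_nat q)%Z.
      { rewrite Nat2Z.inj_div, Nat2Z.inj_mul; auto. }
      lia. }
  rewrite length_map, length_prod, !length_seq in L. exact L.
Qed.

Lemma filter_existsb_length {A B} (l : list A) (l' : list B) p :
  INR (length (filter (fun x => existsb (fun y => p y x) l') l)) <=
  lsum l' (fun y => INR (length (filter (p y) l))).
Proof.
  assert (E : forall A (l : list A), INR (length l) = lsum l (fun _ => 1))
    by (intros; rewrite lsum_const; lra).
  rewrite E, lsum_filter. rewrite (lsum_ext l' _ (fun y => lsum l (fun x => if p y x then 1 else 0)))
    by (intros; rewrite E, lsum_filter; auto).
  rewrite lsum_swap. apply lsum_le; intros x _.
  destruct (existsb (fun y => p y x) l') eqn:X.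
  - apply existsb_exists in X. destruct X as (y & Hy & Hp).
    apply Rle_trans with ((fun y => if p y x then 1 else 0) y); [simpl; rewrite Hp; lra|].
    apply (lsum_ge_term l' (fun y => if p y x then 1 else 0)); auto. intros z _; destruct (p z x); lra.
  - apply lsum_nonneg; intros z _; destruct (p z x); lra.
Qed.

Theorem major_count d Q N : (1 <= d)%nat -> (1 <= Q)%nat -> (1 <= N)%nat ->
  INR (length (major d Q N)) <= 6 * INR d * INR N ^ 2.
Proof.
  intros Hd HQ HN. unfold major.
  eapply Rle_trans; [apply (filter_existsb_length (seq 0 Q) (seq 1 N)
    (fun q j => Z.leb (Z.abs (sres (Z.of_nat Q) (Z.of_nat q * Z.of_nat j))) (Z.of_nat (d * N))))|].
  apply Rle_trans with (lsum (seq 1 N) (fun _ => 6 * INR d * INR N)).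
  - apply lsum_le. intros q Hq; apply in_seq in Hq.
    eapply Rle_trans; [apply le_INR, near_multiple_count; lia|].
    replace 6 with (INR 6) by (simpl; lra). rewrite <- !mult_INR. apply le_INR.
    pose proof (Nat.div_mod (2 * (d * N)) q). 
    assert (q * (2 * (d * N) / q) <= 2 * (d * N))%nat by nia.
    assert (N <= d * N)%nat by nia. nia.
  - rewrite lsum_const, length_seq. right; ring.
Qed.

(** * Quadratic exponential sums *)

Lemma le_of_sq_le x y : 0 <= y -> x ^ 2 <= y ^ 2 -> x <= y.
Proof. intros Hy H. destruct (Rle_or_lt x y); auto. nra. Qed.

Lemma cos_sum_telescope n a al :
  2 * sin (al / 2) * lsum (seq 0 n) (fun i => cos (a + al * INR i)) =
  sin (a + al * INR n - al / 2) - sin (a - al / 2).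
Proof.
  induction n as [|n IH].
  - simpl. rewrite lsum_nil. replace (a + al * 0 - al / 2) with (a - al / 2) by ring. ring.
  - rewrite seq_S, lsum_app, lsum_cons, lsum_nil, Rmult_plus_distr_l, IH. simpl (0 + n)%nat. rewrite S_INR.
    replace (a + al * (INR n + 1) - al / 2) with ((a + al * INR n) + al / 2) by field.
    replace (a + al * INR n - al / 2) with ((a + al * INR n) - al / 2) by ring.
    rewrite sin_plus, (sin_minus (a + al * INR n)). ring.
Qed.

Lemma sin_sum_telescope n a al :
  2 * sin (al / 2) * lsum (seq 0 n) (fun i => sin (a + al * INR i)) =
  cos (a - al / 2) - cos (a + al * INR n - al / 2).
Proof.
  induction n as [|n IH].
  - simpl. rewrite lsum_nil. replace (a + al * 0 - al / 2) with (a - al / 2) by ring. ring.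
  - rewrite seq_S, lsum_app, lsum_cons, lsum_nil, Rmult_plus_distr_l, IH. simpl (0 + n)%nat. rewrite S_INR.
    replace (a + al * (INR n + 1) - al / 2) with ((a + al * INR n) + al / 2) by field.
    replace (a + al * INR n - al / 2) with ((a + al * INR n) - al / 2) by ring.
    rewrite (cos_plus (a + al * INR n)), (cos_minus (a + al * INR n)). ring.
Qed.

(** Multiplied by 2 sin(al/2), the two sums telescope to the components of a chord of the unit
    circle, whose length is at most 2. *)
Lemma geometric_sum_sin n a al :
  sin (al / 2) ^ 2 * (lsum (seq 0 n) (fun i => cos (a + al * INR i)) ^ 2 +
    lsum (seq 0 n) (fun i => sin (a + al * INR i)) ^ 2) <= 1.
Proof.
  pose proof (cos_sum_telescope n a al) as H1. pose proof (sin_sum_telescope n a al) as H2.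
  revert H1 H2. generalize (lsum (seq 0 n) (fun i => cos (a + al * INR i))) as C.
  generalize (lsum (seq 0 n) (fun i => sin (a + al * INR i))) as D.
  generalize (sin (al / 2)) as s. generalize (a + al * INR n - al / 2) as u. generalize (a - al / 2) as v.
  intros v u s D C H1 H2.
  assert (E : 4 * (s ^ 2 * (C ^ 2 + D ^ 2)) = (sin u - sin v) ^ 2 + (cos v - cos u) ^ 2).
  { rewrite <- H1, <- H2. ring. }
  pose proof (sin2_cos2 u) as Hu. pose proof (sin2_cos2 v) as Hv. unfold Rsqr in *.
  assert (0 <= (sin u + sin v) ^ 2) by apply pow2_ge_0.
  assert (0 <= (cos u + cos v) ^ 2) by apply pow2_ge_0. nra.
Qed.

Lemma trig_sum_trivial {A} (l : list A) phi :
  lsum l (fun i => cos (phi i)) ^ 2 + lsum l (fun i => sin (phi i)) ^ 2 <= INR (length l) ^ 2.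
Proof.
  pose proof (lsum_cauchy l (fun i => cos (phi i))) as H1.
  pose proof (lsum_cauchy l (fun i => sin (phi i))) as H2.
  assert (E : lsum l (fun i => cos (phi i) ^ 2) + lsum l (fun i => sin (phi i) ^ 2) = INR (length l)).
  { rewrite <- lsum_plus. rewrite (lsum_ext _ _ (fun _ => 1)), lsum_const; [ring|].
    intros i _. pose proof (sin2_cos2 (phi i)). unfold Rsqr in *. lra. }
  set (X := INR (length l)) in *. replace (X ^ 2) with (X * X) by ring. rewrite <- E at 2. lra.
Qed.

(** Half of Jordan's bound is enough here and is elementary: sin is at least 1/2 beyond PI/6, and
    below it the derivative cos is at least 1/2. *)
Lemma sin_ge_div_PI y : 0 <= y <= PI / 2 -> y / PI <= sin y.
Proof.
  intros [H0 H1]. pose proof PI_RGT_0 as HP. pose proof PI2_3_2 as HP3.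
  assert (HP4 : 2 < PI) by lra.
  destruct (Rle_or_lt (PI / 6) y) as [L|L].
  - apply Rle_trans with (1 / 2).
    + apply Rmult_le_reg_r with PI; [lra|]. unfold Rdiv at 1. rewrite Rmult_assoc, Rinv_l by lra. lra.
    + rewrite <- sin_PI6. apply sin_incr_1; lra.
  - destruct H0 as [H0|<-]; [|rewrite sin_0; lra].
    destruct (MVT_cor2 sin cos 0 y H0) as (c & E & Hc).
    { intros; apply derivable_pt_lim_sin. }
    rewrite sin_0 in E. rewrite !Rminus_0_r in E. rewrite E.
    assert (1 / 2 <= cos c).
    { rewrite <- cos_PI3. apply cos_decr_1; lra. }
    assert (/ PI <= 1 / 2) by (replace (1 / 2) with (/ 2) by lra; apply Rinv_le_contravar; lra).
    unfold Rdiv. nra.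
Qed.

Lemma sin_sq_period x (t : Z) : sin (x + IZR t * PI) ^ 2 = sin x ^ 2.
Proof.
  assert (N : forall (n : nat) x, sin (x + INR n * PI) ^ 2 = sin x ^ 2).
  { clear. induction n as [|n IH]; intros x; [simpl INR; rewrite Rmult_0_l, Rplus_0_r; auto|].
    rewrite S_INR. replace (x + (INR n + 1) * PI) with ((x + INR n * PI) + PI) by ring.
    rewrite neg_sin, <- (IH x). ring. }
  destruct (Z_le_gt_dec 0 t).
  - rewrite <- (N (Z.to_nat t) x), INR_IZR_INZ, Z2Nat.id by lia. auto.
  - rewrite <- (N (Z.to_nat (- t)) (x + IZR t * PI)), INR_IZR_INZ, Z2Nat.id, opp_IZR by lia.
    f_equal. f_equal. ring.
Qed.

Lemma sin_sres_ge (Q : nat) m : (1 <= Q)%nat ->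
  (IZR (Z.abs (sres (Z.of_nat Q) m)) / INR Q) ^ 2 <= sin (PI * IZR m / INR Q) ^ 2.
Proof.
  intros HQ. destruct (sres_spec (Z.of_nat Q) m) as [H [t Ht]]; [lia|].
  set (s := sres _ _) in *.
  assert (HQ' : 1 <= INR Q) by (apply (le_INR 1); auto).
  pose proof PI_RGT_0 as HP.
  rewrite Ht, plus_IZR, mult_IZR, <- INR_IZR_INZ.
  replace (PI * (IZR s + IZR t * INR Q) / INR Q) with (PI * IZR s / INR Q + IZR t * PI) by (field; lra).
  rewrite sin_sq_period.
  assert (E : sin (PI * IZR s / INR Q) ^ 2 = sin (PI * IZR (Z.abs s) / INR Q) ^ 2).
  { destruct (Z_le_gt_dec 0 s); [rewrite Z.abs_eq by lia; auto|].
    rewrite Z.abs_neq, opp_IZR by lia.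
    replace (PI * - IZR s / INR Q) with (- (PI * IZR s / INR Q)) by (field; lra).
    rewrite sin_neg. ring. }
  rewrite E. assert (Ha : 0 <= IZR (Z.abs s)) by (apply IZR_le; lia).
  assert (Hb : 2 * IZR (Z.abs s) <= INR Q).
  { rewrite INR_IZR_INZ, <- mult_IZR. apply IZR_le; lia. }
  assert (Hi : 0 < / INR Q) by (apply Rinv_0_lt_compat; lra).
  apply pow_incr. split; [apply Rmult_le_pos; lra|].
  replace (IZR (Z.abs s) / INR Q) with ((PI * IZR (Z.abs s) / INR Q) / PI) by (field; lra).
  apply sin_ge_div_PI. split.
  - unfold Rdiv. apply Rmult_le_pos; [apply Rmult_le_pos|]; lra.
  - apply Rmult_le_reg_r with (INR Q); [lra|]. unfold Rdiv. rewrite (Rmult_assoc _ (/ INR Q)), Rinv_l by lra. nra.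
Qed.

(* Weyl differencing: the autocorrelation of the quadratic phase is a geometric sum with ratio 2 h j / Q. *)
Lemma exp_sum_le_wt (Q H : nat) (m : Z) n a : (1 <= Q)%nat -> (n <= H)%nat ->
  lsum (seq 0 n) (fun i => cos (a + 2 * PI * IZR m / INR Q * INR i)) ^ 2 +
  lsum (seq 0 n) (fun i => sin (a + 2 * PI * IZR m / INR Q * INR i)) ^ 2 <= wt (Z.of_nat Q) H m ^ 2.
Proof.
  intros HQ Hn. set (al := 2 * PI * IZR m / INR Q).
  assert (HQ' : 1 <= INR Q) by (apply (le_INR 1); auto).
  pose proof (trig_sum_trivial (seq 0 n) (fun i => a + al * INR i)) as H1.
  pose proof (geometric_sum_sin n a al) as H2. rewrite length_seq in H1.
  set (X := lsum _ _ ^ 2 + lsum _ _ ^ 2) in *.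
  assert (H1' : X <= INR H ^ 2).
  { eapply Rle_trans; [exact H1|]. apply pow_incr; split; [apply pos_INR|apply le_INR; auto]. }
  unfold wt. destruct (Z.eqb_spec (sres (Z.of_nat Q) m) 0) as [E|E]; auto.
  unfold Rmin. destruct (Rle_dec _ _); auto.
  pose proof (sin_sres_ge Q m HQ) as H3.
  replace (PI * IZR m / INR Q) with (al / 2) in H3 by (unfold al; field; lra).
  set (s := IZR (Z.abs (sres (Z.of_nat Q) m))) in *.
  assert (Hs : 0 < s) by (apply IZR_lt; lia).
  rewrite <- INR_IZR_INZ.
  assert (0 <= X) by (unfold X; pose proof (pow2_ge_0 (lsum (seq 0 n) (fun i => cos (a + al * INR i))));
    pose proof (pow2_ge_0 (lsum (seq 0 n) (fun i => sin (a + al * INR i)))); lra).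
  assert (H4 : (s / INR Q) ^ 2 * X <= 1) by nra.
  replace X with ((INR Q / s) ^ 2 * ((s / INR Q) ^ 2 * X)) by (field; lra).
  rewrite <- (Rmult_1_r ((INR Q / s) ^ 2)) at 2. apply Rmult_le_compat_l; [apply pow2_ge_0|auto].
Qed.

(** * Weyl's inequality on the line *)

Lemma wt_sign Q H m : (0 < Q)%Z -> wt Q H (- m) = wt Q H m.
Proof.
  intros HQ. assert (E : Z.abs (sres Q (- m)) = Z.abs (sres Q m)).
  { destruct (sres_spec Q m HQ) as [_ [t Ht]]. destruct (sres_spec Q (- m) HQ) as [_ [u Hu]].
    pose proof (sres_min Q (- m) (- sres Q m) (- t) HQ ltac:(lia)).
    pose proof (sres_min Q m (- sres Q (- m)) (- u) HQ ltac:(lia)). lia. }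
  unfold wt. rewrite E.
  destruct (Z.eqb_spec (sres Q (- m)) 0), (Z.eqb_spec (sres Q m) 0); auto; lia.
Qed.

(** An upper bound for the Schur constant of K* K in one variable: the diagonal, plus the shifts of
    both signs. *)
Definition weyl (Q H : nat) (j : Z) : R :=
  INR H + 2 * lsum (seq 1 H) (fun h => wt (Z.of_nat Q) H (Z.of_nat h * j)).

Lemma weyl_nonneg Q H j : (1 <= Q)%nat -> 0 <= weyl Q H j.
Proof.
  intros HQ. unfold weyl. pose proof (pos_INR H).
  assert (0 <= lsum (seq 1 H) (fun h => wt (Z.of_nat Q) H (Z.of_nat h * j))); [|lra].
  apply lsum_nonneg; intros; apply wt_nonneg; lia.
Qed.

(** Differencing the phase produces the even multiples 2h with |h| <= 2M. They are embedded among
    all of 1..H, whence the condition 4M <= H. *)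
Lemma wt_sum_zrange (Q H M : nat) j : (1 <= Q)%nat -> (4 * M <= H)%nat ->
  lsum (zrange (2 * M)) (fun h => wt (Z.of_nat Q) H (2 * h * j)) <= weyl Q H j.
Proof.
  intros HQ HM. unfold weyl.
  rewrite (lsum_split _ (fun h => Z.eqb h 0)). apply Rplus_le_compat.
  - apply Rle_trans with (lsum [0%Z] (fun _ => INR H)); [|unfold lsum; simpl; lra].
    apply lsum_inj with (fun h => h); [apply NoDup_filter, NoDup_zrange|auto| |intros; apply pos_INR].
    intros h; rewrite filter_In, Z.eqb_eq; intros [_ ->]. split; [left; auto|apply wt_le_H].
  - apply Rle_trans with (lsum (list_prod [true; false] (seq 1 H)) (fun p => wt (Z.of_nat Q) H (Z.of_nat (snd p) * j))).
    + apply lsum_inj with (fun h => (Z.ltb 0 h, Z.abs_nat (2 * h)));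
        [apply NoDup_filter, NoDup_zrange| | |intros; apply wt_nonneg; lia].
      * intros x y _ _ E. pose proof (f_equal fst E) as E2. pose proof (f_equal snd E) as E1. cbn [fst snd] in E1, E2.
        destruct (Z.ltb_spec 0 x), (Z.ltb_spec 0 y); try discriminate; lia.
      * intros h; rewrite filter_In, in_zrange; intros [G1 G2]. destruct (Z.eqb_spec h 0); [discriminate|]. split.
        -- apply in_prod_iff; split; [destruct (Z.ltb 0 h); simpl; auto|apply in_seq; lia].
        -- cbn [snd]. right. destruct (Z_le_gt_dec 0 h).
           ++ f_equal. f_equal. lia.
           ++ rewrite <- wt_sign by lia. f_equal. replace (Z.of_nat (Z.abs_nat (2 * h))) with (- (2 * h))%Z by lia. ring.
    + rewrite lsum_list_prod, !lsum_cons, lsum_nil. cbn [snd]. lra.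
Qed.

Lemma lsum_interval (l : list Z) lo hi F : NoDup l -> (forall x, In x l <-> (lo <= x <= hi)%Z) ->
  lsum l F = lsum (seq 0 (Z.to_nat (hi - lo + 1))) (fun i => F (lo + Z.of_nat i)%Z).
Proof.
  intros Hn Hl. apply lsum_bij with (fun x => Z.to_nat (x - lo)) (fun i => (lo + Z.of_nat i)%Z); auto using seq_NoDup.
  - intros x Hx. apply Hl in Hx. rewrite in_seq. split; [lia|]. split; [lia|]. f_equal; lia.
  - intros i; rewrite in_seq, Hl. lia.
Qed.

Definition phase (Q : nat) (j : Z) : R := 2 * PI * IZR j / INR Q.
Definition within (M : nat) (z : Z) : bool := Z.leb (Z.abs z) (Z.of_nat M).

(** The admissible x form an interval, and on it the difference of the two quadratic phases is
    affine in x with slope given by 2 (z' - z) j / Q. *)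
Lemma autocorrelation_bound (Q H M r : nat) j z z' : (1 <= Q)%nat -> (2 * M + 1 <= H)%nat ->
  let D x := phase Q j * IZR ((x - z) * (x - z)) - phase Q j * IZR ((x - z') * (x - z')) in
  let l := filter (fun x => andb (within M (x - z)) (within M (x - z'))) (zrange r) in
  lsum l (fun x => cos (D x)) ^ 2 + lsum l (fun x => sin (D x)) ^ 2 <=
    (if within (2 * M) (z' - z) then wt (Z.of_nat Q) H (2 * (z' - z) * j) else 0) ^ 2.
Proof.
  intros HQ HH D l.
  assert (HQ' : 1 <= INR Q) by (apply (le_INR 1); auto).
  assert (Hl : forall x, In x l <->
    (Z.max (- Z.of_nat r) (Z.max (z - Z.of_nat M) (z' - Z.of_nat M)) <= x <=
     Z.min (Z.of_nat r) (Z.min (z + Z.of_nat M) (z' + Z.of_nat M)))%Z).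
  { intros x. unfold l, within. rewrite filter_In, in_zrange, Bool.andb_true_iff, !Z.leb_le. lia. }
  assert (Hn : NoDup l) by apply NoDup_filter, NoDup_zrange.
  set (lo := Z.max _ _) in *. set (hi := Z.min _ _) in *.
  assert (Hlh : (hi - lo <= 2 * Z.of_nat M)%Z) by (unfold hi, lo; lia).
  unfold within. destruct (Z.leb_spec (Z.abs (z' - z)) (Z.of_nat (2 * M))) as [L|L].
  - rewrite !(lsum_interval l lo hi) by auto.
    pose proof (exp_sum_le_wt Q H (2 * (z' - z) * j) (Z.to_nat (hi - lo + 1)) (D lo) HQ ltac:(lia)) as B.
    assert (E : forall i : nat, D (lo + Z.of_nat i)%Z = D lo + 2 * PI * IZR (2 * (z' - z) * j) / INR Q * INR i).
    { intros i. unfold D, phase.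
      repeat rewrite ?mult_IZR, ?minus_IZR, ?plus_IZR. rewrite <- INR_IZR_INZ. field. lra. }
    rewrite (lsum_ext _ (fun i : nat => cos (D (lo + Z.of_nat i)%Z)) (fun i => cos (D lo + 2 * PI * IZR (2 * (z' - z) * j) / INR Q * INR i))) by (intros; rewrite E; auto).
    rewrite (lsum_ext _ (fun i : nat => sin (D (lo + Z.of_nat i)%Z)) (fun i => sin (D lo + 2 * PI * IZR (2 * (z' - z) * j) / INR Q * INR i))) by (intros; rewrite E; auto).
    exact B.
  - replace l with (@nil Z); [rewrite !lsum_nil; simpl; lra|].
    destruct l as [|x l']; auto. exfalso. specialize (Hl x). destruct Hl as [Hl _].
    specialize (Hl (or_introl eq_refl)). unfold lo, hi in Hl. lia.
Qed.

(** Real and imaginary parts of the convolution of p + i q with exp(i om y^2) on |y| <= M. Complex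
    input is required because coordinates are treated one at a time, and the first convolution
    already leaves the real functions. *)
Definition k1re om M (p q : Z -> R) (x : Z) : R :=
  lsum (zrange M) (fun y => cos (om * IZR (y * y)) * p (x - y)%Z - sin (om * IZR (y * y)) * q (x - y)%Z).
Definition k1im om M (p q : Z -> R) (x : Z) : R :=
  lsum (zrange M) (fun y => sin (om * IZR (y * y)) * p (x - y)%Z + cos (om * IZR (y * y)) * q (x - y)%Z).

Lemma lsum_zrange_recenter M r x (F : Z -> Z -> R) : (Z.abs x <= Z.of_nat r)%Z ->
  lsum (zrange M) (fun y => F y (x - y)%Z) =
  lsum (zrange (r + M)) (fun z => if within M (x - z) then F (x - z)%Z z else 0).
Proof.
  intros Hx. rewrite <- lsum_filter.
  apply lsum_bij with (fun y => x - y)%Z (fun z => x - z)%Z; [apply NoDup_zrange|apply NoDup_filter, NoDup_zrange| |].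
  - intros y; rewrite filter_In, !in_zrange; unfold within; rewrite Z.leb_le; intros H.
    split; [lia|]. replace (x - (x - y))%Z with y by lia. auto.
  - intros z; rewrite filter_In, !in_zrange; unfold within; rewrite Z.leb_le; intros H. lia.
Qed.

Lemma lsum_sq {A} (l : list A) F : lsum l F ^ 2 = lsum l (fun z => lsum l (fun z' => F z * F z')).
Proof.
  rewrite (lsum_ext l (fun z => lsum l (fun z' => F z * F z')) (fun z => F z * lsum l F)) by (intros; apply lsum_scal).
  rewrite lsum_scal_r. ring.
Qed.

Lemma schur_pair A B P W t n n' : A ^ 2 + B ^ 2 <= t ^ 2 -> 0 <= t -> 0 <= n -> 0 <= n' ->
  P ^ 2 + W ^ 2 = n * n' -> A * P + B * W <= t * n / 2 + t * n' / 2.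
Proof.
  intros HA Ht Hn Hn' HP. apply le_of_sq_le; [nra|].
  apply Rle_trans with ((A ^ 2 + B ^ 2) * (P ^ 2 + W ^ 2)).
  - assert (0 <= (A * W - B * P) ^ 2) by apply pow2_ge_0. nra.
  - apply Rle_trans with (t ^ 2 * (n * n')).
    + rewrite HP. apply Rmult_le_compat_r; [nra|auto].
    + assert (0 <= t ^ 2 * (n - n') ^ 2) by (apply Rmult_le_pos; apply pow2_ge_0). nra.
Qed.

(** Expanding the square gives a double sum over z, z' in which [A], [B] are the autocorrelation of
    the kernel and [P] + i [W] is conj(f(z)) f(z'). The autocorrelation is at most [tau] (z' - z),
    and Schur's test follows from the arithmetic-geometric mean inequality, as P^2 + W^2 = N(z)
    N(z'). *)
Lemma k1_l2 (Q H M r : nat) j (p q : Z -> R) : (1 <= Q)%nat -> (2 * M + 1 <= H)%nat -> (4 * M <= H)%nat ->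
  lsum (zrange r) (fun x => k1re (phase Q j) M p q x ^ 2 + k1im (phase Q j) M p q x ^ 2) <=
  weyl Q H j * lsum (zrange (r + M)) (fun z => p z ^ 2 + q z ^ 2).
Proof.
  intros HQ HH HM. set (om := phase Q j). set (Zs := zrange (r + M)).
  set (ph := fun x z : Z => om * IZR ((x - z) * (x - z))).
  set (chi := fun x z : Z => if within M (x - z) then 1 else 0).
  set (P := fun z z' => p z * p z' + q z * q z'). set (W := fun z z' => p z * q z' - q z * p z').
  set (A := fun z z' => lsum (zrange r) (fun x => chi x z * chi x z' * cos (ph x z - ph x z'))).
  set (B := fun z z' => lsum (zrange r) (fun x => chi x z * chi x z' * sin (ph x z - ph x z'))).
  set (tau := fun h : Z => if within (2 * M) h then wt (Z.of_nat Q) H (2 * h * j) else 0).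
  assert (Htau : forall h, 0 <= tau h).
  { intros h; unfold tau; destruct (within _ _); [apply wt_nonneg; lia|lra]. }
  assert (E1 : lsum (zrange r) (fun x => k1re om M p q x ^ 2 + k1im om M p q x ^ 2) =
    lsum Zs (fun z => lsum Zs (fun z' => A z z' * P z z' + B z z' * W z z'))).
  { transitivity (lsum (zrange r) (fun x => lsum Zs (fun z => lsum Zs (fun z' =>
      chi x z * chi x z' * cos (ph x z - ph x z') * P z z' + chi x z * chi x z' * sin (ph x z - ph x z') * W z z')))).
    - apply lsum_ext; intros x Hx. apply in_zrange in Hx. unfold k1re, k1im.
      rewrite (lsum_zrange_recenter M r x (fun y z => cos (om * IZR (y * y)) * p z - sin (om * IZR (y * y)) * q z)) by lia.
      rewrite (lsum_zrange_recenter M r x (fun y z => sin (om * IZR (y * y)) * p z + cos (om * IZR (y * y)) * q z)) by lia.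
      fold Zs. rewrite !lsum_sq, <- lsum_plus. apply lsum_ext; intros z _.
      rewrite <- lsum_plus. apply lsum_ext; intros z' _. unfold chi, P, W.
      fold (ph x z). fold (ph x z').
      destruct (within M (x - z)), (within M (x - z')); try ring.
      rewrite cos_minus, sin_minus. ring.
    - rewrite lsum_swap. apply lsum_ext; intros z _. rewrite lsum_swap. apply lsum_ext; intros z' _.
      rewrite lsum_plus, !lsum_scal_r. reflexivity. }
  assert (E2 : forall z z', A z z' ^ 2 + B z z' ^ 2 <= tau (z' - z)%Z ^ 2).
  { intros z z'. pose proof (autocorrelation_bound Q H M r j z z' HQ HH) as AC. cbv zeta in AC.
    rewrite !lsum_filter in AC. fold om in AC. unfold tau. eapply Rle_trans; [|exact AC]. right. f_equal; f_equal.
    - apply lsum_ext; intros x _. unfold chi, ph. destruct (within M (x - z)), (within M (x - z')); simpl; ring.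
    - apply lsum_ext; intros x _. unfold chi, ph. destruct (within M (x - z)), (within M (x - z')); simpl; ring. }
  set (N := fun z => p z ^ 2 + q z ^ 2).
  assert (HN : forall z, 0 <= N z).
  { intros z; unfold N; pose proof (pow2_ge_0 (p z)); pose proof (pow2_ge_0 (q z)); lra. }
  assert (T1 : forall z, lsum Zs (fun z' => tau (z' - z)%Z) <= weyl Q H j).
  { intros z. eapply Rle_trans; [|apply (wt_sum_zrange Q H M j); auto].
    unfold tau. rewrite <- (lsum_filter Zs (fun z' => within (2 * M) (z' - z))).
    apply lsum_inj with (fun z' => z' - z)%Z; [apply NoDup_filter, NoDup_zrange|intros; lia| |intros; apply wt_nonneg; lia].
    intros z'; rewrite filter_In; unfold within; rewrite Z.leb_le, in_zrange; intros; split; [lia|lra]. }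
  assert (T2 : forall z', lsum Zs (fun z => tau (z' - z)%Z) <= weyl Q H j).
  { intros z'. eapply Rle_trans; [|apply (wt_sum_zrange Q H M j); auto].
    unfold tau. rewrite <- (lsum_filter Zs (fun z => within (2 * M) (z' - z))).
    apply lsum_inj with (fun z => z' - z)%Z; [apply NoDup_filter, NoDup_zrange|intros; lia| |intros; apply wt_nonneg; lia].
    intros z; rewrite filter_In; unfold within; rewrite Z.leb_le, in_zrange; intros; split; [lia|lra]. }
  rewrite E1.
  apply Rle_trans with (lsum Zs (fun z => lsum Zs (fun z' => tau (z' - z)%Z * N z / 2 + tau (z' - z)%Z * N z' / 2))).
  { apply lsum_le; intros z _. apply lsum_le; intros z' _.
    apply schur_pair; auto. unfold P, W, N. ring. }
  rewrite (lsum_ext _ _ (fun z => lsum Zs (fun z' => (N z / 2) * tau (z' - z)%Z) + lsum Zs (fun z' => (N z' / 2) * tau (z' - z)%Z))).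
  2:{ intros z _. rewrite <- lsum_plus. apply lsum_ext; intros; field. }
  rewrite lsum_plus, (lsum_swap _ _ (fun z z' => N z' / 2 * tau (z' - z)%Z)).
  replace (weyl Q H j * lsum Zs N) with (lsum Zs (fun z => N z / 2 * weyl Q H j) + lsum Zs (fun z => N z / 2 * weyl Q H j)).
  2:{ rewrite <- lsum_plus, <- lsum_scal. apply lsum_ext; intros; field. }
  apply Rplus_le_compat; apply lsum_le; intros z _; rewrite lsum_scal;
    (apply Rmult_le_compat_l; [specialize (HN z); lra|auto]).
Qed.

(** * Tensor powers: passage to dimension d *)

Definition kre om d M (p q : Zpt -> R) (x : Zpt) : R :=
  lsum (box d M) (fun y => cos (om * IZR (normsq y)) * p (vsub x y) - sin (om * IZR (normsq y)) * q (vsub x y)).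
Definition kim om d M (p q : Zpt -> R) (x : Zpt) : R :=
  lsum (box d M) (fun y => sin (om * IZR (normsq y)) * p (vsub x y) + cos (om * IZR (normsq y)) * q (vsub x y)).

Lemma kre_cons om d M p q a x :
  kre om (S d) M p q (a :: x) =
  k1re om M (fun b => kre om d M (fun y => p (b :: y)) (fun y => q (b :: y)) x)
            (fun b => kim om d M (fun y => p (b :: y)) (fun y => q (b :: y)) x) a.
Proof.
  unfold kre at 1. rewrite lsum_box_S. unfold k1re. apply lsum_ext; intros b _.
  unfold kre, kim. rewrite <- !lsum_scal, <- lsum_minus. apply lsum_ext; intros y _.
  change (vsub (a :: x) (b :: y)) with ((a - b)%Z :: vsub x y).
  change (normsq (b :: y)) with (b * b + normsq y)%Z.
  rewrite plus_IZR, Rmult_plus_distr_l, cos_plus, sin_plus. ring.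
Qed.

Lemma kim_cons om d M p q a x :
  kim om (S d) M p q (a :: x) =
  k1im om M (fun b => kre om d M (fun y => p (b :: y)) (fun y => q (b :: y)) x)
            (fun b => kim om d M (fun y => p (b :: y)) (fun y => q (b :: y)) x) a.
Proof.
  unfold kim at 1. rewrite lsum_box_S. unfold k1im. apply lsum_ext; intros b _.
  unfold kre, kim. rewrite <- !lsum_scal, <- lsum_plus. apply lsum_ext; intros y _.
  change (vsub (a :: x) (b :: y)) with ((a - b)%Z :: vsub x y).
  change (normsq (b :: y)) with (b * b + normsq y)%Z.
  rewrite plus_IZR, Rmult_plus_distr_l, cos_plus, sin_plus. ring.
Qed.

(** The phase |y|^2 is a sum over coordinates, so the operator is a composition of d one-dimensional
    ones, each costing a factor [weyl] in the squared norm. *)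
Theorem k_l2 (Q H M r d : nat) j (p q : Zpt -> R) : (1 <= Q)%nat -> (2 * M + 1 <= H)%nat -> (4 * M <= H)%nat ->
  lsum (box d r) (fun x => kre (phase Q j) d M p q x ^ 2 + kim (phase Q j) d M p q x ^ 2) <=
  weyl Q H j ^ d * lsum (box d (r + M)) (fun z => p z ^ 2 + q z ^ 2).
Proof.
  intros HQ HH HM. revert p q. induction d as [|d IH]; intros p q.
  - unfold kre, kim. simpl. unfold lsum; simpl. rewrite Rmult_0_r, cos_0, sin_0. simpl. right. change (vsub [] []) with (@nil Z). ring_simplify. ring.
  - rewrite !lsum_box_S.
    set (om := phase Q j) in *.
    set (gre := fun x b => kre om d M (fun y => p (b :: y)) (fun y => q (b :: y)) x).
    set (gim := fun x b => kim om d M (fun y => p (b :: y)) (fun y => q (b :: y)) x).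
    rewrite (lsum_ext _ _ (fun a => lsum (box d r) (fun x => k1re om M (gre x) (gim x) a ^ 2 + k1im om M (gre x) (gim x) a ^ 2))).
    2:{ intros a _. apply lsum_ext; intros x _. rewrite kre_cons, kim_cons. reflexivity. }
    rewrite lsum_swap.
    eapply Rle_trans; [apply lsum_le; intros x _; apply (k1_l2 Q H M r j (gre x) (gim x)); auto|].
    rewrite lsum_scal, lsum_swap. simpl (_ ^ S d). rewrite Rmult_assoc.
    apply Rmult_le_compat_l; [apply weyl_nonneg; auto|].
    rewrite <- lsum_scal. apply lsum_le; intros b _. unfold gre, gim.
    apply (IH (fun y => p (b :: y)) (fun y => q (b :: y))).
Qed.

(** * The circle method *)

Definition ravg (d n : nat) (g : Zpt -> R) (x : Zpt) : R :=
  lsum (sphere d n) (fun y => g (vsub x y)) / INR (length (sphere d n)).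

Lemma orthogonality (Q : nat) (m : Z) : (1 <= Q)%nat -> (Z.abs m < Z.of_nat Q)%Z ->
  lsum (seq 0 Q) (fun j => cos (phase Q (Z.of_nat j) * IZR m)) = if Z.eqb m 0 then INR Q else 0.
Proof.
  intros HQ Hm. assert (HQ' : 1 <= INR Q) by (apply (le_INR 1); auto).
  destruct (Z.eqb_spec m 0) as [->|Hm0].
  - rewrite (lsum_ext _ _ (fun _ => 1)), lsum_const, length_seq; [ring|].
    intros. rewrite Rmult_0_r, cos_0; auto.
  - set (n := Z.abs_nat m).
    assert (Hn : (0 < Z.of_nat n < Z.of_nat Q)%Z) by (unfold n; lia).
    set (al := 2 * PI * INR n / INR Q).
    rewrite (lsum_ext _ _ (fun j => cos (0 + al * INR j))).
    2:{ intros j _. unfold phase, al. rewrite <- INR_IZR_INZ.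
        assert (E : IZR m = INR n \/ IZR m = - INR n).
        { unfold n. rewrite INR_IZR_INZ, Zabs2Nat.id_abs. destruct (Z_le_gt_dec 0 m).
          - left; f_equal; lia.
          - right; rewrite <- opp_IZR; f_equal; lia. }
        destruct E as [-> | ->].
        - f_equal; field; lra.
        - rewrite <- cos_neg. f_equal; field; lra. }
    pose proof (cos_sum_telescope Q 0 al) as T.
    (* Over a full period the telescoped right-hand side vanishes. *)
    replace (0 + al * INR Q - al / 2) with (- (al / 2) + 2 * INR n * PI) in T by (unfold al; field; lra).
    rewrite sin_period in T. replace (0 - al / 2) with (- (al / 2)) in T by ring.
    assert (S : sin (al / 2) <> 0).
    { intros S. pose proof (sin_sres_ge Q (Z.of_nat n) HQ) as G.
      replace (PI * IZR (Z.of_nat n) / INR Q) with (al / 2) in G by (unfold al; rewrite <- INR_IZR_INZ; field; lra).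
      rewrite S in G.
      destruct (sres_spec (Z.of_nat Q) (Z.of_nat n)) as [_ [t Ht]]; [lia|].
      assert (sres (Z.of_nat Q) (Z.of_nat n) <> 0)%Z by (intros Z0; rewrite Z0 in Ht; assert (t <= 0 \/ 1 <= t)%Z as [?|?] by lia; nia).
      assert (0 < IZR (Z.abs (sres (Z.of_nat Q) (Z.of_nat n))) / INR Q) by (apply Rdiv_lt_0_compat; [apply IZR_lt; lia|lra]).
      nra. }
    assert (2 * sin (al / 2) * lsum (seq 0 Q) (fun i => cos (0 + al * INR i)) = 0) as T0 by lra.
    apply Rmult_integral in T0. destruct T0 as [T0|T0]; auto. exfalso; apply S; lra.
Qed.

Lemma normsq_box d m y : In y (box d m) -> (normsq y <= Z.of_nat d * (Z.of_nat m * Z.of_nat m))%Z.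
Proof.
  rewrite in_box. intros [<- Hf]. induction Hf as [|a y Ha Hy IH]; simpl length; [simpl; lia|].
  change (normsq (a :: y)) with (a * a + normsq y)%Z. nia.
Qed.

Definition zerof : Zpt -> R := fun _ => 0.

(** On the box | |y|^2 - n | < Q, so orthogonality detects the sphere exactly. After the factors
    cos(om n) and sin(om n) are bounded by 1, the right-hand side no longer depends on n. *)
Lemma sphere_sum_le_circle (d n M Q : nat) g x : (1 <= Q)%nat -> (n <= M * M)%nat ->
  (d * (M * M) < Q)%nat -> (M * M < Q)%nat -> (forall z, 0 <= g z) ->
  lsum (sphere d n) (fun y => g (vsub x y)) <=
  / INR Q * lsum (seq 0 Q) (fun j => Rabs (kre (phase Q (Z.of_nat j)) d M g zerof x) +
                                      Rabs (kim (phase Q (Z.of_nat j)) d M g zerof x)).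
Proof.
  intros HQ Hn HdQ HMQ Hg. rewrite (lsum_sphere_box d n M) by auto.
  assert (HQ' : 1 <= INR Q) by (apply (le_INR 1); auto).
  assert (E : lsum (box d M) (fun y => if Z.eqb (normsq y) (Z.of_nat n) then g (vsub x y) else 0) =
    / INR Q * lsum (seq 0 Q) (fun j => let om := phase Q (Z.of_nat j) in
      cos (om * INR n) * kre om d M g zerof x + sin (om * INR n) * kim om d M g zerof x)).
  { transitivity (/ INR Q * lsum (seq 0 Q) (fun j => lsum (box d M) (fun y =>
      cos (phase Q (Z.of_nat j) * IZR (normsq y - Z.of_nat n)) * g (vsub x y)))).
    - rewrite lsum_swap, <- lsum_scal. apply lsum_ext; intros y Hy. rewrite lsum_scal_r.
      apply normsq_box in Hy. pose proof (normsq_nonneg y). rewrite orthogonality by lia.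
      destruct (Z.eqb_spec (normsq y) (Z.of_nat n)), (Z.eqb_spec (normsq y - Z.of_nat n) 0); try lia; [field; lra|ring].
    - f_equal. apply lsum_ext; intros j _. cbv zeta. unfold kre, kim. rewrite <- !lsum_scal, <- lsum_plus.
      apply lsum_ext; intros y _. rewrite minus_IZR, <- INR_IZR_INZ, Rmult_minus_distr_l, cos_minus. unfold zerof. ring. }
  rewrite E. apply Rmult_le_compat_l; [left; apply Rinv_0_lt_compat; lra|].
  apply lsum_le; intros j _. cbv zeta. set (om := phase _ _).
  assert (B : forall a b, Rabs a <= 1 -> a * b <= Rabs b).
  { intros a b Ha. eapply Rle_trans; [apply Rle_abs|]. rewrite Rabs_mult.
    pose proof (Rabs_pos b). nra. }
  apply Rplus_le_compat; apply B; apply Rabs_le; [pose proof (COS_bound (om * INR n))|pose proof (SIN_bound (om * INR n))]; lra.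
Qed.

(** * Differences of boxes and the trivial kernel bound *)

Lemma length_vsub x y d : length x = d -> length y = d -> length (vsub x y) = d.
Proof. intros. unfold vsub. rewrite length_map, length_combine. lia. Qed.

Lemma vsub_inj x y y' d : length x = d -> length y = d -> length y' = d -> vsub x y = vsub x y' -> y = y'.
Proof.
  revert x y y'. induction d as [|d IH]; intros [|a x] [|b y] [|b' y'] Hx Hy Hy' E; simpl in *; try discriminate; auto.
  injection E; intros E2 E1. f_equal; [lia|]. apply IH with x; auto; lia.
Qed.

Lemma in_box_vsub d r m x y : In x (box d r) -> In y (box d m) -> In (vsub x y) (box d (r + m)).
Proof.
  rewrite !in_box. intros [Hx Fx] [Hy Fy]. split; [apply length_vsub; auto|].
  revert x y Hx Hy Fx Fy. induction d as [|d IH]; intros [|a x] [|b y] Hx Hy Fx Fy; simpl in *; try discriminate; [constructor|].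
  inversion Fx; inversion Fy; subst. constructor; [simpl; lia|]. apply IH; auto.
Qed.

Lemma lsum_box_vsub_le d r m x g : In x (box d r) -> (forall z, 0 <= g z) ->
  lsum (box d m) (fun y => g (vsub x y)) <= lsum (box d (r + m)) g.
Proof.
  intros Hx Hg. apply lsum_inj with (fun y => vsub x y); auto using NoDup_box.
  - intros y y' Hy Hy' E. apply in_box in Hx, Hy, Hy'. apply vsub_inj with x d; tauto.
  - intros y Hy. split; [apply in_box_vsub; auto|lra].
Qed.

Lemma kre_sup om d M r g x : In x (box d r) -> (forall z, 0 <= g z) ->
  Rabs (kre om d M g zerof x) + Rabs (kim om d M g zerof x) <= 2 * lsum (box d (r + M)) g.
Proof.
  intros Hx Hg. pose proof (lsum_box_vsub_le d r M x g Hx Hg) as B.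
  assert (C : forall c s : Zpt -> R, (forall y, -1 <= c y <= 1) ->
    Rabs (lsum (box d M) (fun y => c y * g (vsub x y))) <= lsum (box d M) (fun y => g (vsub x y))).
  { intros c _ Hc. eapply Rle_trans; [apply lsum_abs|]. apply lsum_le; intros y _.
    rewrite Rabs_mult, (Rabs_right (g _)) by (apply Rle_ge; auto).
    rewrite <- (Rmult_1_l (g (vsub x y))) at 2. apply Rmult_le_compat_r; [auto|apply Rabs_le; auto]. }
  unfold kre, kim.
  rewrite (lsum_ext _ (fun y => _ - _) (fun y => cos (om * IZR (normsq y)) * g (vsub x y))) by (intros; unfold zerof; ring).
  rewrite (lsum_ext _ (fun y => _ + _) (fun y => sin (om * IZR (normsq y)) * g (vsub x y))) by (intros; unfold zerof; ring).
  pose proof (C (fun y => cos (om * IZR (normsq y))) zerof (fun y => COS_bound _)).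
  pose proof (C (fun y => sin (om * IZR (normsq y))) zerof (fun y => SIN_bound _)). lra.
Qed.

(* Arcs j / Q whose best rational approximation has height about 2^i. *)
Definition shell (d Q i : nat) : list nat :=
  match i with
  | O => major d Q 1
  | S i' => filter (fun j => negb (existsb (Nat.eqb j) (major d Q (2 ^ i')))) (major d Q (2 ^ i))
  end.

Lemma in_major d Q N j : In j (major d Q N) <-> (j < Q)%nat /\ exists q, (1 <= q <= N)%nat /\
  (Z.abs (sres (Z.of_nat Q) (Z.of_nat q * Z.of_nat j)) <= Z.of_nat (d * N))%Z.
Proof.
  unfold major. rewrite filter_In, in_seq, existsb_exists. split.
  - intros [Hj (q & Hq & H)]. apply in_seq in Hq. apply Z.leb_le in H. split; [lia|]. exists q; split; [lia|auto].
  - intros [Hj (q & Hq & H)]. split; [lia|]. exists q. rewrite in_seq, Z.leb_le. split; [lia|auto].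
Qed.

Lemma in_shell_S d Q i j : In j (shell d Q (S i)) <-> In j (major d Q (2 ^ S i)) /\ ~ In j (major d Q (2 ^ i)).
Proof.
  unfold shell. rewrite filter_In, Bool.negb_true_iff.
  assert (E : existsb (Nat.eqb j) (major d Q (2 ^ i)) = true <-> In j (major d Q (2 ^ i))).
  { rewrite existsb_exists. split; [intros (x & Hx & Hj)|intros Hj; exists j].
    - apply Nat.eqb_eq in Hj; subst; auto.
    - split; auto. apply Nat.eqb_refl. }
  destruct (existsb _ _); intuition discriminate.
Qed.

Lemma shell_length d Q i : (1 <= d)%nat -> (1 <= Q)%nat -> INR (length (shell d Q i)) <= 6 * INR d * 4 ^ i.
Proof.
  intros Hd HQ. assert (P2 : forall i, (1 <= 2 ^ i)%nat) by (intros; apply Nat.neq_0_lt_0, Nat.pow_nonzero; lia).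
  assert (E4 : forall i, INR (2 ^ i) ^ 2 = 4 ^ i).
  { intros m. rewrite pow_INR, <- pow_mult, Nat.mul_comm, pow_mult. f_equal. simpl; lra. }
  assert (L : INR (length (shell d Q i)) <= INR (length (major d Q (2 ^ i)))).
  { apply le_INR. destruct i; simpl shell; [simpl; lia|apply filter_length_le]. }
  eapply Rle_trans; [exact L|]. rewrite <- E4. apply major_count; auto.
Qed.

(** For Q = d H^2 Dirichlet's residue bound Q/(2H) = d H/2 lies below the threshold 2 d H, so the
    height 2H exhausts all frequencies and the shells stop there. *)
Lemma major_all d Q H j : (1 <= H)%nat -> (1 <= d)%nat -> Q = (d * (H * H))%nat -> (j < Q)%nat -> In j (major d Q (2 * H)).
Proof.
  intros HH Hd EQ Hj. apply in_major. split; auto.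
  destruct (dirichlet (Z.of_nat Q) H (Z.of_nat j)) as (q & Hq & B); [lia|lia|].
  exists q; split; auto. rewrite EQ in B at 2. rewrite !Nat2Z.inj_mul in *. nia.
Qed.

Lemma shells_cover d Q H I F : (1 <= H)%nat -> (1 <= d)%nat -> Q = (d * (H * H))%nat -> (2 ^ I = 2 * H)%nat ->
  (forall j, 0 <= F j) ->
  lsum (seq 0 Q) F <= lsum (seq 0 (S I)) (fun i => lsum (shell d Q i) F).
Proof.
  intros HH Hd EQ EI HF. rewrite <- lsum_flat_map. apply lsum_incl; auto using seq_NoDup.
  intros j Hj. apply in_seq in Hj. apply in_flat_map.
  destruct (least_nat (fun i => In j (major d Q (2 ^ i)) ) I) as (i & Hi & Hmin).
  { rewrite EI. apply major_all; auto; lia. }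
  exists i. split.
  - apply in_seq. split; [lia|]. destruct (le_lt_dec i I); [lia|]. exfalso. apply (Hmin I); auto.
    rewrite EI. apply major_all; auto; lia.
  - destruct i as [|i]; [exact Hi|]. apply in_shell_S. split; auto.
Qed.

(** A frequency outside the major arcs of height 2^(i-1) satisfies the hypothesis of [wt_sum_minor]
    with that N; replacing it by 2^i costs at most a factor 2. The innermost shell uses the trivial
    weight H. *)
Lemma shell_weyl d Q H I i j e : (1 <= H)%nat -> (1 <= d)%nat -> Q = (d * (H * H))%nat -> (2 ^ I = 2 * H)%nat ->
  0 < e <= 1 -> (i <= I)%nat -> In j (shell d Q i) ->
  weyl Q H (Z.of_nat j) <= 200 / e * INR H ^ 2 * rpow 2 (- ((1 - e) * INR i)).
Proof.
  intros HH Hd EQ EI He Hi Hj. assert (HH' : 1 <= INR H) by (apply (le_INR 1); auto).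
  assert (HQ : (1 <= Q)%nat) by nia.
  assert (Hie : 1 <= / e) by (rewrite <- Rinv_1; apply Rinv_le_contravar; lra).
  destruct i as [|i].
  - simpl INR. rewrite Rmult_0_r, Ropp_0.
    replace (rpow 2 0) with 1 by (rewrite rpow_pos_eq, Rpower_O by lra; auto). rewrite Rmult_1_r.
    unfold weyl.
    assert (lsum (seq 1 H) (fun h => wt (Z.of_nat Q) H (Z.of_nat h * Z.of_nat j)) <= INR H * INR H).
    { eapply Rle_trans; [apply lsum_le; intros; apply wt_le_H|]. rewrite lsum_const, length_seq. lra. }
    assert (1 * INR H ^ 2 <= / e * INR H ^ 2) by (apply Rmult_le_compat_r; [apply pow2_ge_0|auto]).
    unfold Rdiv. simpl in *. nra.
  - apply in_shell_S in Hj. destruct Hj as [Hj1 Hj2].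
    assert (HN : (1 <= 2 ^ i <= H)%nat).
    { split; [apply Nat.neq_0_lt_0, Nat.pow_nonzero; lia|].
      assert (2 ^ S i <= 2 ^ I)%nat by (apply Nat.pow_le_mono_r; lia). simpl in H0. lia. }
    set (N := (2 ^ i)%nat) in *.
    assert (HN' : 1 <= INR N) by (apply (le_INR 1); lia).
    assert (HNH : INR N <= INR H) by (apply le_INR; lia).
    pose proof (wt_sum_minor (Z.of_nat Q) (INR d) (Z.of_nat j) H N e) as W.
    assert (W' : lsum (seq 1 H) (fun h => wt (Z.of_nat Q) H (Z.of_nat h * Z.of_nat j)) <= 49 / e * INR H ^ 2 * rpow (INR N) (e - 1)).
    { apply W; auto; [lia|apply lt_0_INR; lia| |].
      - rewrite <- INR_IZR_INZ, EQ, !mult_INR. ring.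
      - intros q Hq. rewrite <- mult_INR, INR_IZR_INZ. apply IZR_le.
        destruct (Z_le_gt_dec (Z.of_nat (d * N)) (Z.abs (sres (Z.of_nat Q) (Z.of_nat q * Z.of_nat j)))); auto.
        exfalso; apply Hj2. apply in_major. apply in_major in Hj1. split; [tauto|]. exists q; split; [auto|lia]. }
    assert (B : INR H <= INR H ^ 2 * rpow (INR N) (e - 1)).
    { apply Rle_trans with (INR H ^ 2 * / INR N).
      - apply Rmult_le_reg_r with (INR N); [lra|]. rewrite Rmult_assoc, Rinv_l by lra. nra.
      - apply Rmult_le_compat_l; [apply pow2_ge_0|].
        rewrite <- (rpow_1 (INR N)) at 1 by lra. rewrite <- rpow_opp by lra. apply rpow_le_exp; lra. }
    assert (C : rpow (INR N) (e - 1) <= 2 * rpow 2 (- ((1 - e) * INR (S i)))).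
    { unfold N. rewrite pow_INR. replace (INR 2) with 2 by (simpl; lra).
      rewrite <- rpow_nat, rpow_rpow by lra. rewrite <- (rpow_1 2) at 2 by lra. rewrite <- rpow_plus by lra.
      apply rpow_le_exp; [lra|]. rewrite S_INR. lra. }
    assert (0 <= INR H ^ 2) by apply pow2_ge_0. pose proof (rpow_nonneg (INR N) (e - 1)).
    set (Y := INR H ^ 2 * rpow (INR N) (e - 1)) in *.
    assert (0 <= Y) by (apply Rmult_le_pos; auto).
    assert (Y <= 2 * (INR H ^ 2 * rpow 2 (- ((1 - e) * INR (S i))))) by (unfold Y; nra).
    unfold weyl. apply Rle_trans with (100 / e * Y).
    + unfold Rdiv in *. rewrite Rmult_assoc in W'. fold Y in W'.
      assert (1 * Y <= / e * Y) by (apply Rmult_le_compat_r; auto). lra.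
    + replace (200 / e * INR H ^ 2 * rpow 2 (- ((1 - e) * INR (S i)))) with (100 / e * (2 * (INR H ^ 2 * rpow 2 (- ((1 - e) * INR (S i)))))) by (field; lra).
      apply Rmult_le_compat_l; [unfold Rdiv; lra|auto].
Qed.

Definition kabs Q d M g x (j : nat) : R :=
  Rabs (kre (phase Q (Z.of_nat j)) d M g zerof x) + Rabs (kim (phase Q (Z.of_nat j)) d M g zerof x).

Lemma kabs_nonneg Q d M g x j : 0 <= kabs Q d M g x j.
Proof. unfold kabs. pose proof (Rabs_pos (kre (phase Q (Z.of_nat j)) d M g zerof x)).
  pose proof (Rabs_pos (kim (phase Q (Z.of_nat j)) d M g zerof x)). lra. Qed.

Lemma kabs_l2 (Q H M r d : nat) g (l : list nat) w : (1 <= Q)%nat -> (2 * M + 1 <= H)%nat -> (4 * M <= H)%nat ->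
  (forall j, In j l -> weyl Q H (Z.of_nat j) <= w) ->
  lsum (box d r) (fun x => lsum l (kabs Q d M g x) ^ 2) <=
  2 * INR (length l) ^ 2 * w ^ d * lsum (box d (r + M)) (fun z => g z ^ 2).
Proof.
  intros HQ HH HM Hw.
  apply Rle_trans with (lsum (box d r) (fun x => INR (length l) * lsum l (fun j => 2 *
    (kre (phase Q (Z.of_nat j)) d M g zerof x ^ 2 + kim (phase Q (Z.of_nat j)) d M g zerof x ^ 2)))).
  - apply lsum_le; intros x _. eapply Rle_trans; [apply lsum_cauchy|].
    apply Rmult_le_compat_l; [apply pos_INR|]. apply lsum_le; intros j _. unfold kabs.
    set (a := kre _ _ _ _ _ _). set (b := kim _ _ _ _ _ _).
    rewrite <- (pow2_abs a), <- (pow2_abs b). pose proof (pow2_ge_0 (Rabs a - Rabs b)). lra.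
  - rewrite lsum_scal, lsum_swap.
    apply Rle_trans with (INR (length l) * lsum l (fun _ => 2 * (w ^ d * lsum (box d (r + M)) (fun z => g z ^ 2)))).
    + apply Rmult_le_compat_l; [apply pos_INR|]. apply lsum_le; intros j Hj. rewrite lsum_scal.
      apply Rmult_le_compat_l; [lra|].
      eapply Rle_trans; [apply (k_l2 Q H M r d (Z.of_nat j) g zerof); auto|].
      apply Rmult_le_compat.
      * apply pow_le, weyl_nonneg; auto.
      * apply lsum_nonneg; intros z _. pose proof (pow2_ge_0 (g z)). pose proof (pow2_ge_0 (zerof z)). lra.
      * apply pow_incr; split; [apply weyl_nonneg; auto|auto].
      * right; apply lsum_ext; intros; unfold zerof; ring.
    + rewrite lsum_const. right; ring.
Qed.

Lemma sphere_count_dyadic d c n L : 0 < c -> (forall n, (1 <= n)%nat -> c * sqrt (INR n) ^ (d - 2) <= INR (length (sphere d n))) ->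
  (1 <= L)%nat -> (L * L <= n)%nat -> c * INR L ^ (d - 2) <= INR (length (sphere d n)).
Proof.
  intros Hc H HL Hn. eapply Rle_trans; [|apply H; nia].
  apply Rmult_le_compat_l; [lra|]. apply pow_incr. split; [apply pos_INR|].
  rewrite <- (sqrt_square (INR L)) by apply pos_INR. apply sqrt_le_1_alt.
  rewrite <- mult_INR. apply le_INR; auto.
Qed.

(** Only the number of frequencies in a shell enters the uniform bound. The l^2 bound combines
    Cauchy-Schwarz over the shell, which costs the square 4^(2i) of that number, with the decay
    2^(-(1-e) d i) of [weyl] ^ d. *)
Theorem circle_decomposition d e : (5 <= d)%nat -> 0 < e <= 1 -> exists C, 0 < C /\ forall k,
  let L := (2 ^ k)%nat in exists U : nat -> (Zpt -> R) -> Zpt -> R,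
  forall g, (forall z, 0 <= g z) ->
  (forall i x, 0 <= U i g x) /\
  (forall x n, (L * L <= n < 4 * (L * L))%nat -> ravg d n g x <= lsum (seq 0 (k + 5)) (fun i => U i g x)) /\
  (forall i x, In x (box d L) -> U i g x <= C * 4 ^ i * (lsum (box d (3 * L)) g / INR L ^ d)) /\
  (forall i, (i < k + 5)%nat -> lsum (box d L) (fun x => U i g x ^ 2) <=
     C * rpow 2 ((4 - (1 - e) * INR d) * INR i) * lsum (box d (3 * L)) (fun z => g z ^ 2)).
Proof.
  intros Hd He. destruct (sphere_count_ge d Hd) as (c & Hc & HN).
  set (A1 := 12 / (64 * c)). set (A2 := 2 * (6 / (64 * c)) ^ 2 * (200 / e * 64) ^ d).
  assert (HA1 : 0 < A1) by (apply Rdiv_lt_0_compat; lra).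
  assert (HA2 : 0 < A2).
  { unfold A2. apply Rmult_lt_0_compat; [apply Rmult_lt_0_compat; [lra|]|]; apply pow_lt.
    - apply Rdiv_lt_0_compat; lra.
    - apply Rmult_lt_0_compat; [apply Rdiv_lt_0_compat|]; lra. }
  exists (A1 + A2). split; [lra|]. intros k L.
  (* Spheres of radius below 2L lie in the box M; H = 4M is what [wt_sum_zrange] asks for; Q = d H^2
     exceeds | |y|^2 - n | and gives D = d. As 2H = 16L = 2^(k+4), there are k + 5 shells. *)
  set (M := (2 * L)%nat). set (H := (8 * L)%nat). set (Q := (d * (H * H))%nat).
  assert (HL : (1 <= L)%nat) by (apply Nat.neq_0_lt_0, Nat.pow_nonzero; lia).
  assert (HL' : 1 <= INR L) by (apply (le_INR 1); auto).
  assert (Hd' : 5 <= INR d) by (apply (le_INR 5) in Hd; simpl in Hd; lra).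
  assert (HQ : (1 <= Q)%nat) by (unfold Q, H; nia).
  assert (EQ : INR Q = 64 * INR d * INR L ^ 2).
  { unfold Q, H. rewrite !mult_INR. simpl. ring. }
  assert (HQ' : 1 <= INR Q) by (apply (le_INR 1); auto).
  set (K := / (c * INR L ^ (d - 2) * INR Q)).
  assert (HLd : 0 < INR L ^ (d - 2)) by (apply pow_lt; lra).
  assert (HK : K = / (64 * c * INR d * INR L ^ d)).
  { unfold K. f_equal. rewrite EQ. replace (INR L ^ d) with (INR L ^ (d - 2) * INR L ^ 2) by (rewrite <- pow_add; f_equal; lia). ring. }
  assert (HLd' : 0 < INR L ^ d) by (apply pow_lt; lra).
  assert (HK0 : 0 < K).
  { unfold K. apply Rinv_0_lt_compat. apply Rmult_lt_0_compat; [apply Rmult_lt_0_compat|]; lra. }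
  exists (fun i g x => K * lsum (shell d Q i) (kabs Q d M g x)).
  intros g Hg. split; [|split; [|split]].
  - intros i x. apply Rmult_le_pos; [lra|]. apply lsum_nonneg; intros; apply kabs_nonneg.
  - intros x n Hn. unfold ravg.
    pose proof (sphere_count_dyadic d c n L Hc HN HL ltac:(lia)) as HNn.
    assert (HcL : 0 < c * INR L ^ (d - 2)) by (apply Rmult_lt_0_compat; lra).
    assert (S0 : 0 <= lsum (sphere d n) (fun y => g (vsub x y))) by (apply lsum_nonneg; intros; auto).
    apply Rle_trans with (/ (c * INR L ^ (d - 2)) * lsum (sphere d n) (fun y => g (vsub x y))).
    { unfold Rdiv. rewrite Rmult_comm. apply Rmult_le_compat_r; [auto|]. apply Rinv_le_contravar; auto. }
    pose proof (sphere_sum_le_circle d n M Q g x HQ) as SC.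
    specialize (SC ltac:(unfold M; nia)).
    assert (d * (M * M) < Q)%nat by (unfold M, Q, H; nia). assert (M * M < Q)%nat by nia.
    specialize (SC ltac:(auto) ltac:(auto) Hg).
    assert (CV : lsum (seq 0 Q) (kabs Q d M g x) <= lsum (seq 0 (k + 5)) (fun i => lsum (shell d Q i) (kabs Q d M g x))).
    { replace (k + 5)%nat with (S (k + 4)) by lia. apply shells_cover with H; try (unfold H; lia); auto; [|intros; apply kabs_nonneg].
      rewrite Nat.pow_add_r. unfold H, L. simpl. lia. }
    rewrite lsum_scal. unfold K. rewrite (Rinv_mult (c * INR L ^ (d - 2)) (INR Q)), Rmult_assoc.
    apply Rmult_le_compat_l; [left; apply Rinv_0_lt_compat; auto|].
    eapply Rle_trans; [exact SC|]. apply Rmult_le_compat_l; [left; apply Rinv_0_lt_compat; lra|exact CV].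
  - intros i x Hx. set (S1 := lsum (box d (3 * L)) g).
    assert (HS1 : 0 <= S1) by (apply lsum_nonneg; auto).
    assert (B : lsum (shell d Q i) (kabs Q d M g x) <= 6 * INR d * 4 ^ i * (2 * S1)).
    { apply Rle_trans with (lsum (shell d Q i) (fun _ => 2 * S1)).
      - apply lsum_le; intros j _. unfold S1. replace (3 * L)%nat with (L + M)%nat by (unfold M; lia).
        apply kre_sup; auto.
      - rewrite lsum_const. apply Rmult_le_compat_r; [lra|]. apply shell_length; auto; lia. }
    apply Rle_trans with (K * (6 * INR d * 4 ^ i * (2 * S1))).
    { apply Rmult_le_compat_l; lra. }
    replace (K * (6 * INR d * 4 ^ i * (2 * S1))) with (A1 * (4 ^ i * (S1 / INR L ^ d))).
    2:{ rewrite HK. unfold A1. field. repeat split; try lra. }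
    rewrite Rmult_assoc. apply Rmult_le_compat_r; [|lra].
    apply Rmult_le_pos; [apply pow_le; lra|]. apply Rmult_le_pos; [auto|left; apply Rinv_0_lt_compat; auto].
  - intros i Hi. set (S2 := lsum (box d (3 * L)) (fun z => g z ^ 2)).
    assert (HS2 : 0 <= S2) by (apply lsum_nonneg; intros; apply pow2_ge_0).
    rewrite (lsum_ext _ _ (fun x => K ^ 2 * lsum (shell d Q i) (kabs Q d M g x) ^ 2)) by (intros; ring).
    rewrite lsum_scal.
    set (w := 200 / e * INR H ^ 2 * rpow 2 (- ((1 - e) * INR i))).
    pose proof (kabs_l2 Q H M L d g (shell d Q i) w HQ ltac:(unfold M, H; lia) ltac:(unfold M, H; lia)) as B.
    specialize (B ltac:(intros j Hj; apply (shell_weyl d Q H (k + 4)); auto; try (unfold H; lia); rewrite Nat.pow_add_r; unfold H, L; simpl; lia)).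
    replace (L + M)%nat with (3 * L)%nat in B by (unfold M; lia). fold S2 in B.
    assert (Hw : w = (200 / e * 64 * INR L ^ 2) * rpow 2 (- ((1 - e) * INR i))).
    { unfold w, H. rewrite mult_INR. simpl. ring. }
    assert (Hr : 0 < rpow 2 (- ((1 - e) * INR i))) by (apply rpow_pos; lra).
    assert (He0 : 0 < 200 / e) by (apply Rdiv_lt_0_compat; lra).
    assert (HL2 : 0 < INR L ^ 2) by (apply pow_lt; lra).
    assert (Hw0 : 0 <= w).
    { rewrite Hw. apply Rmult_le_pos; [|lra]. apply Rmult_le_pos; lra. }
    apply Rle_trans with (K ^ 2 * (2 * (6 * INR d * 4 ^ i) ^ 2 * w ^ d * S2)).
    { apply Rmult_le_compat_l; [apply pow2_ge_0|]. eapply Rle_trans; [exact B|].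
      apply Rmult_le_compat_r; [auto|]. apply Rmult_le_compat_r; [apply pow_le; auto|].
      apply Rmult_le_compat_l; [lra|]. apply pow_incr. split; [apply pos_INR|apply shell_length; auto; lia]. }
    assert (E1 : rpow 2 ((4 - (1 - e) * INR d) * INR i) = (4 ^ i) ^ 2 * rpow 2 (- ((1 - e) * INR i)) ^ d).
    { replace (4 ^ i) with (rpow 2 (2 * INR i)).
      - rewrite <- rpow_2, rpow_rpow by (try apply rpow_nonneg; lra). rewrite <- (rpow_nat (rpow 2 (- _))) by auto. rewrite rpow_rpow, <- rpow_plus by lra.
        f_equal. ring.
      - rewrite <- rpow_rpow, rpow_2 by lra. replace (2 ^ 2) with 4 by ring. apply rpow_nat; lra. }
    (* All powers of L cancel: K^2 is of order L^(-2d) and w^d of order L^(2d). *)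
    replace (K ^ 2 * (2 * (6 * INR d * 4 ^ i) ^ 2 * w ^ d * S2)) with (A2 * rpow 2 ((4 - (1 - e) * INR d) * INR i) * S2).
    2:{ rewrite E1, Hw, HK. rewrite !(Rpow_mult_distr (200 / e * 64 * INR L ^ 2)), (Rpow_mult_distr (200 / e * 64)).
        replace ((INR L ^ 2) ^ d) with ((INR L ^ d) ^ 2) by (rewrite <- !pow_mult; f_equal; lia). unfold A2. field. repeat split; try lra. }
    apply Rmult_le_compat_r; [auto|]. apply Rmult_le_compat_r; [apply rpow_nonneg|lra].
Qed.

(** * Local estimates *)

Definition fmax {A} (l : list A) (F : A -> R) : R := fold_right Rmax 0 (map F l).

Lemma fmax_nonneg {A} (l : list A) F : 0 <= fmax l F.
Proof. induction l; [unfold fmax; simpl; lra|]. unfold fmax in *; simpl. eapply Rle_trans; [exact IHl|apply Rmax_r]. Qed.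

Lemma fmax_le {A} (l : list A) F c : 0 <= c -> (forall a, In a l -> F a <= c) -> fmax l F <= c.
Proof.
  intros Hc H. induction l as [|a l IH]; [unfold fmax; simpl; lra|].
  unfold fmax in *; simpl. apply Rmax_lub; [apply H; left; auto|]. apply IH; intros; apply H; right; auto.
Qed.

Lemma fmax_ge {A} (l : list A) F a : In a l -> F a <= fmax l F.
Proof.
  induction l as [|b l IH]; intros Ha; [destruct Ha|]. unfold fmax in *; simpl. destruct Ha as [->|Ha].
  - apply Rmax_l.
  - eapply Rle_trans; [apply IH; auto|apply Rmax_r].
Qed.

Lemma fmax_case {A} (l : list A) F : fmax l F = 0 \/ exists a, In a l /\ fmax l F = F a.
Proof.
  induction l as [|b l IH]; [left; auto|]. unfold fmax in *; simpl.
  unfold Rmax at 1 3. destruct (Rle_dec _ _).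
  - destruct IH as [IH|(a & Ha & E)]; [left; auto|right; exists a; auto].
  - right; exists b; auto.
Qed.

Definition rmax (d L : nat) (g : Zpt -> R) (x : Zpt) : R :=
  fmax (seq (L * L) (3 * (L * L))) (fun n => ravg d n g x).

Lemma rmax_nonneg d L g x : 0 <= rmax d L g x.
Proof. apply fmax_nonneg. Qed.

Lemma in_scales L n : In n (seq (L * L) (3 * (L * L))) <-> (L * L <= n < 4 * (L * L))%nat.
Proof. rewrite in_seq. lia. Qed.

Lemma ravg_plus d n g h x : ravg d n (fun z => g z + h z) x = ravg d n g x + ravg d n h x.
Proof. unfold ravg. rewrite lsum_plus. unfold Rdiv. ring. Qed.

Lemma ravg_lsum {A} d n (l : list A) (g : A -> Zpt -> R) x :
  ravg d n (fun z => lsum l (fun a => g a z)) x = lsum l (fun a => ravg d n (g a) x).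
Proof. unfold ravg, Rdiv. rewrite lsum_swap, <- lsum_scal_r. reflexivity. Qed.

Lemma ravg_one_le d n x : ravg d n (fun _ => 1) x <= 1.
Proof.
  unfold ravg. rewrite lsum_const, Rmult_1_r. destruct (Req_dec (INR (length (sphere d n))) 0) as [E|E].
  - rewrite E. unfold Rdiv. rewrite Rmult_0_l. lra.
  - right. field. auto.
Qed.

Lemma ravg_inv_nonneg d n : 0 <= / INR (length (sphere d n)).
Proof. destruct (pos_INR (length (sphere d n))) as [H|<-]; [left; apply Rinv_0_lt_compat; auto|rewrite Rinv_0; lra]. Qed.

Lemma ravg_le d n g h x : (forall y, In y (sphere d n) -> g (vsub x y) <= h (vsub x y)) -> ravg d n g x <= ravg d n h x.
Proof. intros H. unfold ravg, Rdiv. apply Rmult_le_compat_r; [apply ravg_inv_nonneg|]. apply lsum_le; auto. Qed.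

Lemma in_sphere_box d n M y : (n <= M * M)%nat -> In y (sphere d n) -> In y (box d M).
Proof.
  rewrite in_sphere, in_box. intros Hn [H1 H2]. split; auto.
  apply Forall_forall; intros z Hz. apply normsq_coord in Hz; nia.
Qed.

Lemma ravg_le_box d n L g h x : In x (box d L) -> (n < 4 * (L * L))%nat ->
  (forall z, In z (box d (3 * L)) -> g z <= h z) -> ravg d n g x <= ravg d n h x.
Proof.
  intros Hx Hn H. apply ravg_le. intros y Hy. apply H.
  replace (3 * L)%nat with (L + 2 * L)%nat by lia. apply in_box_vsub; auto.
  apply in_sphere_box with n; auto. nia.
Qed.

(** * Dyadic levels and geometric series *)

Definition level (g : Zpt -> R) (m : nat) (z : Zpt) : R :=
  if Rlt_dec (2 ^ m) (g z) then if Rle_dec (g z) (2 ^ S m) then g z else 0 else 0.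

Lemma level_nonneg g m z : 0 <= g z -> 0 <= level g m z.
Proof. intros; unfold level; destruct (Rlt_dec _ _); [destruct (Rle_dec _ _)|]; lra. Qed.

Lemma levels_cover g z n : 0 <= g z <= 2 ^ n -> g z <= 1 + lsum (seq 0 n) (fun m => level g m z).
Proof.
  intros [H0 H]. induction n as [|n IH].
  - simpl in *. rewrite lsum_nil. lra.
  - assert (N : 0 <= lsum (seq 0 (S n)) (fun m => level g m z)) by (apply lsum_nonneg; intros; apply level_nonneg; auto).
    rewrite seq_S, lsum_app, lsum_cons, lsum_nil. simpl (0 + n)%nat.
    assert (N' : 0 <= lsum (seq 0 n) (fun m => level g m z)) by (apply lsum_nonneg; intros; apply level_nonneg; auto).
    unfold level at 2. destruct (Rlt_dec (2 ^ n) (g z)).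
    + destruct (Rle_dec (g z) (2 ^ S n)); lra.
    + assert (g z <= 2 ^ n) by lra. specialize (IH H1). lra.
Qed.

Lemma level_l1 g m z p : 1 <= p -> 0 <= g z -> level g m z <= 2 * rpow 2 (INR m * (1 - p)) * rpow (g z) p.
Proof.
  intros Hp Hg. unfold level.
  assert (0 <= 2 * rpow 2 (INR m * (1 - p)) * rpow (g z) p).
  { apply Rmult_le_pos; [apply Rmult_le_pos; [lra|]|]; apply rpow_nonneg. }
  destruct (Rlt_dec _ _) as [L|L]; [destruct (Rle_dec _ _) as [U|U]|]; auto.
  assert (rpow 2 (INR m * p) <= rpow (g z) p).
  { rewrite <- rpow_rpow, rpow_nat by lra. apply rpow_le; [|lra]. split; [apply pow_le; lra|lra]. }
  eapply Rle_trans; [exact U|]. apply Rle_trans with (2 * rpow 2 (INR m * (1 - p)) * rpow 2 (INR m * p)).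
  - rewrite Rmult_assoc, <- rpow_plus by lra. replace (INR m * (1 - p) + INR m * p) with (INR m) by ring.
    rewrite rpow_nat by lra. simpl. lra.
  - apply Rmult_le_compat_l; [|auto]. apply Rmult_le_pos; [lra|apply rpow_nonneg].
Qed.

Lemma level_l2 g m z p : 1 <= p -> 0 <= g z -> level g m z ^ 2 <= 4 * rpow 2 (INR m * (2 - p)) * rpow (g z) p.
Proof.
  intros Hp Hg. pose proof (level_l1 g m z p Hp Hg) as H1. pose proof (level_nonneg g m z Hg) as H0.
  assert (H2 : level g m z <= 2 * 2 ^ m).
  { unfold level. assert (0 < 2 ^ m) by (apply pow_lt; lra).
    destruct (Rlt_dec _ _); [destruct (Rle_dec _ _)|]; simpl in *; lra. }
  replace (4 * rpow 2 (INR m * (2 - p)) * rpow (g z) p) with ((2 * 2 ^ m) * (2 * rpow 2 (INR m * (1 - p)) * rpow (g z) p)).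
  - simpl. rewrite Rmult_1_r. apply Rmult_le_compat; auto.
  - rewrite <- (rpow_nat 2 m) by lra. replace (INR m * (2 - p)) with (INR m + INR m * (1 - p)) by ring.
    rewrite rpow_plus by lra. ring.
Qed.

Lemma geometric_le r n : 0 <= r < 1 -> lsum (seq 0 n) (fun i => r ^ i) <= / (1 - r).
Proof.
  intros Hr. assert (E : lsum (seq 0 n) (fun i => r ^ i) * (1 - r) = 1 - r ^ n).
  { induction n as [|n IH]; [simpl; rewrite lsum_nil; ring|].
    rewrite seq_S, lsum_app, lsum_cons, lsum_nil, Rmult_plus_distr_r, IH. simpl. ring. }
  assert (0 <= r ^ n) by (apply pow_le; lra).
  apply Rmult_le_reg_r with (1 - r); [lra|]. rewrite E, Rinv_l by lra. lra.
Qed.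

Lemma rpow2_neg a : 0 < a -> 0 <= rpow 2 (- a) < 1.
Proof.
  intros Ha. split; [apply rpow_nonneg|]. rewrite rpow_opp by lra. rewrite <- Rinv_1.
  apply Rinv_lt_contravar; rewrite ?Rmult_1_l; [apply rpow_pos; lra|].
  rewrite rpow_pos_eq by lra. rewrite <- (Rpower_O 2) by lra. apply Rpower_lt; lra.
Qed.

Lemma geometric2_le a n n' : 0 < a ->
  lsum (list_prod (seq 0 n) (seq 0 n')) (fun im => rpow 2 (- a * (INR (fst im) + INR (snd im)))) <= (/ (1 - rpow 2 (- a))) ^ 2.
Proof.
  intros Ha. pose proof (rpow2_neg a Ha) as Hr. set (r := rpow 2 (- a)) in *.
  assert (Hr0 : 0 < r) by (apply rpow_pos; lra).
  rewrite (lsum_ext _ _ (fun im => r ^ fst im * r ^ snd im)).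
  - rewrite lsum_list_prod. cbn [fst snd].
    rewrite (lsum_ext _ _ (fun i => r ^ i * lsum (seq 0 n') (fun j => r ^ j))) by (intros; apply lsum_scal).
    rewrite lsum_scal_r. simpl (_ ^ 2). rewrite Rmult_1_r.
    apply Rmult_le_compat; try (apply lsum_nonneg; intros; apply pow_le; lra); apply geometric_le; auto.
  - intros [i m] _. cbn [fst snd]. unfold r. rewrite <- !rpow_nat, !rpow_rpow, <- rpow_plus by (try apply rpow_pos; lra).
    f_equal. ring.
Qed.

Lemma lsum_rpow_interpolate {A} (l : list A) a S q : 2 <= q -> (forall x, In x l -> 0 <= a x <= S) ->
  lsum l (fun x => rpow (a x) q) <= rpow S (q - 2) * lsum l (fun x => a x ^ 2).
Proof.
  intros Hq H. rewrite <- lsum_scal. apply lsum_le; intros x Hx. specialize (H x Hx).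
  replace q with ((q - 2) + 2) at 1 by ring. rewrite rpow_plus, rpow_2 by lra.
  apply Rmult_le_compat_r; [apply pow2_ge_0|apply rpow_le; lra].
Qed.

Lemma exists_pow2_ge x : exists n : nat, x <= 2 ^ n.
Proof.
  destruct (INR_unbounded x) as [n Hn]. exists n.
  assert (INR n <= 2 ^ n); [|lra]. clear. induction n; [simpl; lra|]. rewrite S_INR. simpl.
  assert (1 <= 2 ^ n) by (apply pow_R1_Rle; lra). lra.
Qed.

(** Values of g up to 1 are handled trivially. For shell i and level m the uniform and l^2 bounds
    interpolate to the q-th power rate 2^(- mu i - nu m), where mu > 0 comes from q < d/2 and nu > 0
    is the condition 1/p + 1/q < 1. *)
Theorem local_strong_type d p q : (5 <= d)%nat -> 1 <= p -> 2 <= q -> 2 * q < INR d -> p < (p - 1) * q ->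
  exists C, 0 < C /\ forall k g, (forall z, 0 <= g z) ->
  let L := (2 ^ k)%nat in
  lsum (box d (3 * L)) (fun z => rpow (g z) p) <= INR L ^ d ->
  lsum (box d L) (fun x => rpow (rmax d L g x) q) <= C * INR L ^ d.
Proof.
  intros Hd Hp Hq Hqd Hpq.
  (* Chosen so that (1 - e) d is the midpoint of 2q and d, which leaves mu = d/2 - q. *)
  set (e := (INR d - 2 * q) / (2 * INR d)).
  assert (Hd' : 5 <= INR d) by (apply (le_INR 5) in Hd; simpl in Hd; lra).
  assert (He : 0 < e <= 1).
  { unfold e. split; [apply Rdiv_lt_0_compat; lra|]. apply Rmult_le_reg_r with (2 * INR d); [lra|].
    unfold Rdiv. rewrite Rmult_assoc, Rinv_l by lra. lra. }
  destruct (circle_decomposition d e Hd He) as (C & HC & HU).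
  set (mu := (1 - e) * INR d - 2 * q). set (nu := (p - 1) * q - p).
  assert (Hmu : 0 < mu). { unfold mu, e. replace ((1 - (INR d - 2 * q) / (2 * INR d)) * INR d) with (INR d / 2 + q) by (field; lra). lra. }
  assert (Hnu : 0 < nu) by (unfold nu; lra).
  (* Half of the decay pays for the weights 2^(-a (i + m)), which enter to the power 1 - q and cost
     2^(b (i + m)); the other half makes the double series converge. *)
  set (b := Rmin mu nu / 2). assert (Hmn : 0 < Rmin mu nu) by (apply Rmin_glb_lt; auto).
  assert (Hb : 0 < b) by (unfold b; lra).
  set (a := b / (q - 1)). assert (Ha : 0 < a) by (apply Rdiv_lt_0_compat; lra).
  set (Ga := (/ (1 - rpow 2 (- a))) ^ 2). set (Gb := (/ (1 - rpow 2 (- b))) ^ 2).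
  set (C3 := rpow (2 * C) (q - 2) * (C * 4)).
  assert (HC3 : 0 <= C3) by (unfold C3; apply Rmult_le_pos; [apply rpow_nonneg|lra]).
  assert (HGb : 0 <= Gb) by apply pow2_ge_0.
  set (C4 := rpow 2 (q - 1) * (3 ^ d + rpow Ga (q - 1) * (C3 * Gb))).
  exists (C4 + 1). 
  assert (HC4 : 0 <= C4).
  { unfold C4. apply Rmult_le_pos; [apply rpow_nonneg|]. apply Rplus_le_le_0_compat; [apply pow_le; lra|].
    apply Rmult_le_pos; [apply rpow_nonneg|]. apply Rmult_le_pos; auto. }
  split; [lra|]. intros k g Hg L HgL. destruct (HU k) as (U & HUg). fold L in HUg.
  assert (HL : (1 <= L)%nat) by (apply Nat.neq_0_lt_0, Nat.pow_nonzero; lia).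
  assert (HL' : 1 <= INR L) by (apply (le_INR 1); auto).
  assert (HLd : 0 < INR L ^ d) by (apply pow_lt; lra).
  (* This bounds g on the box and makes the set of levels finite; the geometric series keep the
     constants independent of [m1]. *)
  destruct (exists_pow2_ge (lsum (box d (3 * L)) g)) as (m1 & Hm1).
  set (I := list_prod (seq 0 (k + 5)) (seq 0 m1)).
  set (V := fun (im : nat * nat) x => U (fst im) (level g (snd im)) x).
  assert (Hlev : forall m z, 0 <= level g m z) by (intros; apply level_nonneg; auto).
  assert (HV0 : forall im x, 0 <= V im x) by (intros; unfold V; apply (HUg (level g (snd im))); auto).
  assert (Dom : forall x, In x (box d L) -> rmax d L g x <= 1 + lsum I (fun im => V im x)).
  { intros x Hx. assert (0 <= lsum I (fun im => V im x)) by (apply lsum_nonneg; auto).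
    apply fmax_le; [lra|]. intros n Hn. apply in_scales in Hn.
    eapply Rle_trans; [apply (ravg_le_box d n L g (fun z => 1 + lsum (seq 0 m1) (fun m => level g m z))); auto; [lia|]|].
    - intros z Hz. apply levels_cover. split; auto. eapply Rle_trans; [|exact Hm1]. apply lsum_ge_term; auto.
    - rewrite (ravg_plus d n (fun _ => 1)), ravg_lsum. pose proof (ravg_one_le d n x).
      unfold I. rewrite lsum_list_prod, lsum_swap. cbn [fst snd].
      apply Rplus_le_compat; [auto|]. apply lsum_le; intros m _. unfold V; cbn [fst snd].
      apply (HUg (level g m)); auto. }
  assert (Vq : forall im, In im I -> lsum (box d L) (fun x => rpow (V im x) q) <=
    C3 * INR L ^ d * rpow 2 (- mu * INR (fst im) - nu * INR (snd im))).
  { intros [i m] Him. apply in_prod_iff in Him. destruct Him as [Hi _]. apply in_seq in Hi.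
    unfold V; cbn [fst snd]. destruct (HUg (level g m) (Hlev m)) as (H0 & _ & Hsup & Hl2).
    set (S := 2 * C * rpow 2 (2 * INR i + INR m * (1 - p))).
    assert (HS : forall x, In x (box d L) -> 0 <= U i (level g m) x <= S).
    { intros x Hx. split; auto. eapply Rle_trans; [apply Hsup; auto|].
      assert (B : lsum (box d (3 * L)) (level g m) <= 2 * rpow 2 (INR m * (1 - p)) * INR L ^ d).
      { eapply Rle_trans; [apply lsum_le; intros z _; apply (level_l1 g m z p); auto|].
        rewrite lsum_scal. apply Rmult_le_compat_l; auto. apply Rmult_le_pos; [lra|apply rpow_nonneg]. }
      assert (B' : lsum (box d (3 * L)) (level g m) / INR L ^ d <= 2 * rpow 2 (INR m * (1 - p))).
      { apply Rmult_le_reg_r with (INR L ^ d); [auto|]. unfold Rdiv. rewrite Rmult_assoc, Rinv_l by lra. lra. }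
      replace S with (C * 4 ^ i * (2 * rpow 2 (INR m * (1 - p)))).
      - apply Rmult_le_compat_l; auto. apply Rmult_le_pos; [lra|apply pow_le; lra].
      - unfold S. rewrite rpow_plus, <- (rpow_rpow 2 2) by lra. rewrite rpow_2, rpow_nat by lra.
        replace (2 ^ 2) with 4 by ring. ring. }
    eapply Rle_trans; [apply lsum_rpow_interpolate; eauto|].
    assert (B : lsum (box d (3 * L)) (fun z => level g m z ^ 2) <= 4 * rpow 2 (INR m * (2 - p)) * INR L ^ d).
    { eapply Rle_trans; [apply lsum_le; intros z _; apply (level_l2 g m z p); auto|].
      rewrite lsum_scal. apply Rmult_le_compat_l; auto. apply Rmult_le_pos; [lra|apply rpow_nonneg]. }
    apply Rle_trans with (rpow S (q - 2) * (C * rpow 2 ((4 - (1 - e) * INR d) * INR i) * (4 * rpow 2 (INR m * (2 - p)) * INR L ^ d))).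
    - apply Rmult_le_compat_l; [apply rpow_nonneg|]. eapply Rle_trans; [apply Hl2; lia|].
      apply Rmult_le_compat_l; auto. apply Rmult_le_pos; [lra|apply rpow_nonneg].
    - right. unfold S. rewrite rpow_mult by (try apply rpow_nonneg; lra). rewrite rpow_rpow by lra.
      replace (- mu * INR i - nu * INR m) with ((2 * INR i + INR m * (1 - p)) * (q - 2) + ((4 - (1 - e) * INR d) * INR i + INR m * (2 - p)))
        by (unfold mu, nu; ring).
      rewrite !(rpow_plus 2 (_ * (q - 2))), (rpow_plus 2 ((4 - (1 - e) * INR d) * INR i)) by lra. unfold C3. ring. }
  set (w := fun im : nat * nat => rpow 2 (- a * (INR (fst im) + INR (snd im)))).
  assert (Hw : forall im, 0 < w im) by (intros; apply rpow_pos; lra).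
  assert (Pt : forall x, In x (box d L) -> rpow (rmax d L g x) q <=
    rpow 2 (q - 1) * (1 + rpow Ga (q - 1) * lsum I (fun im => rpow (w im) (1 - q) * rpow (V im x) q))).
  { intros x Hx. assert (N : 0 <= lsum I (fun im => V im x)) by (apply lsum_nonneg; auto).
    eapply Rle_trans; [apply rpow_le; [split; [apply rmax_nonneg|apply Dom; auto]|lra]|].
    eapply Rle_trans; [apply rpow_add_le; lra|]. rewrite rpow_one.
    apply Rmult_le_compat_l; [apply rpow_nonneg|]. apply Rplus_le_compat_l.
    eapply Rle_trans; [apply (rpow_sum_le I w); auto; lra|].
    apply Rmult_le_compat_r.
    - apply lsum_nonneg; intros; apply Rmult_le_pos; apply rpow_nonneg.
    - apply rpow_le; [|lra]. split; [apply lsum_nonneg; intros; left; auto|]. apply geometric2_le; auto. }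
  eapply Rle_trans; [apply lsum_le; exact Pt|].
  rewrite lsum_scal, lsum_plus, lsum_const, lsum_scal, length_box, lsum_swap.
  assert (T : lsum I (fun im => lsum (box d L) (fun x => rpow (w im) (1 - q) * rpow (V im x) q)) <= C3 * INR L ^ d * Gb).
  { apply Rle_trans with (lsum I (fun im => C3 * INR L ^ d * rpow 2 (- b * (INR (fst im) + INR (snd im))))).
    - apply lsum_le; intros im Him. rewrite lsum_scal.
      apply Rle_trans with (rpow (w im) (1 - q) * (C3 * INR L ^ d * rpow 2 (- mu * INR (fst im) - nu * INR (snd im)))).
      + apply Rmult_le_compat_l; [apply rpow_nonneg|auto].
      + replace (rpow (w im) (1 - q) * (C3 * INR L ^ d * rpow 2 (- mu * INR (fst im) - nu * INR (snd im))))
          with (C3 * INR L ^ d * (rpow (w im) (1 - q) * rpow 2 (- mu * INR (fst im) - nu * INR (snd im)))) by ring.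
        apply Rmult_le_compat_l; [apply Rmult_le_pos; lra|].
        unfold w. rewrite rpow_rpow, <- rpow_plus by lra. apply rpow_le_exp; [lra|].
        assert (Eb : a * (q - 1) = b) by (unfold a; field; lra).
        replace (- a * (INR (fst im) + INR (snd im)) * (1 - q)) with (b * (INR (fst im) + INR (snd im))) by (rewrite <- Eb; ring).
        pose proof (Rmin_l mu nu). pose proof (Rmin_r mu nu). 
        assert (B1 : 2 * b <= mu) by (unfold b; lra). assert (B2 : 2 * b <= nu) by (unfold b; lra).
        pose proof (pos_INR (fst im)). pose proof (pos_INR (snd im)). nra.
    - rewrite lsum_scal. apply Rmult_le_compat_l; [apply Rmult_le_pos; lra|]. apply geometric2_le; auto. }
  apply Rle_trans with (C4 * INR L ^ d); [|nra].
  unfold C4. rewrite Rmult_assoc. apply Rmult_le_compat_l; [apply rpow_nonneg|].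
  rewrite Rmult_plus_distr_r. apply Rplus_le_compat.
  - rewrite Rmult_1_r, <- Rpow_mult_distr. apply pow_incr. lra.
  - rewrite Rmult_assoc. apply Rmult_le_compat_l; [apply rpow_nonneg|]. lra.
Qed.

(** * Sufficiency *)

Lemma ravg_jensen d n g x k : 1 <= k -> (forall z, 0 <= g z) ->
  rpow (ravg d n g x) k <= ravg d n (fun z => rpow (g z) k) x.
Proof.
  intros Hk Hg. unfold ravg.
  destruct (pos_INR (length (sphere d n))) as [H|H].
  - pose proof (rpow_jensen (sphere d n) (fun _ => / INR (length (sphere d n))) (fun y => g (vsub x y)) k Hk) as J.
    cbv beta in J. rewrite !lsum_scal, lsum_const in J. unfold Rdiv. rewrite !(Rmult_comm _ (/ _)). apply J; auto.
    + intros; left; apply Rinv_0_lt_compat; auto.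
    + apply Rinv_r; lra.
  (* An empty sphere has average 0, since division by 0 gives 0. *)
  - rewrite <- H. unfold Rdiv. rewrite Rinv_0, !Rmult_0_r, rpow_0. lra.
Qed.

Lemma rmax_jensen d L g x k : 1 <= k -> (forall z, 0 <= g z) ->
  rpow (rmax d L g x) k <= rmax d L (fun z => rpow (g z) k) x.
Proof.
  intros Hk Hg. unfold rmax at 1. destruct (fmax_case (seq (L * L) (3 * (L * L))) (fun n => ravg d n g x)) as [->|(n & Hn & ->)].
  - rewrite rpow_0. apply rmax_nonneg.
  - eapply Rle_trans; [apply ravg_jensen; auto|]. apply (fmax_ge _ (fun n => ravg d n (fun z => rpow (g z) k) x)); auto.
Qed.

(** The requirement q < d/2 leaves room for q above 1/(u k) and 1/(1 - s k) exactly when u k > 2/d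
    and s k < (d-2)/d. Together with k >= 1 these confine k to an interval, nonempty by the two
    inequalities of the region; k and q are taken as midpoints. *)
Lemma exists_exponents d s u : (5 <= d)%nat -> 0 < s -> 0 < u -> 2 * s < (INR d - 2) * u -> INR d * s < INR d - 2 ->
  exists k q, 1 <= k /\ s * k < 1 /\ 2 <= q /\ 2 * q < INR d /\ 1 < (1 - s * k) * q /\ 1 / u <= k * q.
Proof.
  intros Hd Hs Hu H1 H2.
  assert (Hd' : 5 <= INR d) by (apply (le_INR 5) in Hd; simpl in Hd; lra).
  set (D := INR d) in *.
  set (k0 := Rmax 1 (2 / (D * u))). set (k1 := (D - 2) / (D * s)).
  assert (Hk : k0 < k1).
  { unfold k0, k1. apply Rmax_lub_lt.
    - apply Rmult_lt_reg_r with (D * s); [nra|]. unfold Rdiv. rewrite Rmult_assoc, Rinv_l by nra. lra.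
    - apply Rmult_lt_reg_r with (D * s * u); [apply Rmult_lt_0_compat; nra|].
      replace (2 / (D * u) * (D * s * u)) with (2 * s) by (field; lra).
      replace ((D - 2) / (D * s) * (D * s * u)) with ((D - 2) * u) by (field; lra). lra. }
  set (k := (k0 + k1) / 2). assert (K0 : k0 < k) by (unfold k; lra). assert (K1 : k < k1) by (unfold k; lra).
  assert (Hk1 : 1 < k) by (eapply Rle_lt_trans; [apply Rmax_l|exact K0]).
  assert (Hk2 : 2 < D * (u * k)).
  { assert (2 / (D * u) < k) by (eapply Rle_lt_trans; [apply Rmax_r|exact K0]).
    apply Rmult_lt_compat_l with (r := D * u) in H; [|nra].
    replace (D * u * (2 / (D * u))) with 2 in H by (field; lra). lra. }
  assert (Hk3 : D * (s * k) < D - 2).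
  { apply Rmult_lt_compat_l with (r := D * s) in K1; [|nra].
    unfold k1 in K1. replace (D * s * ((D - 2) / (D * s))) with (D - 2) in K1 by (field; lra). lra. }
  assert (Hsk : s * k < 1) by nra.
  assert (Huk : 0 < u * k) by nra.
  set (q0 := Rmax 2 (Rmax (/ (u * k)) (/ (1 - s * k)))).
  assert (Hq : q0 < D / 2).
  { unfold q0. apply Rmax_lub_lt; [lra|]. apply Rmax_lub_lt.
    - apply Rmult_lt_reg_r with (u * k); [auto|]. rewrite Rinv_l by lra. lra.
    - apply Rmult_lt_reg_r with (1 - s * k); [lra|]. rewrite Rinv_l by lra. nra. }
  set (q := (q0 + D / 2) / 2). assert (Q0 : q0 < q) by (unfold q; lra).
  assert (Q1 : 2 <= q) by (left; eapply Rle_lt_trans; [apply Rmax_l|exact Q0]).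
  assert (Q2 : / (u * k) < q).
  { eapply Rle_lt_trans; [|exact Q0]. unfold q0. eapply Rle_trans; [apply Rmax_l|apply Rmax_r]. }
  assert (Q3 : / (1 - s * k) < q).
  { eapply Rle_lt_trans; [|exact Q0]. unfold q0. eapply Rle_trans; [apply Rmax_r|apply Rmax_r]. }
  exists k, q. repeat split; try lra.
  - unfold q; lra.
  - apply Rmult_lt_compat_l with (r := 1 - s * k) in Q3; [|lra]. rewrite Rinv_r in Q3 by lra. lra.
  - apply Rmult_lt_compat_l with (r := k) in Q2; [|lra].
    replace (k * / (u * k)) with (1 / u) in Q2 by (field; lra). lra.
Qed.

(** The strong type bound is applied to g^k with p = 1/(s k). The exponent k q is then lowered to
    1/u by B^(1/u) <= 1 + B^(k q); the constant 1 costs the number of points of the box, which is of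
    the order allowed. *)
Theorem local_type d s u : (5 <= d)%nat -> 0 < s -> 0 < u -> 2 * s < (INR d - 2) * u -> INR d * s < INR d - 2 ->
  exists C, 0 < C /\ forall k g, (forall z, 0 <= g z) ->
  let L := (2 ^ k)%nat in
  lsum (box d (3 * L)) (fun z => rpow (g z) (1 / s)) <= INR L ^ d ->
  lsum (box d L) (fun x => rpow (rmax d L g x) (1 / u)) <= C * INR L ^ d.
Proof.
  intros Hd Hs Hu H1 H2.
  destruct (exists_exponents d s u Hd Hs Hu H1 H2) as (k & q & Hk & Hsk & Hq & Hqd & Hkq & Huq).
  set (p := 1 / (s * k)). assert (Hsk0 : 0 < s * k) by nra.
  assert (Hp : 1 < p).
  { unfold p. apply Rmult_lt_reg_r with (s * k); [auto|]. unfold Rdiv. rewrite Rmult_assoc, Rinv_l by lra. lra. }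
  assert (Hpq : p < (p - 1) * q).
  { unfold p. apply Rmult_lt_reg_r with (s * k); [auto|].
    replace ((1 / (s * k) - 1) * q * (s * k)) with ((1 - s * k) * q) by (field; split; lra).
    unfold Rdiv. rewrite Rmult_assoc, Rinv_l by lra. lra. }
  destruct (local_strong_type d p q Hd ltac:(lra) Hq Hqd Hpq) as (C & HC & HL).
  exists (3 ^ d + C). assert (0 < 3 ^ d) by (apply pow_lt; lra). split; [lra|].
  intros m g Hg L Hloc.
  assert (HL1 : (1 <= L)%nat) by (apply Nat.neq_0_lt_0, Nat.pow_nonzero; lia).
  assert (HL' : 1 <= INR L) by (apply (le_INR 1); auto).
  specialize (HL m (fun z => rpow (g z) k) (fun z => rpow_nonneg _ _)). cbv zeta in HL. fold L in HL.
  assert (E : lsum (box d (3 * L)) (fun z => rpow (rpow (g z) k) p) = lsum (box d (3 * L)) (fun z => rpow (g z) (1 / s))).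
  { apply lsum_ext; intros z _. rewrite rpow_rpow by auto. f_equal. unfold p. field. lra. }
  cbv beta in HL. rewrite E in HL. specialize (HL Hloc).
  apply Rle_trans with (lsum (box d L) (fun x => 1 + rpow (rmax d L (fun z => rpow (g z) k) x) q)).
  - apply lsum_le; intros x _. set (B := rmax d L g x).
    assert (HB : 0 <= B) by apply rmax_nonneg.
    assert (B1 : rpow B (k * q) <= rpow (rmax d L (fun z => rpow (g z) k) x) q).
    { rewrite <- rpow_rpow by auto. apply rpow_le; [|lra]. split; [apply rpow_nonneg|]. apply rmax_jensen; auto. }
    destruct (Rle_or_lt B 1).
    + assert (rpow B (1 / u) <= 1).
      { apply Rle_trans with (rpow 1 (1 / u)); [|rewrite rpow_one; lra].
        apply rpow_le; [lra|]. left; apply Rdiv_lt_0_compat; lra. }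
      pose proof (rpow_nonneg (rmax d L (fun z => rpow (g z) k) x) q). lra.
    + assert (rpow B (1 / u) <= rpow B (k * q)) by (apply rpow_le_exp; lra). lra.
  - rewrite lsum_plus, lsum_const, length_box.
    assert ((2 * INR L + 1) ^ d <= 3 ^ d * INR L ^ d).
    { rewrite <- Rpow_mult_distr. apply pow_incr. lra. }
    lra.
Qed.

(** * Translation invariance and homogeneity *)

Definition vadd (x y : Zpt) : Zpt := map (fun p => (fst p + snd p)%Z) (combine x y).

Lemma length_vadd x y d : length x = d -> length y = d -> length (vadd x y) = d.
Proof. intros. unfold vadd. rewrite length_map, length_combine. lia. Qed.

Lemma vsub_vadd c x y d : length c = d -> length x = d -> length y = d -> vsub (vadd c x) y = vadd c (vsub x y).
Proof.
  revert c x y. induction d as [|d IH]; intros [|a c] [|b x] [|e y] Hc Hx Hy; simpl in *; try discriminate; auto.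
  unfold vsub, vadd in *. simpl. f_equal; [lia|]. apply IH; lia.
Qed.

Lemma vadd_vsub_cancel x y d : length x = d -> length y = d -> vadd (vsub x y) y = x.
Proof.
  revert x y. induction d as [|d IH]; intros [|b x] [|e y] Hx Hy; simpl in *; try discriminate; auto.
  unfold vsub, vadd in *. simpl. f_equal; [lia|]. apply IH; lia.
Qed.

Lemma vadd_inj_l c c' z d : length c = d -> length c' = d -> length z = d -> vadd c z = vadd c' z -> c = c'.
Proof.
  revert c c' z. induction d as [|d IH]; intros [|a c] [|a' c'] [|b z] Hc Hc' Hz E; simpl in *; try discriminate; auto.
  injection E; intros E2 E1. f_equal; [lia|]. apply IH with z; auto; lia.
Qed.

Lemma vadd_comm x y : vadd x y = vadd y x.
Proof.
  revert y. induction x as [|a x IH]; intros [|b y]; auto.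
  unfold vadd in *; simpl. f_equal; [lia|apply IH].
Qed.

Lemma ravg_translate d n g c x : length c = d -> length x = d ->
  ravg d n g (vadd c x) = ravg d n (fun z => g (vadd c z)) x.
Proof.
  intros Hc Hx. unfold ravg. f_equal. apply lsum_ext; intros y Hy. apply in_sphere in Hy.
  rewrite (vsub_vadd c x y d); tauto.
Qed.

Lemma fmax_ext {A} (l : list A) F G : (forall a, In a l -> F a = G a) -> fmax l F = fmax l G.
Proof. intros H. unfold fmax. f_equal. apply map_ext_in; auto. Qed.

Lemma fmax_scal {A} (l : list A) c F : 0 <= c -> fmax l (fun a => c * F a) = c * fmax l F.
Proof.
  intros Hc. induction l as [|a l IH]; [unfold fmax; simpl; ring|].
  unfold fmax in *; simpl. rewrite IH. apply RmaxRmult; auto.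
Qed.

Lemma rmax_translate d L g c x : length c = d -> length x = d ->
  rmax d L g (vadd c x) = rmax d L (fun z => g (vadd c z)) x.
Proof. intros; apply fmax_ext; intros; apply ravg_translate; auto. Qed.

Lemma rmax_scal d L g b x : 0 <= b -> rmax d L (fun z => b * g z) x = b * rmax d L g x.
Proof.
  intros Hb. unfold rmax. rewrite <- fmax_scal by auto. apply fmax_ext; intros n _.
  unfold ravg. rewrite lsum_scal. unfold Rdiv. ring.
Qed.

Lemma rmax_zero d L g x : In x (box d L) -> (forall z, In z (box d (3 * L)) -> g z = 0) -> rmax d L g x = 0.
Proof.
  intros Hx H. apply Rle_antisym; [|apply rmax_nonneg]. apply fmax_le; [lra|].
  intros n Hn. apply in_scales in Hn.
  eapply Rle_trans; [apply (ravg_le_box d n L g (fun _ => 0)); auto; [lia|]|].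
  - intros z Hz; rewrite H; auto; lra.
  - unfold ravg. rewrite lsum_zero by auto. unfold Rdiv. lra.
Qed.

(** With V the normalised sum of g^(1/s), division by b = V^s turns the hypothesis of [local_type]
    into an equality; undoing it on the left gives b^(1/u) = V^(s/u). If V = 0, then g vanishes on
    the box. *)
Lemma local_type_homogeneous d s u : (5 <= d)%nat -> 0 < s -> 0 < u -> 2 * s < (INR d - 2) * u -> INR d * s < INR d - 2 ->
  exists C, 0 < C /\ forall k g, (forall z, 0 <= g z) ->
  let L := (2 ^ k)%nat in
  lsum (box d L) (fun x => rpow (rmax d L g x) (1 / u)) <=
    C * INR L ^ d * rpow (lsum (box d (3 * L)) (fun z => rpow (g z) (1 / s)) / INR L ^ d) (s / u).
Proof.
  intros Hd Hs Hu H1 H2. destruct (local_type d s u Hd Hs Hu H1 H2) as (C & HC & HL).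
  exists C. split; [auto|]. intros k g Hg L.
  assert (HL1 : (1 <= L)%nat) by (apply Nat.neq_0_lt_0, Nat.pow_nonzero; lia).
  assert (HL' : 1 <= INR L) by (apply (le_INR 1); auto).
  assert (HLd : 0 < INR L ^ d) by (apply pow_lt; lra).
  set (N := lsum (box d (3 * L)) (fun z => rpow (g z) (1 / s))).
  assert (HN : 0 <= N) by (apply lsum_nonneg; intros; apply rpow_nonneg).
  destruct HN as [HN|HN].
  - set (V := N / INR L ^ d). assert (HV : 0 < V) by (apply Rdiv_lt_0_compat; auto).
    set (b := rpow V s). assert (Hb : 0 < b) by (apply rpow_pos; auto).
    assert (Hib : 0 < / b) by (apply Rinv_0_lt_compat; auto).
    specialize (HL k (fun z => / b * g z)). cbv zeta in HL. fold L in HL.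
    assert (HLb : lsum (box d L) (fun x => rpow (rmax d L (fun z => / b * g z) x) (1 / u)) <= C * INR L ^ d).
    { apply HL.
      - intros z; apply Rmult_le_pos; [lra|auto].
      - rewrite (lsum_ext _ _ (fun z => / V * rpow (g z) (1 / s))).
        + rewrite lsum_scal. fold N. unfold V. right. field. lra.
        + intros z _. rewrite rpow_mult, rpow_inv by (auto; lra). unfold b. rewrite rpow_rpow by lra.
          replace (s * (1 / s)) with 1 by (field; lra). rewrite rpow_1 by lra. auto. }
    rewrite (lsum_ext _ _ (fun x => rpow V (s / u) * rpow (rmax d L (fun z => / b * g z) x) (1 / u))).
    + rewrite lsum_scal, Rmult_comm. apply Rmult_le_compat_r; [apply rpow_nonneg|auto].
    + intros x _. rewrite rmax_scal, rpow_mult, rpow_inv by (try apply rmax_nonneg; lra).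
      unfold b. rewrite rpow_rpow by lra. replace (s * (1 / u)) with (s / u) by (field; lra).
      assert (0 < rpow V (s / u)) by (apply rpow_pos; auto). field. lra.
  - rewrite <- HN. unfold Rdiv at 2. rewrite Rmult_0_l, rpow_0, Rmult_0_r.
    right. apply lsum_zero. intros x Hx. rewrite rmax_zero, rpow_0; auto.
    intros z Hz. apply rpow_eq_0 with (1 / s). apply Rle_antisym; [|apply rpow_nonneg].
    rewrite HN. unfold N. apply (lsum_ge_term _ (fun z => rpow (g z) (1 / s))); auto. intros; apply rpow_nonneg.
Qed.

(** * Domination of complex averages by real ones *)

Lemma Cmod_nonneg z : 0 <= Cmod z.
Proof. apply sqrt_pos. Qed.

Lemma Cmod_sq z : Cmod z ^ 2 = fst z ^ 2 + snd z ^ 2.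
Proof.
  unfold Cmod. rewrite <- Rsqr_pow2. apply Rsqr_sqrt.
  pose proof (pow2_ge_0 (fst z)). pose proof (pow2_ge_0 (snd z)). lra.
Qed.

Lemma Cmod_triangle a b c e : Cmod (a + c, b + e) <= Cmod (a, b) + Cmod (c, e).
Proof.
  pose proof (Cmod_nonneg (a, b)) as H1. pose proof (Cmod_nonneg (c, e)) as H2.
  pose proof (Cmod_sq (a, b)) as E1. pose proof (Cmod_sq (c, e)) as E2. pose proof (Cmod_sq (a + c, b + e)) as E3.
  cbn [fst snd] in *. set (X := Cmod (a, b)) in *. set (Y := Cmod (c, e)) in *.
  apply le_of_sq_le; [lra|]. rewrite E3.
  assert (a * c + b * e <= X * Y).
  { apply le_of_sq_le; [apply Rmult_le_pos; auto|]. rewrite Rpow_mult_distr, E1, E2.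
    pose proof (pow2_ge_0 (a * e - b * c)). nra. }
  nra.
Qed.

Lemma Cmod_scal a b c : 0 <= c -> Cmod (a * c, b * c) = Cmod (a, b) * c.
Proof.
  intros Hc. pose proof (Cmod_nonneg (a, b)) as H1. pose proof (Cmod_nonneg (a * c, b * c)) as H2.
  pose proof (Cmod_sq (a, b)) as E1. pose proof (Cmod_sq (a * c, b * c)) as E2. cbn [fst snd] in *.
  assert (0 <= Cmod (a, b) * c) by (apply Rmult_le_pos; auto).
  apply Rle_antisym; apply le_of_sq_le; auto; rewrite Rpow_mult_distr, E1, E2; right; ring.
Qed.

Lemma Cmod_lsum {A} (l : list A) F G : Cmod (lsum l F, lsum l G) <= lsum l (fun a => Cmod (F a, G a)).
Proof.
  induction l as [|a l IH].
  - rewrite !lsum_nil. unfold Cmod; simpl. rewrite Rmult_0_l, Rplus_0_l, sqrt_0. lra.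
  - rewrite !lsum_cons. eapply Rle_trans; [apply Cmod_triangle|]. lra.
Qed.

Lemma sph_avg_le d n f x : Cmod (sph_avg d n f x) <= ravg d n (fun z => Cmod (f z)) x.
Proof.
  unfold sph_avg, ravg, Rdiv. rewrite Cmod_scal by apply ravg_inv_nonneg.
  apply Rmult_le_compat_r; [apply ravg_inv_nonneg|].
  eapply Rle_trans; [apply (Cmod_lsum (sphere d n) (fun y => fst (f (vsub x y))) (fun y => snd (f (vsub x y))))|].
  apply lsum_le; intros y _. rewrite <- surjective_pairing. lra.
Qed.

Lemma max_avg_nonneg d L f x : 0 <= max_avg d L f x.
Proof. exact (fmax_nonneg (seq (L * L) (3 * (L * L))) (fun n => Cmod (sph_avg d n f x))). Qed.

Lemma max_avg_le d L f x : max_avg d L f x <= rmax d L (fun z => Cmod (f z)) x.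
Proof.
  apply (fmax_le (seq (L * L) (3 * (L * L))) (fun n => Cmod (sph_avg d n f x))); [apply rmax_nonneg|].
  intros n Hn. eapply Rle_trans; [apply sph_avg_le|].
  apply (fmax_ge _ (fun n => ravg d n (fun z => Cmod (f z)) x)); auto.
Qed.

(** The triangle satisfies three linear inequalities, and moving an interior point by eps/2 towards
    each side makes them strict. Positivity of s then follows from 2s < (d-2) u and u < s, as d >
    4. *)
Lemma region_inequalities d s t : (5 <= d)%nat -> regionR d s t ->
  0 < s /\ 1 - t < s /\ 2 * s < (INR d - 2) * (1 - t) /\ INR d * s < INR d - 2.
Proof.
  intros Hd (eps & He & H).
  assert (Hd' : 5 <= INR d) by (apply (le_INR 5) in Hd; simpl in Hd; lra).
  set (D := INR d) in *.
  assert (Hull : forall s' t', in_hull d s' t' -> D * s' <= D - 2 /\ 1 <= s' + t' /\ (D - 2) * t' + 2 * s' <= D - 2).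
  { intros s' t' (a & b & c & Ha & Hb & Hc & Hs & -> & ->). fold D.
    replace a with (1 - b - c) by lra.
    assert (E1 : D * ((D - 2) / D) = D - 2) by (field; lra).
    assert (E2 : D * (2 / D) = 2) by (field; lra).
    set (x := (D - 2) / D) in *. set (y := 2 / D) in *.
    assert (Hx : x + y = 1) by (unfold x, y; field; lra).
    assert (Hy : 0 < y) by (apply Rdiv_lt_0_compat; lra).
    assert (Hxy : y <= x) by nra.
    split; [|split].
    - replace (D * ((1 - b - c) * 0 + b * x + c * x)) with ((b + c) * (D * x)) by ring. rewrite E1. nra.
    - nra.
    - replace ((D - 2) * ((1 - b - c) * 1 + b * y + c * x) + 2 * ((1 - b - c) * 0 + b * x + c * x))
        with ((D - 2) - (D - 2) * (b + c) + b * ((D - 2) * y + 2 * x) + c * (D * x)) by ring.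
      rewrite E1. replace y with (1 - x) by lra. assert (Dx : x = 1 - y) by lra.
      assert ((D - 2) * (1 - x) + 2 * x <= D - 2) by nra. nra. }
  destruct (Hull (s + eps / 2) t) as (A1 & _ & _); [apply H; nra|].
  destruct (Hull s (t - eps / 2)) as (_ & A2 & _); [apply H; nra|].
  destruct (Hull s (t + eps / 2)) as (_ & _ & A3); [apply H; nra|].
  assert (B1 : D * s < D - 2) by nra. assert (B2 : 1 - t < s) by lra.
  assert (B3 : 2 * s < (D - 2) * (1 - t)) by nra.
  split; [|auto]. nra.
Qed.

Lemma list_in_box d S : Forall (fun x => length x = d) S -> exists r, forall x, In x S -> In x (box d r).
Proof.
  intros HS. induction HS as [|x S Hx HS (r & IH)].
  - exists 0%nat. intros x [].
  - assert (exists m, In x (box d m)) as (m & Hm).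
    { exists (Z.to_nat (normsq x)). apply in_box. split; auto. apply Forall_forall. intros z Hz.
      apply normsq_coord in Hz. nia. }
    assert (Mono : forall a b y, (a <= b)%nat -> In y (box d a) -> In y (box d b)).
    { intros a b y Hab. rewrite !in_box. intros [H1 H2]. split; auto. eapply Forall_impl; [|exact H2]. simpl; intros; lia. }
    exists (Nat.max r m). intros y [<-|Hy]; [apply Mono with m; auto; lia|apply Mono with r; auto; lia].
Qed.

Theorem max_estimate_sufficiency d s t : (5 <= d)%nat -> regionR d s t -> exists A, max_estimate d s t A.
Proof.
  intros Hd HR. destruct (region_inequalities d s t Hd HR) as (Hs & Hts & H1 & H2).
  assert (Hd' : 5 <= INR d) by (apply (le_INR 5) in Hd; simpl in Hd; lra).
  set (u := 1 - t) in *. assert (Hu : 0 < u) by nra.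
  destruct (local_type_homogeneous d s u Hd Hs Hu H1 H2) as (C0 & HC0 & Hloc).
  set (A := rpow (C0 * 3 ^ d) u). exists A.
  intros k f C HC Hf. fold u. unfold lp_le in *. destruct (Req_EM_T s 0); [lra|]. destruct (Req_EM_T u 0); [lra|].
  intros S HSn HSd. set (L := (2 ^ k)%nat) in *.
  assert (HL1 : (1 <= L)%nat) by (apply Nat.neq_0_lt_0, Nat.pow_nonzero; lia).
  assert (HL' : 1 <= INR L) by (apply (le_INR 1); auto).
  assert (HLd : 0 < INR L ^ d) by (apply pow_lt; lra).
  set (g := fun z => Cmod (f z)).
  assert (Hg : forall z, 0 <= g z) by (intros; apply Cmod_nonneg).
  assert (Hf' : forall S, NoDup S -> Forall (fun x => length x = d) S -> lsum S (fun x => rpow (g x) (1 / s)) <= rpow C (1 / s)).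
  { intros S' Hn Hl. eapply Rle_trans; [|apply (Hf S' Hn Hl)]. right. apply lsum_ext; intros x _.
    rewrite Rabs_right; [reflexivity|]. apply Rle_ge, Hg. }
  set (F := fun x => rpow (rmax d L g x) (1 / u)).
  assert (HF : forall x, 0 <= F x) by (intros; apply rpow_nonneg).
  apply Rle_trans with (lsum S F).
  { apply lsum_le; intros x _. unfold F. rewrite Rabs_right by (apply Rle_ge, max_avg_nonneg).
    apply rpow_le; [split; [apply max_avg_nonneg|apply max_avg_le]|]. left; apply Rdiv_lt_0_compat; lra. }
  destruct (list_in_box d S HSd) as (r & Hr).
  (* Large enough to contain y - x for every y in [S] and x in the box of side L, so each y is
     counted once for every x. *)
  set (B := box d (r + L)).
  assert (Blen : forall c, In c B -> length c = d) by (intros c Hc; apply in_box in Hc; tauto).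
  set (Vs := rpow C (1 / s) / INR L ^ d).
  assert (HVs : 0 <= Vs) by (apply Rmult_le_pos; [apply rpow_nonneg|left; apply Rinv_0_lt_compat; auto]).
  set (V := fun c => lsum (box d (3 * L)) (fun z => rpow (g (vadd c z)) (1 / s)) / INR L ^ d).
  assert (HV0 : forall c, 0 <= V c).
  { intros c. apply Rmult_le_pos; [apply lsum_nonneg; intros; apply rpow_nonneg|left; apply Rinv_0_lt_compat; auto]. }
  assert (HV1 : forall c, In c B -> V c <= Vs).
  { intros c Hc. apply Rmult_le_compat_r; [left; apply Rinv_0_lt_compat; auto|].
    rewrite <- (lsum_map _ (fun z => vadd c z) (fun z => rpow (g z) (1 / s))). apply Hf'.
    - apply NoDup_map_inj_on; [|apply NoDup_box]. intros x y Hx Hy E. apply in_box in Hx, Hy.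
      rewrite !(vadd_comm c) in E. apply vadd_inj_l with c d; auto; tauto.
    - apply Forall_forall. intros y Hy. apply in_map_iff in Hy. destruct Hy as (z & <- & Hz). apply in_box in Hz.
      apply length_vadd; [auto|tauto]. }
  assert (HV2 : lsum B V <= INR (length (box d (3 * L))) * Vs).
  { unfold V. unfold Rdiv. rewrite lsum_scal_r, lsum_swap. unfold Vs, Rdiv. rewrite <- Rmult_assoc.
    apply Rmult_le_compat_r; [left; apply Rinv_0_lt_compat; auto|].
    rewrite <- lsum_const. apply lsum_le. intros z Hz. apply in_box in Hz.
    rewrite <- (lsum_map _ (fun c => vadd c z) (fun z => rpow (g z) (1 / s))). apply Hf'.
    - apply NoDup_map_inj_on; [|apply NoDup_box]. intros x y Hx Hy E.
      apply vadd_inj_l with z d; auto; tauto.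
    - apply Forall_forall. intros y Hy. apply in_map_iff in Hy. destruct Hy as (c & <- & Hc).
      apply length_vadd; [auto|tauto]. }
  (* Here u < s enters: the local masses satisfy sum V_c^(s/u) <= (sup V_c)^(s/u - 1) sum V_c, and
     both factors are controlled by the global norm. *)
  assert (Hsu : 1 <= s / u).
  { apply Rmult_le_reg_r with u; auto. unfold Rdiv. rewrite Rmult_assoc, Rinv_l by lra. lra. }
  (* Average over all translates of the box of side L rather than tile Z^d. *)
  assert (Cover : INR (length (box d L)) * lsum S F <= lsum B (fun c => lsum (box d L) (fun x => F (vadd c x)))).
  { rewrite lsum_swap, <- lsum_const. apply lsum_le; intros x Hx. apply in_box in Hx as Hx'. destruct Hx' as [Hxl _].
    apply lsum_inj with (fun y => vsub y x); auto.
    - intros y y' Hy Hy' E. rewrite Forall_forall in HSd.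
      rewrite <- (vadd_vsub_cancel y x d), <- (vadd_vsub_cancel y' x d), E; auto.
    - intros y Hy. split; [apply in_box_vsub; auto|]. rewrite Forall_forall in HSd.
      rewrite (vadd_vsub_cancel y x d); auto. lra. }
  assert (Main : INR (length (box d L)) * lsum S F <= C0 * INR L ^ d * (INR (length (box d (3 * L))) * rpow Vs (s / u))).
  { eapply Rle_trans; [exact Cover|].
    apply Rle_trans with (lsum B (fun c => C0 * INR L ^ d * (V c * rpow Vs (s / u - 1)))).
    - apply lsum_le; intros c Hc. unfold F.
      rewrite (lsum_ext _ _ (fun x => rpow (rmax d L (fun z => g (vadd c z)) x) (1 / u))).
      2:{ intros x Hx. apply in_box in Hx. rewrite rmax_translate; auto; tauto. }
      eapply Rle_trans; [apply (Hloc k (fun z => g (vadd c z))); auto|].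
      apply Rmult_le_compat_l; [apply Rmult_le_pos; lra|]. fold L. fold (V c).
      replace (s / u) with (1 + (s / u - 1)) at 1 by ring. rewrite rpow_plus, rpow_1 by auto.
      apply Rmult_le_compat_l; [auto|]. apply rpow_le; [split; auto|lra].
    - rewrite lsum_scal, lsum_scal_r. apply Rmult_le_compat_l; [apply Rmult_le_pos; lra|].
      replace (s / u) with (1 + (s / u - 1)) at 2 by ring. rewrite rpow_plus, rpow_1 by auto.
      rewrite <- Rmult_assoc. apply Rmult_le_compat_r; [apply rpow_nonneg|auto]. }
  assert (Hbox : INR (length (box d (3 * L))) <= 3 ^ d * INR (length (box d L))).
  { rewrite !length_box, <- Rpow_mult_distr. apply pow_incr. rewrite mult_INR. simpl (INR 3). lra. }
  assert (Hb0 : 0 < INR (length (box d L))) by (rewrite length_box; apply pow_lt; lra).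
  assert (Fin : lsum S F <= C0 * 3 ^ d * (INR L ^ d * rpow Vs (s / u))).
  { apply Rmult_le_reg_l with (INR (length (box d L))); [auto|]. eapply Rle_trans; [exact Main|].
    replace (INR (length (box d L)) * (C0 * 3 ^ d * (INR L ^ d * rpow Vs (s / u))))
      with (C0 * INR L ^ d * (3 ^ d * INR (length (box d L)) * rpow Vs (s / u))) by ring.
    apply Rmult_le_compat_l; [apply Rmult_le_pos; lra|]. apply Rmult_le_compat_r; [apply rpow_nonneg|auto]. }
  eapply Rle_trans; [exact Fin|]. right.
  assert (H3 : 0 < 3 ^ d) by (apply pow_lt; lra).
  rewrite <- (rpow_pos_eq (INR L)) by lra.
  rewrite rpow_mult by (auto; apply Rmult_le_pos; apply rpow_nonneg). rewrite rpow_mult by apply rpow_nonneg.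
  unfold A. rewrite !rpow_rpow by (try apply Rmult_le_pos; lra).
  replace (u * (1 / u)) with 1 by (field; lra). rewrite rpow_1 by (apply Rmult_le_pos; lra).
  rewrite (Rmult_assoc (C0 * 3 ^ d) (rpow (INR L) _)). apply Rmult_eq_compat_l. unfold Vs, Rdiv.
  rewrite rpow_mult by (try apply rpow_nonneg; left; apply Rinv_0_lt_compat; auto).
  rewrite rpow_rpow, rpow_inv by lra.
  rewrite <- !(rpow_nat (INR L) d), rpow_rpow, <- rpow_opp by (try apply rpow_pos; lra).
  replace (1 * / s * (s * / u)) with (1 * / u) by (field; lra).
  rewrite (Rmult_comm (rpow C _)), <- Rmult_assoc, <- rpow_plus by lra. apply Rmult_eq_compat_r. f_equal. field. lra.
Qed.

(** * Necessity *)

(* For negative c, [rpow c q] is 1 because [ln] vanishes there. *)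
Lemma rpow_le_large c q B : 0 <= q -> c <= B -> 1 <= B -> rpow c q <= rpow B q.
Proof.
  intros Hq Hc HB. destruct (Rle_or_lt 0 c) as [H|H]; [apply rpow_le; lra|].
  assert (rpow c q = 1) as ->; [|apply rpow_ge_1; auto].
  unfold rpow. destruct (Req_EM_T c 0); [lra|]. unfold Rpower, ln.
  destruct (Rlt_dec 0 c); [exfalso; lra|]. rewrite Rmult_0_r, exp_0; auto.
Qed.

(** Taking C to be the inverse power of Lambda leaves a bound free of Lambda. Since [A] may be
    negative, it is replaced by |A| + 1. *)
Lemma max_estimate_normalized d s t A : 0 <= t <= 1 -> max_estimate d s t A -> forall k f,
  lp_le d s (fun x => Cmod (f x)) (rpow (INR (2 ^ k)) (- (INR d * ((1 - t) - s)))) ->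
  lp_le d (1 - t) (max_avg d (2 ^ k) f) (Rabs A + 1).
Proof.
  intros Ht H k f Hf.
  assert (HL : 1 <= INR (2 ^ k)).
  { apply (le_INR 1). apply Nat.neq_0_lt_0, Nat.pow_nonzero; lia. }
  specialize (H k f _ (rpow_nonneg _ _) Hf).
  rewrite <- (rpow_pos_eq (INR (2 ^ k))) in H by lra.
  rewrite Rmult_assoc, <- rpow_plus in H by lra.
  replace (INR d * (1 - t - s) + - (INR d * (1 - t - s))) with 0 in H by ring.
  replace (rpow (INR (2 ^ k)) 0) with 1 in H by (rewrite rpow_pos_eq, Rpower_O by lra; auto).
  rewrite Rmult_1_r in H. pose proof (Rle_abs A) as HA. pose proof (Rabs_pos A).
  unfold lp_le in *. destruct (Req_EM_T (1 - t) 0).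
  - intros x Hx. specialize (H x Hx). lra.
  - intros S Hn Hl. specialize (H S Hn Hl). eapply Rle_trans; [exact H|].
    apply rpow_le_large; try lra. left; apply Rdiv_lt_0_compat; lra.
Qed.

(** A positive exponent would make this a geometric progression of ratio 2^b > 1, which Bernoulli's
    inequality shows to be unbounded. *)
Lemma rpow_bounded_exponent b B : (forall k, rpow (INR (2 ^ k)) b <= B) -> b <= 0.
Proof.
  intros H. destruct (Rle_or_lt b 0) as [|Hb]; auto. exfalso.
  set (r := rpow 2 b). assert (Hr : 1 < r).
  { unfold r. rewrite rpow_pos_eq by lra. rewrite <- (Rpower_O 2) by lra. apply Rpower_lt; lra. }
  destruct (INR_unbounded (B / (r - 1))) as [k Hk].
  specialize (H k).
  assert (E : rpow (INR (2 ^ k)) b = r ^ k).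
  { rewrite pow_INR. replace (INR 2) with 2 by (simpl; lra). unfold r.
    rewrite <- (rpow_nat (rpow 2 b)), <- (rpow_nat 2), !rpow_rpow by (try apply rpow_pos; lra). f_equal; ring. }
  rewrite E in H. pose proof (poly k (r - 1) ltac:(lra)) as P.
  replace (1 + (r - 1)) with r in P by ring.
  apply Rmult_lt_compat_r with (r := r - 1) in Hk; [|lra].
  unfold Rdiv in Hk. rewrite Rmult_assoc, Rinv_l in Hk by lra. lra.
Qed.

(** * Most spheres have the expected size *)

Lemma NoDup_spheres d l : NoDup l -> NoDup (flat_map (sphere d) l).
Proof.
  induction l as [|n l IH]; intros Hn; simpl; [constructor|]. inversion Hn; subst.
  apply NoDup_app; [apply NoDup_sphere|auto|].
  intros y Hy Hy'. apply in_flat_map in Hy'. destruct Hy' as (n' & Hn' & Hy').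
  apply in_sphere in Hy, Hy'. assert (n = n') by lia. subst; contradiction.
Qed.

Lemma length_flat_map_INR {A B} (l : list A) (h : A -> list B) :
  INR (length (flat_map h l)) = lsum l (fun a => INR (length (h a))).
Proof.
  rewrite <- (Rmult_1_r (INR _)), <- lsum_const, lsum_flat_map. apply lsum_ext; intros. rewrite lsum_const; ring.
Qed.

Definition typical (d L n : nat) : bool :=
  if Rle_dec (INR (length (sphere d n))) (5 ^ d * INR L ^ (d - 2)) then true else false.

Definition typical_scales (d L : nat) : list nat := filter (typical d L) (seq (L * L) (3 * (L * L))).

(** Chebyshev's inequality: the spheres are disjoint subsets of a box with at most (5L)^d points, so
    at most L^2 of the 3 L^2 scales can exceed the threshold. No upper bound for an individual N(n)
    is required. *)
Lemma typical_scales_count d L : (5 <= d)%nat -> (1 <= L)%nat -> 2 * INR L ^ 2 <= INR (length (typical_scales d L)).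
Proof.
  intros Hd HL. set (l := seq (L * L) (3 * (L * L))).
  assert (HL' : 1 <= INR L) by (apply (le_INR 1); auto).
  set (K := 5 ^ d * INR L ^ (d - 2)).
  assert (HK : 0 < K) by (apply Rmult_lt_0_compat; apply pow_lt; lra).
  assert (Tot : lsum l (fun n => INR (length (sphere d n))) <= INR (length (box d (2 * L)))).
  { rewrite <- length_flat_map_INR. apply le_INR. apply NoDup_incl_length; [apply NoDup_spheres, seq_NoDup|].
    intros y Hy. apply in_flat_map in Hy. destruct Hy as (n & Hn & Hy). apply in_scales in Hn.
    apply in_sphere_box with n; auto. nia. }
  assert (Box : INR (length (box d (2 * L))) <= K * INR L ^ 2).
  { rewrite length_box. unfold K. rewrite Rmult_assoc, <- pow_add. replace (d - 2 + 2)%nat with d by lia.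
    rewrite <- Rpow_mult_distr. apply pow_incr. rewrite mult_INR. simpl (INR 2). lra. }
  set (bad := filter (fun n => negb (typical d L n)) l).
  assert (Bad : INR (length bad) * K <= lsum l (fun n => INR (length (sphere d n)))).
  { rewrite <- lsum_const. apply Rle_trans with (lsum bad (fun n => INR (length (sphere d n)))).
    - apply lsum_le. intros n Hn. apply filter_In in Hn. destruct Hn as [_ Hn]. unfold typical in Hn.
      destruct (Rle_dec _ _); [discriminate|]. fold K in n0. lra.
    - apply lsum_incl; [apply NoDup_filter, seq_NoDup|intros x Hx; apply filter_In in Hx; tauto|intros; apply pos_INR]. }
  assert (Split : INR (length l) = INR (length (typical_scales d L)) + INR (length bad)).
  { rewrite <- (Rmult_1_r (INR (length l))), <- lsum_const, (lsum_split l (typical d L)), !lsum_const. unfold typical_scales, bad, l. ring. }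
  assert (Len : INR (length l) = 3 * INR L ^ 2).
  { unfold l. rewrite length_seq, !mult_INR. simpl. ring. }
  assert (INR (length bad) <= INR L ^ 2).
  { apply Rmult_le_reg_r with K; auto. lra. }
  lra.
Qed.

(** With n = 0 this is a point mass at the origin, so one family serves both tests. *)
Definition sphere_ind (n : Z) (a : R) (x : Zpt) : Cx := ((if Z.eqb (normsq x) n then a else 0), 0).

Lemma Cmod_real a : 0 <= a -> Cmod (a, 0) = a.
Proof. intros Ha. unfold Cmod; cbn [fst snd]. replace (a ^ 2 + 0 ^ 2) with (Rsqr a) by (unfold Rsqr; ring). apply sqrt_Rsqr; auto. Qed.

Lemma Cmod_sphere_ind n a x : 0 <= a -> Cmod (sphere_ind n a x) = if Z.eqb (normsq x) n then a else 0.
Proof. intros Ha. unfold sphere_ind. destruct (Z.eqb _ _); apply Cmod_real; lra. Qed.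

Lemma sphere_ind_lp d s (n : nat) a C : 0 <= s -> 0 <= a -> 0 <= C ->
  (s = 0 -> a <= C) -> (s <> 0 -> INR (length (sphere d n)) * rpow a (1 / s) <= rpow C (1 / s)) ->
  lp_le d s (fun x => Cmod (sphere_ind (Z.of_nat n) a x)) C.
Proof.
  intros Hs Ha HC H0 H1. unfold lp_le. destruct (Req_EM_T s 0) as [E|E].
  - intros x _. rewrite Cmod_sphere_ind, Rabs_right by (try apply Rle_ge; try destruct (Z.eqb _ _); auto; lra).
    destruct (Z.eqb _ _); auto.
  - intros S Hn Hl. eapply Rle_trans; [|apply H1; auto]. rewrite <- lsum_const.
    fold (lsum S (fun x => rpow (Rabs (Cmod (sphere_ind (Z.of_nat n) a x))) (1 / s))).
    rewrite (lsum_split S (fun x => Z.eqb (normsq x) (Z.of_nat n))).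
    rewrite (lsum_zero (filter (fun x => negb _) S)), Rplus_0_r.
    + apply lsum_inj with (fun x => x); [apply NoDup_filter; auto|auto| |intros; apply rpow_nonneg].
      intros x Hx. apply filter_In in Hx. destruct Hx as [Hx E1]. rewrite Forall_forall in Hl. split.
      * apply in_sphere. split; auto. apply Z.eqb_eq; auto.
      * rewrite Cmod_sphere_ind, E1, Rabs_right by (auto; apply Rle_ge; auto). lra.
    + intros x Hx. apply filter_In in Hx. destruct Hx as [_ E1]. rewrite Cmod_sphere_ind by auto.
      destruct (Z.eqb _ _); [discriminate|]. rewrite Rabs_R0, rpow_0. auto.
Qed.

Lemma max_avg_sphere_ind_ge d L m n a x w : 0 <= a -> (L * L <= n < 4 * (L * L))%nat ->
  w <= lsum (sphere d n) (fun y => fst (sphere_ind m a (vsub x y))) ->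
  w / INR (length (sphere d n)) <= max_avg d L (sphere_ind m a) x.
Proof.
  intros Ha Hn Hw.
  apply Rle_trans with (Cmod (sph_avg d n (sphere_ind m a) x)).
  - assert (Hge : forall z, fst z <= Cmod z).
    { intros z. apply le_of_sq_le; [apply Cmod_nonneg|]. rewrite Cmod_sq. pose proof (pow2_ge_0 (snd z)). lra. }
    eapply Rle_trans; [|apply Hge]. unfold sph_avg; cbn [fst].
    apply Rmult_le_compat_r; [apply ravg_inv_nonneg|exact Hw].
  - apply (fmax_ge (seq (L * L) (3 * (L * L))) (fun n => Cmod (sph_avg d n (sphere_ind m a) x))). apply in_scales; auto.
Qed.

Lemma normsq_vsub_self x : normsq (vsub x x) = 0%Z.
Proof.
  induction x as [|a x IH]; auto. change (vsub (a :: x) (a :: x)) with ((a - a)%Z :: vsub x x).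
  change (normsq ((a - a)%Z :: vsub x x)) with ((a - a) * (a - a) + normsq (vsub x x))%Z. rewrite IH, Z.sub_diag. auto.
Qed.

Lemma normsq_vsub_origin d y : length y = d -> normsq (vsub (repeat 0%Z d) y) = normsq y.
Proof.
  revert y. induction d as [|d IH]; intros [|a y] Hy; try discriminate; auto.
  change (vsub (repeat 0%Z (S d)) (a :: y)) with ((0 - a)%Z :: vsub (repeat 0%Z d) y).
  change (normsq ((0 - a)%Z :: vsub (repeat 0%Z d) y)) with ((0 - a) * (0 - a) + normsq (vsub (repeat 0%Z d) y))%Z.
  change (normsq (a :: y)) with (a * a + normsq y)%Z.
  rewrite IH by (injection Hy; auto). ring.
Qed.

(** For the mass a = L^(-d(u-s)) at 0, the maximal function is at least of order a L^(2-d) on the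
    union of the typical spheres, which has at least c L^d points. The norm is thus at least of
    order L^(d u) a L^(2-d) = L^(d s - (d-2)). *)
Lemma necessity_first d s t A : (5 <= d)%nat -> 0 <= s <= 1 -> 0 <= t <= 1 -> max_estimate d s t A ->
  INR d * s <= INR d - 2.
Proof.
  intros Hd Hs Ht HE. set (u := 1 - t).
  assert (Hd' : 5 <= INR d) by (apply (le_INR 5) in Hd; simpl in Hd; lra).
  destruct (sphere_count_ge d Hd) as (c & Hc & HN).
  set (A2 := Rabs A + 1). assert (HA2 : 1 <= A2) by (unfold A2; pose proof (Rabs_pos A); lra).
  assert (H5 : 0 < 5 ^ d) by (apply pow_lt; lra).
  assert (Hcu : 0 < rpow c u) by (apply rpow_pos; auto).
  assert (G : INR d * s - (INR d - 2) <= 0); [|lra].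
  apply rpow_bounded_exponent with (A2 * 5 ^ d / rpow c u). intros k.
  set (L := (2 ^ k)%nat).
  assert (HL1 : (1 <= L)%nat) by (apply Nat.neq_0_lt_0, Nat.pow_nonzero; lia).
  assert (HL' : 1 <= INR L) by (apply (le_INR 1); auto).
  set (a := rpow (INR L) (- (INR d * (u - s)))). assert (Ha : 0 < a) by (apply rpow_pos; lra).
  assert (N0 : INR (length (sphere d 0)) = 1) by (pose proof (repcount_0 d) as R0; exact R0).
  pose proof (max_estimate_normalized d s t A Ht HE k (sphere_ind (Z.of_nat 0) a)) as E.
  fold L in E. fold u in E. fold a in E. fold A2 in E.
  assert (F : lp_le d u (max_avg d L (sphere_ind (Z.of_nat 0) a)) A2).
  { apply E. apply sphere_ind_lp; try lra; intros; rewrite N0; lra. }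
  set (b := a / (5 ^ d * INR L ^ (d - 2))).
  assert (HLd : 0 < INR L ^ (d - 2)) by (apply pow_lt; lra).
  assert (Hb : 0 < b) by (apply Rdiv_lt_0_compat; nra).
  set (S := flat_map (sphere d) (typical_scales d L)).
  assert (HSlow : forall x, In x S -> length x = d /\ b <= max_avg d L (sphere_ind (Z.of_nat 0) a) x).
  { intros x Hx. apply in_flat_map in Hx. destruct Hx as (n & Hn & Hx). apply filter_In in Hn. destruct Hn as [Hn Ty].
    apply in_scales in Hn. apply in_sphere in Hx as Hx'. destruct Hx' as [Hx1 Hx2]. split; auto.
    eapply Rle_trans; [|apply (max_avg_sphere_ind_ge d L (Z.of_nat 0) n a x a); auto; [lra|]].
    - unfold b. apply Rmult_le_compat_l; [lra|]. unfold typical in Ty. destruct (Rle_dec _ _) as [Hle|]; [|discriminate].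
      apply Rinv_le_contravar; auto.
      pose proof (sphere_count_dyadic d c n L Hc HN HL1 ltac:(lia)). 
      assert (0 < c * INR L ^ (d - 2)) by (apply Rmult_lt_0_compat; lra). lra.
    - apply Rle_trans with (fst (sphere_ind (Z.of_nat 0) a (vsub x x))).
      + unfold sphere_ind; cbn [fst]. rewrite normsq_vsub_self. simpl. lra.
      + apply (lsum_ge_term _ (fun y => fst (sphere_ind (Z.of_nat 0) a (vsub x y)))); auto.
        intros y _. unfold sphere_ind; cbn [fst]. destruct (Z.eqb _ _); lra. }
  pose proof (typical_scales_count d L Hd HL1) as TC.
  assert (HScount : c * INR L ^ d <= INR (length S)).
  { unfold S. rewrite length_flat_map_INR.
    apply Rle_trans with (lsum (typical_scales d L) (fun _ => c * INR L ^ (d - 2))).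
    - rewrite lsum_const. replace (INR L ^ d) with (INR L ^ 2 * INR L ^ (d - 2)) by (rewrite <- pow_add; f_equal; lia).
      assert (0 < c * INR L ^ (d - 2)) by (apply Rmult_lt_0_compat; lra).
      assert (0 < INR L ^ 2) by (apply pow_lt; lra). nra.
    - apply lsum_le. intros n Hn. apply filter_In in Hn. destruct Hn as [Hn _]. apply in_scales in Hn.
      apply sphere_count_dyadic; auto; lia. }
  assert (HLdd : 0 < INR L ^ d) by (apply pow_lt; lra).
  assert (HcL : 0 < c * INR L ^ d) by (apply Rmult_lt_0_compat; lra).
  assert (Key : rpow (c * INR L ^ d) u * b <= A2).
  (* For u = 0 the norm is a supremum; the number of points drops out, and one point of [S]
     suffices. *)
  { unfold lp_le in F. destruct (Req_EM_T u 0) as [U|U].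
    - rewrite U. replace (rpow (c * INR L ^ d) 0) with 1 by (rewrite rpow_pos_eq, Rpower_O by lra; auto).
      destruct S as [|x S'] eqn:ES; [simpl in HScount; lra|].
      destruct (HSlow x (or_introl eq_refl)) as [Hx1 Hx2]. specialize (F x Hx1).
      rewrite Rabs_right in F by apply Rle_ge, max_avg_nonneg. lra.
    - assert (Hu : 0 < u) by (unfold u in *; lra).
      assert (Hiu : 0 < 1 / u) by (apply Rdiv_lt_0_compat; lra).
      specialize (F S (NoDup_spheres d _ (NoDup_filter _ (seq_NoDup _ _)))).
      assert (Fl : Forall (fun x => length x = d) S) by (apply Forall_forall; intros x Hx; apply HSlow; auto).
      specialize (F Fl).
      assert (B : c * INR L ^ d * rpow b (1 / u) <= rpow A2 (1 / u)).
      { eapply Rle_trans; [|exact F].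
        apply Rle_trans with (lsum S (fun _ => rpow b (1 / u))).
        - rewrite lsum_const. apply Rmult_le_compat_r; [apply rpow_nonneg|auto].
        - apply lsum_le. intros x Hx. destruct (HSlow x Hx) as [_ Hx2].
          rewrite Rabs_right by apply Rle_ge, max_avg_nonneg. apply rpow_le; lra. }
      assert (B0 : 0 <= c * INR L ^ d * rpow b (1 / u)) by (apply Rmult_le_pos; [lra|apply rpow_nonneg]).
      pose proof (rpow_le _ _ u (conj B0 B) (Rlt_le _ _ Hu)) as B'.
      rewrite rpow_mult, !rpow_rpow in B' by (try apply rpow_nonneg; lra).
      replace (1 / u * u) with 1 in B' by (field; lra). rewrite !rpow_1 in B' by lra. exact B'. }
  assert (Val : rpow (c * INR L ^ d) u * b = rpow c u / 5 ^ d * rpow (INR L) (INR d * s - (INR d - 2))).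
  { unfold b, a. rewrite rpow_mult by lra. rewrite <- (rpow_nat (INR L) d), <- (rpow_nat (INR L) (d - 2)), rpow_rpow by lra.
    rewrite minus_INR by lia. simpl (INR 2).
    replace (INR d * s - (INR d - 2)) with (INR d * u + - (INR d * (u - s)) + - (INR d - 2)) by ring.
    rewrite !(rpow_plus (INR L)), (rpow_opp _ (INR d - 2)) by lra.
    replace (1 + 1) with 2 by ring.
    assert (0 < rpow (INR L) (INR d - 2)) by (apply rpow_pos; lra). field. lra. }
  rewrite Val in Key. apply Rmult_le_reg_l with (rpow c u / 5 ^ d); [apply Rdiv_lt_0_compat; auto|].
  replace (rpow c u / 5 ^ d * (A2 * 5 ^ d / rpow c u)) with A2 by (field; lra). exact Key.
Qed.

(** The average at the origin over the sphere carrying the test function is its full height [a]. A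
    typical sphere has at most K points, K of order L^(d-2), so normalisation allows a = L^(-d(u-s))
    K^(-s), which is of order L^(2s - d u). *)
Lemma necessity_second d s t A : (5 <= d)%nat -> 0 <= s <= 1 -> 0 <= t <= 1 -> max_estimate d s t A ->
  2 * s <= INR d * (1 - t).
Proof.
  intros Hd Hs Ht HE. set (u := 1 - t).
  assert (Hd' : 5 <= INR d) by (apply (le_INR 5) in Hd; simpl in Hd; lra).
  destruct (sphere_count_ge d Hd) as (c & Hc & HN).
  set (A2 := Rabs A + 1). assert (HA2 : 1 <= A2) by (unfold A2; pose proof (Rabs_pos A); lra).
  assert (H5 : 0 < 5 ^ d) by (apply pow_lt; lra).
  assert (H5s : 0 < rpow (5 ^ d) s) by (apply rpow_pos; auto).
  assert (G : 2 * s - INR d * u <= 0); [|lra].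
  apply rpow_bounded_exponent with (A2 * rpow (5 ^ d) s). intros k.
  set (L := (2 ^ k)%nat).
  assert (HL1 : (1 <= L)%nat) by (apply Nat.neq_0_lt_0, Nat.pow_nonzero; lia).
  assert (HL' : 1 <= INR L) by (apply (le_INR 1); auto).
  assert (HLd : 0 < INR L ^ (d - 2)) by (apply pow_lt; lra).
  pose proof (typical_scales_count d L Hd HL1) as TC.
  destruct (typical_scales d L) as [|n l] eqn:ET.
  { simpl in TC. assert (0 < INR L ^ 2) by (apply pow_lt; lra). simpl in *. lra. }
  assert (Hn : In n (typical_scales d L)) by (rewrite ET; left; auto).
  apply filter_In in Hn. destruct Hn as [Hn Ty]. apply in_scales in Hn.
  unfold typical in Ty. destruct (Rle_dec _ _) as [Hle|]; [|discriminate].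
  set (K := 5 ^ d * INR L ^ (d - 2)) in *. assert (HK : 0 < K) by (apply Rmult_lt_0_compat; auto).
  assert (HKs : 0 < rpow K s) by (apply rpow_pos; auto).
  set (R0 := rpow (INR L) (- (INR d * (u - s)))). assert (HR0 : 0 < R0) by (apply rpow_pos; lra).
  set (a := R0 / rpow K s). assert (Ha : 0 < a) by (apply Rdiv_lt_0_compat; auto).
  pose proof (sphere_count_dyadic d c n L Hc HN HL1 ltac:(lia)) as Hlow.
  assert (HcL : 0 < c * INR L ^ (d - 2)) by (apply Rmult_lt_0_compat; lra).
  pose proof (max_estimate_normalized d s t A Ht HE k (sphere_ind (Z.of_nat n) a)) as E.
  fold L in E. fold u in E. fold R0 in E. fold A2 in E.
  assert (F : lp_le d u (max_avg d L (sphere_ind (Z.of_nat n) a)) A2).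
  { apply E. apply sphere_ind_lp; try lra.
    - intros S0. unfold a. rewrite S0. rewrite (rpow_pos_eq K), Rpower_O by auto. lra.
    - intros S0. apply Rle_trans with (K * rpow a (1 / s)); [apply Rmult_le_compat_r; [apply rpow_nonneg|auto]|].
      right. unfold a, Rdiv. assert (0 < / rpow K s) by (apply Rinv_0_lt_compat; auto).
      rewrite rpow_mult, rpow_inv, rpow_rpow by lra. replace (s * (1 * / s)) with 1 by (field; lra).
      rewrite rpow_1 by lra. field. lra. }
  set (o := repeat 0%Z d). assert (Ho : length o = d) by apply repeat_length.
  assert (Hao : a <= max_avg d L (sphere_ind (Z.of_nat n) a) o).
  { eapply Rle_trans; [|apply (max_avg_sphere_ind_ge d L (Z.of_nat n) n a o (INR (length (sphere d n)) * a)); auto; [lra|]].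
    - right. field. lra.
    - rewrite <- lsum_const. apply lsum_le. intros y Hy. apply in_sphere in Hy. destruct Hy as [Hy1 Hy2].
      unfold sphere_ind; cbn [fst]. unfold o. rewrite normsq_vsub_origin, Hy2, Z.eqb_refl by auto. lra. }
  assert (Key : a <= A2).
  { unfold lp_le in F. destruct (Req_EM_T u 0) as [U|U].
    - specialize (F o Ho). rewrite Rabs_right in F by apply Rle_ge, max_avg_nonneg. lra.
    - assert (Hu : 0 < u) by (unfold u in *; lra).
      assert (Hiu : 0 < 1 / u) by (apply Rdiv_lt_0_compat; lra).
      specialize (F [o] ltac:(repeat constructor; auto) ltac:(repeat constructor; auto)).
      simpl in F. rewrite Rplus_0_r, Rabs_right in F by apply Rle_ge, max_avg_nonneg.
      assert (B : rpow a (1 / u) <= rpow A2 (1 / u)).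
      { eapply Rle_trans; [|exact F]. apply rpow_le; lra. }
      pose proof (rpow_le _ _ u (conj (rpow_nonneg _ _) B) (Rlt_le _ _ Hu)) as B'.
      rewrite !rpow_rpow in B' by lra. replace (1 / u * u) with 1 in B' by (field; lra). rewrite !rpow_1 in B' by lra. exact B'. }
  assert (Val : rpow (INR L) (2 * s - INR d * u) = a * rpow (5 ^ d) s).
  { unfold a, K, R0. rewrite (rpow_mult (5 ^ d)) by lra. rewrite <- (rpow_nat (INR L) (d - 2)), rpow_rpow by lra.
    rewrite minus_INR by lia. simpl (INR 2).
    replace (2 * s - INR d * u) with (- (INR d * (u - s)) + - ((INR d - (1 + 1)) * s)) by ring.
    rewrite rpow_plus, (rpow_opp _ ((INR d - (1 + 1)) * s)) by lra.
    assert (0 < rpow (INR L) ((INR d - (1 + 1)) * s)) by (apply rpow_pos; lra). field. lra. }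
  rewrite Val. apply Rmult_le_compat_r; [lra|exact Key].
Qed.

Theorem mainTheorem1 (d : nat) (hd : (5 <= d)%nat) :
  (forall s t : R, regionR d s t -> exists A : R, max_estimate d s t A) /\
  (forall s t : R, 0 <= s <= 1 -> 0 <= t <= 1 ->
     (exists A : R, max_estimate d s t A) ->
     Rmax (s + 2 / INR d) (t + 2 * s / INR d) <= 1).
Proof.
  split.
  - intros s t. apply max_estimate_sufficiency; auto.
  - intros s t Hs Ht (A & HA).
    pose proof (necessity_first d s t A hd Hs Ht HA) as N1.
    pose proof (necessity_second d s t A hd Hs Ht HA) as N2.
    assert (Hd' : 5 <= INR d) by (apply (le_INR 5) in hd; simpl in hd; lra).
    apply Rmax_lub; apply Rmult_le_reg_r with (INR d); try lra.
    + replace ((s + 2 / INR d) * INR d) with (INR d * s + 2) by (field; lra). lra.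
    + replace ((t + 2 * s / INR d) * INR d) with (INR d * t + 2 * s) by (field; lra). lra.
Qed.
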